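(* Let $k\ge1$, let $1\le q_1<\dots<q_k$ be integers and let $F=\sum_{i=1}^k I_{q_i}(f_i)$ (so $E[F]=0$), where each $f_i$ is a nonzero element of $L^2_s(\mu^{q_i})$, $f_i\ge0$ for every $i$, and the family $\{f_i\}$ satisfies the technical assumptions (i)–(iii) listed in the context. Let $\sigma^2=E[F^2]>0$. Then there exists a constant $C_2=C_2(q_1,\dots,q_k)$, depending only on $q_1,\dots,q_k$, such that $$\max_1\|f_i\star_r^l f_i\|_{L^2(\mu^{2q_i-r-l})}+\max_{i=1,\dots,k}\|f_i\|^2_{L^4(\mu^{q_i})}\le C_2\sqrt{E[F^4]-3\sigma^4},$$ where $\max_1$ ranges over all $1\le i\le k$ such that $q_i>1$ and all pairs $(r,l)$ with $r\in\{1,\dots,q_i\}$ and $1\le l\le r\wedge(q_i-1)$ (a maximum over an empty set is $0$).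
   Context: $(Z,\mathscr Z,\mu)$ is a Borel space with its Borel $\sigma$-field and a $\sigma$-finite measure $\mu$ without atoms. $\eta$ is a Poisson measure on $Z$ with control $\mu$: $\eta(B)$ is Poisson with mean $\mu(B)$ whenever $\mu(B)<\infty$, and $\eta(B),\eta(C)$ are independent for disjoint $B,C$; $\hat\eta=\eta-\mu$. $L^2_s(\mu^q)$ is the space of $\mu^q$-a.e. symmetric functions in $L^2(\mu^q)$, and $I_q(f)$ is the multiple Wiener–Itô integral of order $q$ of $f\in L^2_s(\mu^q)$ with respect to $\hat\eta$, normalized so that $E[I_q(f)I_m(g)]=q!\langle f,g\rangle_{L^2(\mu^q)}\mathbf 1_{q=m}$. Contractions: for $f$ and $g$ symmetric functions of $p$ and $q$ variables, $0\le l\le r\le p\wedge q$, $$f\star_r^l g(\gamma_1,\dots,\gamma_{r-l},t_1,\dots,t_{p-r},s_1,\dots,s_{q-r})=\int_{Z^l}f(z_1,\dots,z_l,\gamma_1,\dots,\gamma_{r-l},t_1,\dots,t_{p-r})\,g(z_1,\dots,z_l,\gamma_1,\dots,\gamma_{r-l},s_1,\dots,s_{q-r})\,\mu^l(dz_1,\dots,dz_l),$$ with no integration when $l=0$. Technical assumptions on $\{f_i:i=1,\dots,k\}$: (i) for every $i$ and every $r=1,\dots,q_i$, the kernel $f_i\star_{q_i}^{q_i-r}f_i$ is in $L^2(\mu^r)$; (ii) for every $i$ with $q_i\ge2$, every $r=1,\dots,q_i$ and $l=1,\dots,r$, the contraction $|f_i|\star_r^l|f_i|(z_1,\dots,z_{2q_i-r-l})$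 is well defined and finite at every $(z_1,\dots,z_{2q_i-r-l})\in Z^{2q_i-r-l}$; (iii) for every $i,j$ with $\max(q_i,q_j)>1$, every integer $m$ with $|q_i-q_j|\vee1\le m\le q_i+q_j-2$, and every $(r,l)$ (with $0\le l\le r\le q_i\wedge q_j-1$) such that $m=q_i+q_j-2-r-l$, $$\int_Z\Big[\int_{Z^m}(f_i(z,\cdot)\star_r^l f_j(z,\cdot))^2\,d\mu^m\Big]^{1/2}\mu(dz)<\infty,$$ where $f_i(z,\cdot)$ is the function of $q_i-1$ variables obtained by fixing one argument equal to $z$. *)

(* Defs.v *)
From HB Require Import structures.
From mathcomp Require Import all_boot all_order all_algebra perm.
From mathcomp Require Import all_classical all_reals all_analysis measurable_realfun.
Set Implicit Arguments.
Unset Strict Implicit.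
Unset Printing Implicit Defensive.
Import Order.TTheory GRing.Theory Num.Theory.
Import numFieldNormedType.Exports.
Local Open Scope classical_set_scope.
Local Open Scope ring_scope.

Section power_measure.
Context {d : measure_display} {Z : measurableType d} {R : realType}.
Variable mu : {sigma_finite_measure set Z -> \bar R}.

Definition tcons n (p : Z * n.-tuple Z) : n.+1.-tuple Z := [tuple of p.1 :: p.2].

Lemma measurable_tcons n : measurable_fun setT (@tcons n).
Proof. exact: measurable_cons measurable_fst measurable_snd. Qed.

Section step.
Variables (n : nat) (nu : {sigma_finite_measure set (n.-tuple Z) -> \bar R}).

Definition cons_measure : set (n.+1.-tuple Z) -> \bar R :=
  pushforward (mu \x nu)%E (@tcons n).

Let cons_measure0 : cons_measure set0 = 0%E.
Proof. by rewrite /cons_measure /pushforward preimage_set0 measure0. Qed.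

Let cons_measure_ge0 A : (0 <= cons_measure A)%E.
Proof. by rewrite /cons_measure /pushforward. Qed.

Let cons_measure_sigma_additive : semi_sigma_additive cons_measure.
Proof.
move=> F mF tF mUF; rewrite /cons_measure /pushforward preimage_bigcup.
have mtF i : measurable (@tcons n @^-1` F i).
  by rewrite -[X in measurable X]setTI; exact: measurable_tcons.
apply: measure_semi_sigma_additive => //.
- apply/trivIsetP => /= i j _ _ ij; rewrite -preimage_setI.
  by move/trivIsetP : tF => /(_ _ _ _ _ ij) ->//; rewrite preimage_set0.
- by rewrite -preimage_bigcup -[X in measurable X]setTI; exact: measurable_tcons.
Qed.

HB.instance Definition _ := isMeasure.Build _ _ _ cons_measure
  cons_measure0 cons_measure_ge0 cons_measure_sigma_additive.

Let cons_measure_sigma_finite : sigma_finite setT cons_measure.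
Proof.
have /sigma_finiteP[F [FT ndF Foo]] := sigma_finiteT mu.
have /sigma_finiteP[G [GT ndG Goo]] := sigma_finiteT nu.
exists (fun i => [set t | F i (thead t) /\ G i [tuple of behead t]]).
  apply/esym; rewrite -subTset => t _.
  have [i _ Fi] : (\bigcup_i F i) (thead t) by rewrite -FT.
  have [j _ Gj] : (\bigcup_i G i) [tuple of behead t] by rewrite -GT.
  exists (maxn i j) => //; split.
  - by move: Fi; exact/subsetPset/ndF/leq_maxl.
  - by move: Gj; exact/subsetPset/ndG/leq_maxr.
move=> i; have [mF Fi] := Foo i; have [mG Gi] := Goo i; split.
  apply: measurableI; rewrite -[X in measurable X]setTI.
  - exact: (measurable_tnth ord0).
  - exact: measurable_behead.
rewrite /= /cons_measure /pushforward.
rewrite (_ : _ @^-1` _ = F i `*` G i); last first.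
  rewrite /tcons; apply/seteqP; split => -[z t] /= [Fz Gt]; split => //;
    move: Gt; congr (G i _); exact: val_inj.
by rewrite product_measure1E// lte_mul_pinfty// ge0_fin_numE.
Qed.

HB.instance Definition _ := Measure_isSigmaFinite.Build _ _ _ cons_measure
  cons_measure_sigma_finite.

End step.

Fixpoint power_measure n : {sigma_finite_measure set (n.-tuple Z) -> \bar R} :=
  match n with
  | 0%N => dirac [tuple]
  | n'.+1 => cons_measure (power_measure n')
  end.

Lemma power_measure_box n (B : 'I_n -> set Z) :
  (forall i, measurable (B i)) ->
  power_measure n [set x | forall i, B i (tnth x i)] = (\prod_(i < n) mu (B i))%E.
Proof.
elim: n B => [|n IHn] B mB.
  by rewrite big_ord0 /= diracE mem_set//= => -[].
rewrite big_ord_recl -IHn//= /cons_measure /pushforward.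
rewrite -product_measure1E//; last first.
  rewrite (_ : [set _ | _] = \bigcap_(i in [set: 'I_n])
    ((@tnth n Z ^~ i) @^-1` B (lift ord0 i))).
    apply: fin_bigcap_measurable => // i _.
    by rewrite -[X in measurable X]setTI; exact: measurable_tnth.
  by apply/seteqP; split => x /= Bx i; [move=> _|]; exact: Bx.
congr ((mu \x power_measure n)%E _); apply/seteqP; split => -[z t] /=.
  move=> Bzt; split; first exact: (Bzt ord0).
  by move=> i; have := Bzt (lift ord0 i); rewrite tnthS.
move=> [Bz Bt] i; case: (unliftP ord0 i) => [j ->|->//].
by rewrite tnthS.
Qed.

End power_measure.

Section poisson_measure.
Context {d dO : measure_display} {Z : measurableType d} {Omega : measurableType dO}.
Context {R : realType}.
Local Open Scope ereal_scope.

(* Z is Borel isomorphic to a Borel subset of the real line. *)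
Definition borel_space : Prop :=
  exists h : Z -> R, [/\ injective h, measurable_fun setT h &
    forall A, measurable A -> measurable (h @` A)].

(* mu has no atom, an atom being a measurable set A of positive measure such
   that every measurable subset of A is null or has a null complement in A. *)
Definition no_atoms (mu : set Z -> \bar R) : Prop :=
  forall A, measurable A -> 0 < mu A ->
    exists B, [/\ measurable B, B `<=` A, 0 < mu B & 0 < mu (A `\` B)].

Definition independent_rv (P : probability Omega R) (X Y : Omega -> \bar R) : Prop :=
  forall U V : set (\bar R), measurable U -> measurable V ->
    P (X @^-1` U `&` Y @^-1` V) = P (X @^-1` U) * P (Y @^-1` V).

(* A random measure is a kernel from the probability space to Z.  The second
   argument of poisson_prob is unused; poisson_prob 0 is the Dirac mass at 0
   (unlike poisson_pmf 0, which is constantly 1). *)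
Definition poisson_measure (P : probability Omega R) (mu : set Z -> \bar R)
    (eta : R.-ker Omega ~> Z) : Prop :=
  (forall B, measurable B -> mu B < +oo -> forall n : nat,
     P [set w | eta w B = n%:R%:E] = poisson_prob (fine (mu B)) 0%N [set n]) /\
  (forall B C, measurable B -> measurable C -> [disjoint B & C]%classic ->
     independent_rv P (eta ^~ B) (eta ^~ C)).

End poisson_measure.
Arguments borel_space {d} Z R.

Section multiple_integral.
Context {d dO : measure_display} {Z : measurableType d} {Omega : measurableType dO}.
Context {R : realType}.
Variable mu : {sigma_finite_measure set Z -> \bar R}.

(* The off-diagonal step function
     \sum_(j injective) c_j 1_(B_(j 0)) (x 0) ... 1_(B_(j (q - 1))) (x (q - 1))
   with pairwise disjoint B_0, ..., B_(n - 1) of finite measure. *)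
Record step_kernel (q : nat) := StepKernel {
  sk_size : nat ;
  sk_set : 'I_sk_size -> set Z ;
  sk_coef : {ffun 'I_q -> 'I_sk_size} -> R ;
  sk_measurable : forall a, measurable (sk_set a) ;
  sk_finite : forall a, (mu (sk_set a) < +oo)%E ;
  sk_disjoint : forall a b, a != b -> [disjoint sk_set a & sk_set b]%classic
}.

Definition sk_fun q (e : step_kernel q) (x : q.-tuple Z) : R :=
  \sum_(j : {ffun 'I_q -> 'I_(sk_size e)} | injectiveb j)
    sk_coef j * \prod_(i < q) \1_(sk_set (j i)) (tnth x i).

Definition compensated (eta : R.-ker Omega ~> Z) (B : set Z) (w : Omega) : R :=
  fine (eta w B) - fine (mu B).

Definition sk_integral (eta : R.-ker Omega ~> Z) q (e : step_kernel q)
    (w : Omega) : R :=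
  \sum_(j : {ffun 'I_q -> 'I_(sk_size e)} | injectiveb j)
    sk_coef j * \prod_(i < q) compensated eta (sk_set (j i)) w.

(* X is a version of I_q(f): I_q is the continuous extension to L2 of
   sk_integral. *)
Definition is_multiple_integral (P : probability Omega R)
    (eta : R.-ker Omega ~> Z) q (f : q.-tuple Z -> R) (X : {RV P >-> R}) : Prop :=
  exists e : nat -> step_kernel q,
    ('N[power_measure mu q]_2%:E[EFin \o (f \- sk_fun (e n))%R]
       @[n --> \oo] --> 0)%E /\
    ('N[P]_2%:E[EFin \o (X \- sk_integral eta (e n))%R]
       @[n --> \oo] --> 0)%E.

Definition L2_symmetric q (f : q.-tuple Z -> R) : Prop :=
  f \in Lfun (power_measure mu q) 2%:E /\
  forall s : 'S_q,
    {ae power_measure mu q, forall x, f [tuple tnth x (s i) | i < q] = f x}.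

End multiple_integral.

Section contractions.
Context {d : measure_display} {Z : measurableType d} {R : realType}.
Variable mu : {sigma_finite_measure set Z -> \bar R}.

(* f evaluated at the list s of its arguments; the default value point is only
   reached when s has fewer than n entries. *)
Definition apply_seq n (f : n.-tuple Z -> R) (s : seq Z) : R :=
  f [tuple nth point s i | i < n].

(* The contraction of f and g with indices r and l, for l <= r <= minn p q, at
   y = (gamma, t, s) where gamma, t and s have lengths r - l, p - r and q - r;
   it is to be used with m = p + q - r - l.  For l = 0 the measure
   power_measure mu 0 is the Dirac mass at the empty tuple. *)
Definition star_contraction p q (f : p.-tuple Z -> R) (g : q.-tuple Z -> R)
    (r l : nat) {m : nat} (y : m.-tuple Z) : \bar R :=
  let gamma := take (r - l) y in
  let t := take (p - r) (drop (r - l) y) in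
  let s := drop ((r - l) + (p - r)) y in
  (\int[power_measure mu l]_z
     (apply_seq f (z ++ gamma ++ t) * apply_seq g (z ++ gamma ++ s))%:E)%E.

Definition fix_arg n (f : n.-tuple Z -> R) (z : Z) (t : n.-1.-tuple Z) : R :=
  apply_seq f (z :: t).

Section assumptions.
Variables (k : nat) (q : 'I_k -> nat) (f : forall i, (q i).-tuple Z -> R).
Local Open Scope ereal_scope.

Definition assumption_i : Prop :=
  forall (i : 'I_k) (r : nat), (1 <= r <= q i)%N ->
    'N[power_measure mu r]_2%:E[star_contraction (@f i) (@f i) (q i) (q i - r)] < +oo.

Definition assumption_ii : Prop :=
  forall (i : 'I_k) (r l : nat), (2 <= q i)%N -> (1 <= r <= q i)%N ->
    (1 <= l <= r)%N ->
    forall y : (2 * q i - r - l).-tuple Z,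
      star_contraction (fun x => `|@f i x|%R) (fun x => `|@f i x|%R) r l y < +oo.

Definition assumption_iii : Prop :=
  forall (i j : 'I_k) (m r l : nat), (1 < maxn (q i) (q j))%N ->
    (maxn `|q i - q j| 1 <= m <= q i + q j - 2)%N ->
    (l <= r <= (minn (q i) (q j)).-1)%N ->
    m = (q i + q j - 2 - r - l)%N ->
    \int[mu]_z 'N[power_measure mu m]_2%:E[
      star_contraction (fix_arg (@f i) z) (fix_arg (@f j) z) r l] < +oo.

End assumptions.
End contractions.

(* Main.v *)
(** On a finite family of disjoint blocks of finite measure, let G be the sum of
the multiple integrals of the off-diagonal block averages of the kernels.  Then G
is the L2-projection of F onto such step sums: F - G is orthogonal to the
multilinear monomials in the compensated block masses, and has nonnegative mean
against all monomials because the kernels are nonnegative.  By convexity of the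
fourth power, E F^4 >= E G^4 + 4 E (F - G) G^3 >= E G^4.

The masses of disjoint blocks are mutually independent: the hypothesis only gives
independence of pairs, but void probabilities on finer and finer partitions
determine the joint law because mu has no atoms (Renyi).  Hence
E G^4 - 3 (E G^2)^2 expands over quadruples of words in the blocks, and every term
is nonnegative.  Keeping the quadruples whose coordinates are identified by given
maps s1, s2, s3, s4, under which each block occurs two or four times, bounds the
integral of g(x o s1) g(x o s2) g(x o s3) g(x o s4) for the block averages g of a
kernel, and Fatou's lemma carries the bound over to the kernel itself.  By Tonelli
this integral is, for suitable maps, the integral of f^4 or the squared norm of a
contraction, so that C2 = 2 works. *)
Require Import Defs.
From HB Require Import structures.
From mathcomp Require Import all_boot all_order all_algebra perm.
From mathcomp Require Import all_classical all_reals all_analysis measurable_realfun.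
From mathcomp Require Import ring lra zify.
Set Implicit Arguments.
Unset Strict Implicit.
Unset Printing Implicit Defensive.
Import Order.TTheory GRing.Theory Num.Theory.
Import numFieldNormedType.Exports.
Local Open Scope classical_set_scope.
Local Open Scope ring_scope.

(** * Joint moments over words *)

(** All signs come from one source: the recursion for the moments of a centered Poisson variable has
    nonnegative coefficients. The same integration by parts, E[xi_i Psi] = lam_i E[D_i Psi] with D_i
    the add-one difference, removes the letters of a step integral one by one from a monomial in the
    blocks. What remains are integrals of the kernel over boxes, with nonnegative weights that
    vanish on a box with a repeated block when the monomial has no repeated letter; this gives both
    the orthogonality and the sign of F - G.

    In the fourth cumulant every surviving pairing of words is subtracted, and the fourth moment lam
    + 3 lam^2 has to pay for it: 3 lam^2 covers three pairings, and the surplus lam leaves room for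
    the lower bound. That bound must also hold when several coordinates fall into one block.

    F is only an L2 limit and F^4 may fail to be integrable, so the comparison is made for fixed
    blocks, where G is a polynomial with all moments. Apart from the kernels only E F^2 is
    approximated, and G does so at least as well as the given step integrals. *)

Section moments.
Context {R : realFieldType} {I : finType}.
Variables (m : I -> nat -> R) (lam : I -> R).
Hypothesis lam_ge0 : forall c, 0 <= lam c.
Hypothesis m0 : forall c, m c 0%N = 1.
Hypothesis m1 : forall c, m c 1%N = 0.
Hypothesis m2 : forall c, m c 2%N = lam c.
Hypothesis m3 : forall c, 0 <= m c 3%N.
Hypothesis m4 : forall c, m c 4%N = lam c + 3 * lam c ^+ 2.

(** The mean of a monomial in independent variables x_c with moments [m c n]; a word lists the
    factors with multiplicity. The hypotheses on [m] are those of a centered Poisson variable of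
    mean [lam c]. *)
Definition word_moment (s : seq I) : R := \prod_c m c (count_mem c s).

(** The mixed moment of four monomials minus the three pairings that a Gaussian family would give
    (Wick). *)
Definition word_cumulant (s1 s2 s3 s4 : seq I) : R :=
  word_moment (s1 ++ s2 ++ s3 ++ s4) - word_moment (s1 ++ s2) * word_moment (s3 ++ s4)
  - word_moment (s1 ++ s3) * word_moment (s2 ++ s4)
  - word_moment (s1 ++ s4) * word_moment (s2 ++ s3).

Lemma m_ge0 c n : (n <= 4)%N -> 0 <= m c n.
Proof.
case: n => [|[|[|[|[|//]]]]] _; rewrite ?m0 ?m1 ?m2 ?m4 ?addr_ge0 ?mulr_ge0 ?exprn_ge0//.
Qed.

(** A letter that occurs in only one of two repetition-free words contributes the first moment,
    which is 0. So distinct square-free monomials are orthogonal. *)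
Lemma word_moment_pair (s t : seq I) : uniq s -> uniq t ->
  word_moment (s ++ t) = if perm_eq s t then \prod_c lam c ^+ count_mem c s else 0.
Proof.
move=> us ut; case: ifP => st.
  apply: eq_bigr => c _; rewrite count_cat -(seq.permP st) (count_uniq_mem _ us).
  by case: (c \in s); rewrite ?m0 ?m2.
have [c cst] : exists c, (c \in s) != (c \in t).
  apply/existsP; apply: contraT; rewrite negb_exists => /forallP st'.
  have /uniq_perm : s =i t by move=> c; apply/eqP; have := st' c; rewrite negbK.
  by rewrite st => /(_ us ut).
apply/eqP; rewrite prodf_seq_eq0; apply/hasP; exists c; rewrite ?mem_index_enum//=.
rewrite count_cat !count_uniq_mem//.
by move: cst; case: (c \in s); case: (c \in t) => // _; rewrite /= m1.
Qed.

Let prodD1 c0 (F : I -> R) : \prod_c F c = F c0 * \prod_(c | c != c0) F c.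
Proof. exact: bigD1. Qed.

Let prodD2 c0 c1 (F : I -> R) : c0 != c1 ->
  \prod_(c | c != c0) F c = F c1 * \prod_(c | (c != c0) && (c != c1)) F c.
Proof. by move=> c01; apply: bigD1; rewrite eq_sym. Qed.

(** Room for both products is needed at a single index only: once [c0] is factored out, the product
    of [F] over the other indices dominates both remainders. This is how subtracted pairings are
    absorbed below. *)
Lemma prod_split_ge (F U V : I -> R) (c0 : I) :
  (forall c, 0 <= U c) -> (forall c, 0 <= V c) ->
  (forall c, U c <= F c) -> (forall c, V c <= F c) -> U c0 + V c0 <= F c0 ->
  \prod_c U c + \prod_c V c <= \prod_c F c.
Proof.
move=> U0 V0 UF VF UVF; rewrite !(prodD1 c0).
apply: (@le_trans _ _ ((U c0 + V c0) * \prod_(c | c != c0) F c)).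
  by rewrite mulrDl lerD// ler_wpM2l// ler_prod// => c _; rewrite ?U0 ?V0 ?UF ?VF.
by rewrite ler_wpM2r// prodr_ge0// => c _; exact: le_trans (UF c).
Qed.

Section four_words.
Variables s1 s2 s3 s4 : seq I.
Hypotheses (u1 : uniq s1) (u2 : uniq s2) (u3 : uniq s3) (u4 : uniq s4).
Let n c := count_mem c (s1 ++ s2 ++ s3 ++ s4).

Let nE c : n c = ((c \in s1) + (c \in s2) + (c \in s3) + (c \in s4))%N.
Proof. by rewrite /n !count_cat !count_uniq_mem// !addnA. Qed.

Let P := \prod_c lam c ^+ (n c)./2.

(** The condition under which some pairing in [word_cumulant] survives, by [word_moment_pair]. *)
Definition split_pairs := [|| perm_eq s1 s2 && perm_eq s3 s4,
  perm_eq s1 s3 && perm_eq s2 s4 | perm_eq s1 s4 && perm_eq s2 s3].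

(** Every surviving pairing has the same value [P]: when the words match in pairs, each letter has
    half of its [n c] occurrences in the two pair products as a power of [lam]. *)
Let pairP a b c d : uniq a -> uniq b -> uniq c -> uniq d ->
  perm_eq (s1 ++ s2 ++ s3 ++ s4) (a ++ b ++ c ++ d) ->
  word_moment (a ++ b) * word_moment (c ++ d) =
    (if perm_eq a b && perm_eq c d then P else 0).
Proof.
move=> ua ub uc ud /seq.permP E; rewrite !word_moment_pair//.
have [ab|_] /= := boolP (perm_eq a b); last by rewrite mul0r.
have [cd|_] /= := boolP (perm_eq c d); last by rewrite mulr0.
rewrite -big_split; apply: eq_bigr => x _ /=; rewrite -exprD; congr (_ ^+ _).
have -> : n x = (count_mem x a + count_mem x c).*2.
  rewrite /n E !count_cat (seq.permP ab) (seq.permP cd) -addnn.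
  by move: (count _ b) (count _ d) => u v; rewrite addnA addnACA.
by rewrite doubleK.
Qed.

Lemma word_cumulantE : word_cumulant s1 s2 s3 s4 = \prod_c m c (n c) -
  P *+ (perm_eq s1 s2 && perm_eq s3 s4) - P *+ (perm_eq s1 s3 && perm_eq s2 s4)
  - P *+ (perm_eq s1 s4 && perm_eq s2 s3).
Proof.
rewrite /word_cumulant !pairP//; last 2 first.
- by apply/seq.permP => x; rewrite !count_cat; lia.
- by apply/seq.permP => x; rewrite !count_cat; lia.
by do 3 case: ifP => _; rewrite ?mulr1n ?mulr0n.
Qed.

Lemma split_pairs_count c : split_pairs -> n c \in [:: 0; 2; 4]%N.
Proof.
rewrite nE => /or3P[]/andP[/perm_mem e /perm_mem e'];
  rewrite e e'; do ?[case: (_ \in _) => //].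
Qed.

Let kappa : nat := ((perm_eq s1 s2 && perm_eq s3 s4) +
  (perm_eq s1 s3 && perm_eq s2 s4) + (perm_eq s1 s4 && perm_eq s2 s3))%N.

(** Two surviving pairings force all four words to have the same letters, so that each letter of
    [s1] occurs four times. *)
Let kappa_cases : [\/ kappa = 0%N, kappa = 1%N /\ split_pairs |
  [/\ (kappa <= 3)%N, split_pairs & forall c, (n c == 4)%N = (c \in s1)]].
Proof.
rewrite /kappa /split_pairs.
have all4 : perm_eq s1 s2 -> perm_eq s1 s3 -> perm_eq s1 s4 ->
    forall c, (n c == 4)%N = (c \in s1).
  by move=> /perm_mem e2 /perm_mem e3 /perm_mem e4 c; rewrite nE -e2 -e3 -e4; case: (c \in s1).
case/boolP: (perm_eq s1 s2 && perm_eq s3 s4) => [/andP[e12 e34]|n1];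
case/boolP: (perm_eq s1 s3 && perm_eq s2 s4) => [/andP[e13 e24]|n2];
case/boolP: (perm_eq s1 s4 && perm_eq s2 s3) => [/andP[e14 e23]|n3] /=;
  do ?[by constructor 1]; do ?[by constructor 2]; constructor 3; split => //; apply: all4 => //.
- exact: perm_trans e13 e34.
- by apply: perm_trans e14 _; rewrite perm_sym.
- by apply: perm_trans e13 _; rewrite perm_sym.
Qed.

Let cumulant_kappa : word_cumulant s1 s2 s3 s4 = \prod_c m c (n c) - P *+ kappa.
Proof. by rewrite word_cumulantE /kappa !mulrnDr !opprD !addrA. Qed.

Let n_le4 c : (n c <= 4)%N.
Proof. by rewrite nE; do 4 case: (_ \in _). Qed.

Let half_le : split_pairs -> forall c, lam c ^+ (n c)./2 <= m c (n c).
Proof.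
move=> sp c; have := split_pairs_count c sp; rewrite !inE => /or3P[]/eqP->;
  rewrite ?m0 ?m2 ?m4 ?expr0 ?expr1//=.
by have := lam_ge0 c; nra.
Qed.

Let P_ge0 : 0 <= P. Proof. by apply: prodr_ge0 => c _; rewrite exprn_ge0. Qed.

(** Without a surviving pairing only a nonnegative moment is left. One pairing is dominated letter
    by letter. Three pairings are dominated at a letter with four occurrences, where 3 lam^2 <= lam
    + 3 lam^2. Nonempty words are essential: four empty words have cumulant 1 - 3. *)
Lemma word_cumulant_ge0 : s1 != [::] -> 0 <= word_cumulant s1 s2 s3 s4.
Proof.
move=> s1N; rewrite cumulant_kappa subr_ge0; case: kappa_cases => [->|[->] sp|[k3 sp nc4]].
- by rewrite mulr0n prodr_ge0// => c _; rewrite m_ge0.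
- by rewrite mulr1n ler_prod// => c _; rewrite exprn_ge0//= half_le.
- case: s1 s1N nc4 => // c0 s _ nc4; have /eqP n4 : (n c0 == 4)%N by rewrite nc4 mem_head.
  apply: (@le_trans _ _ (P *+ 3)); first by rewrite ler_wpMn2l.
  rewrite /P !(prodD1 c0) -mulrnAl n4/= m4; apply: ler_pM => //.
  + by rewrite mulrn_wge0// exprn_ge0.
  + by apply: prodr_ge0 => c _; rewrite exprn_ge0.
  + by rewrite -mulr_natl; have := lam_ge0 c0; lra.
  + by apply: ler_prod => c _; rewrite exprn_ge0//= half_le.
Qed.

(** A letter with four occurrences is where the moment exceeds the pairing, hence the second
    condition. The third one concerns three pairings at once: at a single letter with [p c] = 2 the
    sum lam^2 + 3 lam^2 may exceed lam + 3 lam^2, so either two letters share the cost or [p] is at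
    most 1. *)
Lemma word_cumulant_ge (p : I -> nat) :
  (forall c, (n c, p c) \in [:: (0, 0); (2, 1); (4, 1); (4, 2)]%N) ->
  (split_pairs -> exists c, n c = 4%N) ->
  ((exists c c', [/\ c \in s1, c' \in s1 & c != c']) \/ forall c, (p c <= 1)%N) ->
  \prod_c lam c ^+ p c <= word_cumulant s1 s2 s3 s4.
Proof.
move=> np sp4 H; rewrite cumulant_kappa lerBrDr.
have Ule c : lam c ^+ p c <= m c (n c).
  have := np c; rewrite !inE => /or4P[]/eqP[-> ->]; rewrite ?m0 ?m2 ?m4//=;
  by have := lam_ge0 c; nra.
have U0 c : 0 <= lam c ^+ p c by rewrite exprn_ge0.
have p2 c : n c = 4%N -> lam c ^+ p c + lam c ^+ 2 *+ 2 <= m c (n c).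
  have := np c; rewrite !inE => /or4P[]/eqP[-> ->]//= _; rewrite m4;
  by have := lam_ge0 c; have := sqr_ge0 (lam c); rewrite mulr2n; lra.
case: kappa_cases => [->|[->] sp|[k3 sp nc4]].
- by rewrite mulr0n addr0 ler_prod// => c _; rewrite U0 Ule.
- have [c0 n4] := sp4 sp.
  apply: le_trans (prod_split_ge (c0 := c0) U0 _ Ule (half_le sp) _); rewrite ?mulr1n//.
    by move=> c; rewrite exprn_ge0.
  by apply: le_trans (p2 _ n4); rewrite n4/= lerD2l mulr2n lerDl sqr_ge0.
- apply: (@le_trans _ _ (\prod_c lam c ^+ p c + P *+ 3)); first by rewrite lerD2l ler_wpMn2l.
  have [c0 n4] := sp4 sp.
  case: H => [[c [c' [cs1 c's1 cc']]]|p1].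
    have /eqP n4c : (n c == 4)%N by rewrite nc4.
    have /eqP n4c' : (n c' == 4)%N by rewrite nc4.
    (* Each of the two letters spares 2 lam^2 beside lam^p, and the factor 2 * 2 is at least the 3
       required by the pairings. *)
    pose V d := if (d == c) || (d == c') then lam d ^+ 2 *+ 2 else lam d ^+ (n d)./2.
    have V0 d : 0 <= V d by rewrite /V; case: ifP => _; rewrite ?mulrn_wge0 ?exprn_ge0.
    apply: le_trans (prod_split_ge (c0 := c) U0 V0 Ule _ _); last first.
    + by rewrite /V eqxx/=; exact: p2.
    + move=> d; rewrite /V; case: ifP => [/orP dc|_]; last exact: half_le.
      apply: le_trans (p2 d _); first by rewrite lerDr.
      by case: dc => /eqP->.
    + rewrite lerD2l /P !(prodD1 c) !(prodD2 _ cc').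
      rewrite /V !eqxx orbT n4c n4c'/=.
      rewrite [in leRHS](eq_bigr (fun d => lam d ^+ (n d)./2)); last first.
        by move=> d /andP[/negPf-> /negPf->].
      set Q := \prod_(_ | _) _; have Q0 : 0 <= Q by apply: prodr_ge0 => d _; rewrite exprn_ge0.
      rewrite mulrnAl mulrnAl mulrnAr -mulrnA ler_wpMn2l//.
      by rewrite !mulr_ge0// sqr_ge0.
  (* Here [p c0] = 1, so the whole of 3 lam^2 at [c0] is available for the three pairings and lam
     for the lower bound. *)
  pose V d := if d == c0 then lam d ^+ 2 *+ 3 else lam d ^+ (n d)./2.
  have V0 d : 0 <= V d by rewrite /V; case: ifP => _; rewrite ?mulrn_wge0 ?exprn_ge0.
  apply: le_trans (prod_split_ge (c0 := c0) U0 V0 Ule _ _); last first.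
  + rewrite /V eqxx n4 m4 -mulr_natl; have := np c0; have := p1 c0; rewrite n4 !inE.
    by move=> pc /or4P[]/eqP[]// pE; move: pc; rewrite pE.
  + move=> d; rewrite /V; case: ifP => [/eqP->|_]; last exact: half_le.
    by rewrite n4 m4 -mulr_natl lerDr.
  + rewrite lerD2l /P !(prodD1 c0) /V eqxx n4/= mulrnAl le_eqVlt; apply/orP; left; apply/eqP; congr (_ * _ *+ _).
    by apply: eq_bigr => d /negPf->.
Qed.

End four_words.
End moments.

Section fourth_cumulant.
Context {R : realFieldType} {I K : finType}.
Variables (m : I -> nat -> R) (lam : I -> R) (e : K -> R) (wd : K -> seq I).
Local Notation mom := (word_moment m).

Definition moment4 : R := \sum_p \sum_q \sum_r \sum_s
  e p * e q * e r * e s * mom (wd p ++ wd q ++ wd r ++ wd s).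

Definition moment2 : R := \sum_p \sum_q e p * e q * mom (wd p ++ wd q).

(** Renaming the summation indices shows that each of the three pairings sums to [moment2 ^+ 2]. *)
Lemma fourth_cumulantE : moment4 - 3 * moment2 ^+ 2 = \sum_p \sum_q \sum_r \sum_s
  e p * e q * e r * e s * word_cumulant m (wd p) (wd q) (wd r) (wd s).
Proof.
have sq2 : moment2 ^+ 2 = \sum_p \sum_q \sum_r \sum_s
    e p * e q * e r * e s * (mom (wd p ++ wd q) * mom (wd r ++ wd s)).
  rewrite expr2 {1}/moment2 mulr_suml; apply: eq_bigr => p _.
  rewrite mulr_suml; apply: eq_bigr => q _.
  rewrite mulr_sumr; apply: eq_bigr => r _.
  by rewrite mulr_sumr; apply: eq_bigr => s _; ring.
have sq3 : moment2 ^+ 2 = \sum_p \sum_q \sum_r \sum_s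
    e p * e q * e r * e s * (mom (wd p ++ wd r) * mom (wd q ++ wd s)).
  rewrite sq2; apply: eq_bigr => p _; rewrite exchange_big; apply: eq_bigr => q _.
  by apply: eq_bigr => r _; apply: eq_bigr => s _; ring.
have sq4 : moment2 ^+ 2 = \sum_p \sum_q \sum_r \sum_s
    e p * e q * e r * e s * (mom (wd p ++ wd s) * mom (wd q ++ wd r)).
  rewrite sq3; apply: eq_bigr => p _; apply: eq_bigr => q _; rewrite exchange_big.
  by apply: eq_bigr => r _; apply: eq_bigr => s _; ring.
have -> : moment4 - 3 * moment2 ^+ 2 =
    moment4 - moment2 ^+ 2 - moment2 ^+ 2 - moment2 ^+ 2 by ring.
rewrite {1}sq2 {1}sq3 sq4 -!sumrB; apply: eq_bigr => p _; rewrite -!sumrB; apply: eq_bigr => q _.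
rewrite -!sumrB; apply: eq_bigr => r _; rewrite -!sumrB; apply: eq_bigr => s _.
by rewrite /word_cumulant; ring.
Qed.

Hypothesis lam_ge0 : forall c, 0 <= lam c.
Hypothesis m0 : forall c, m c 0%N = 1.
Hypothesis m1 : forall c, m c 1%N = 0.
Hypothesis m2 : forall c, m c 2%N = lam c.
Hypothesis m3 : forall c, 0 <= m c 3%N.
Hypothesis m4 : forall c, m c 4%N = lam c + 3 * lam c ^+ 2.
Hypothesis e_ge0 : forall p, 0 <= e p.
Hypothesis e_uniq : forall p, e p != 0 -> uniq (wd p) && (wd p != [::]).

(** All terms of the expansion are nonnegative, so those outside the image of [J] may be dropped;
    injectivity ensures that no quadruple is counted twice. The words need to be repetition-free
    only where the coefficients are nonzero. *)
Lemma fourth_cumulant_ge (J : finType) (h1 h2 h3 h4 : J -> K) (w : J -> R) :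
  injective (fun b => (h1 b, h2 b, h3 b, h4 b)) ->
  (forall b, uniq (wd (h1 b)) -> uniq (wd (h2 b)) -> uniq (wd (h3 b)) -> uniq (wd (h4 b)) ->
    w b <= word_cumulant m (wd (h1 b)) (wd (h2 b)) (wd (h3 b)) (wd (h4 b))) ->
  \sum_b e (h1 b) * e (h2 b) * e (h3 b) * e (h4 b) * w b <= moment4 - 3 * moment2 ^+ 2.
Proof.
move=> h_inj wle; rewrite fourth_cumulantE.
pose F (x : K * K * K * K) := e x.1.1.1 * e x.1.1.2 * e x.1.2 * e x.2 *
  word_cumulant m (wd x.1.1.1) (wd x.1.1.2) (wd x.1.2) (wd x.2).
have F0 x : 0 <= F x.
  rewrite /F; case: x => -[[p q] r] s /=.
  have [->|/e_uniq/andP[up pN]] := eqVneq (e p) 0; first by rewrite !mul0r.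
  have [->|/e_uniq/andP[uq _]] := eqVneq (e q) 0; first by rewrite mulr0 !mul0r.
  have [->|/e_uniq/andP[ur _]] := eqVneq (e r) 0; first by rewrite mulr0 !mul0r.
  have [->|/e_uniq/andP[us _]] := eqVneq (e s) 0; first by rewrite mulr0 !mul0r.
  by rewrite !mulr_ge0// (word_cumulant_ge0 (lam := lam)).
rewrite !pair_bigA/= (eq_bigr F)//.
apply: (@le_trans _ _ (\sum_b F (h1 b, h2 b, h3 b, h4 b))).
  apply: ler_sum => b _; rewrite /F/=.
  have [->|/e_uniq/andP[up pN]] := eqVneq (e (h1 b)) 0; first by rewrite !mul0r.
  have [->|/e_uniq/andP[uq _]] := eqVneq (e (h2 b)) 0; first by rewrite mulr0 !mul0r.
  have [->|/e_uniq/andP[ur _]] := eqVneq (e (h3 b)) 0; first by rewrite mulr0 !mul0r.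
  have [->|/e_uniq/andP[us _]] := eqVneq (e (h4 b)) 0; first by rewrite mulr0 !mul0r.
  by rewrite ler_wpM2l ?wle// !mulr_ge0.
rewrite (bigID (fun x => x \in codom (fun b => (h1 b, h2 b, h3 b, h4 b))) xpredT)/=.
rewrite -[leLHS]addr0 lerD ?sumr_ge0//.
pose hh b := (h1 b, h2 b, h3 b, h4 b); rewrite -/hh.
have <- : \sum_(x <- codom hh) F x = \sum_b F (hh b) by rewrite big_image.
by rewrite big_uniq//= (map_inj_uniq h_inj) enum_uniq.
Qed.

End fourth_cumulant.

Section selections.
Context {R : realFieldType} {I : finType}.
Variables (m : I -> nat -> R) (lam : I -> R).
Hypothesis lam_ge0 : forall c, 0 <= lam c.
Hypothesis m0 : forall c, m c 0%N = 1.
Hypothesis m1 : forall c, m c 1%N = 0.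
Hypothesis m2 : forall c, m c 2%N = lam c.
Hypothesis m3 : forall c, 0 <= m c 3%N.
Hypothesis m4 : forall c, m c 4%N = lam c + 3 * lam c ^+ 2.

(** The map [b] places the N coordinates into blocks, and the k-th word consists of the blocks read
    through the k-th index map. Distinct coordinates may share a block, so [p c] counts the
    coordinates placed in [c]. *)
Lemma selected_cumulant_ge (q N : nat) (i1 i2 i3 i4 : 'I_q -> 'I_N) (b : 'I_N -> I)
    (j12 j13 : 'I_N) :
  (forall j, #|[pred i | i1 i == j]| + #|[pred i | i2 i == j]| + #|[pred i | i3 i == j]|
    + #|[pred i | i4 i == j]| \in [:: 2; 4])%N ->
  j12 \in codom i1 -> j12 \in codom i2 -> j13 \in codom i1 -> j13 \in codom i3 ->
  (1 < q)%N || (N == 1)%N ->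
  uniq (codom (b \o i1)) -> uniq (codom (b \o i2)) -> uniq (codom (b \o i3)) ->
  uniq (codom (b \o i4)) ->
  \prod_j lam (b j) <=
    word_cumulant m (codom (b \o i1)) (codom (b \o i2)) (codom (b \o i3)) (codom (b \o i4)).
Proof.
move=> D /codomP[a1 e1] /codomP[a2 e2] /codomP[a3 e3] /codomP[a4 e4] qN u1 u2 u3 u4.
pose p c := #|[pred j | b j == c]|.
pose S j := (#|[pred i | i1 i == j]| + #|[pred i | i2 i == j]| + #|[pred i | i3 i == j]|
    + #|[pred i | i4 i == j]|)%N.
have cntE (i : 'I_q -> 'I_N) c :
    count_mem c (codom (b \o i)) = (\sum_(j | b j == c) #|[pred x | i x == j]|)%N.
  rewrite /codom count_map -size_filter -sum1_size big_filter.
  rewrite big_enum_cond/= (partition_big i (fun j => b j == c))//=.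
  apply: eq_bigr => j /eqP bj; rewrite sum1_card; apply: eq_card => x.
  by rewrite inE [LHS]unfold_in/=; case: (i x =P j) => [->|]; rewrite ?andbF ?bj ?eqxx.
have nE : forall c, count_mem c (codom (b \o i1) ++ codom (b \o i2) ++ codom (b \o i3) ++
    codom (b \o i4)) = (\sum_(j | b j == c) S j)%N.
  by move=> c; rewrite !count_cat !cntE !addnA -!big_split.
have in_all : forall c, c \in codom (b \o i1) -> c \in codom (b \o i2) ->
  c \in codom (b \o i3) -> c \in codom (b \o i4) ->
  (\sum_(j | b j == c) S j)%N = 4%N.
  by move=> c c1 c2 c3 c4; rewrite -nE !count_cat !count_uniq_mem// c1 c2 c3 c4.
have mem_b (i : 'I_q -> 'I_N) x : b (i x) \in codom (b \o i) by apply/codomP; exists x.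
have -> : \prod_j lam (b j) = \prod_c lam c ^+ p c.
  rewrite (partition_big b predT)//=; apply: eq_bigr => c _.
  rewrite (eq_bigr (fun=> lam c)) => [|j /eqP->//].
  by rewrite prodr_const.
apply: word_cumulant_ge => //.
(* Each coordinate is read two or four times, so 2p <= n <= 4p with n even; n <= 4 since the four
   words have no repetition. Only the four listed pairs (n, p) remain. *)
- move=> c; rewrite nE.
  have S2 : (2 * p c <= \sum_(j | b j == c) S j <= 4 * p c)%N.
    rewrite /p -sum1_card !big_distrr/=; apply/andP; split;
      by apply: leq_sum => j _; have := D j; rewrite -/(S j) !inE => /orP[]/eqP->.
  have S4 : (\sum_(j | b j == c) S j <= 4)%N.
    by rewrite -nE !count_cat !count_uniq_mem//; do 4 case: (_ \in _).
  have Se : ~~ odd (\sum_(j | b j == c) S j).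
    apply: (big_ind (fun n => ~~ odd n)) => // [x y /negPf xe /negPf ye|j _].
      by rewrite oddD xe ye.
    by have := D j; rewrite -/(S j) !inE => /orP[]/eqP->.
  move: S2 S4 Se; move: (\sum_(_ | _) _)%N (p c) => n k; clear.
  case: k => [|[|[|k]]]; case: n => [|[|[|[|[|n]]]]] //=; lia.
(* The shared coordinates yield a letter in all four words: when s1 is paired with s2, the block of
   [j13] lies in s1 and s3 and so in their partners; for the other two pairings the block of [j12]
   does the same. *)
- case/or3P => /andP[/perm_mem p1 /perm_mem p2].
  + exists (b j13); rewrite nE; apply: in_all => //.
    * by rewrite e3.
    * by rewrite -p1 e3.
    * by rewrite e4.
    * by rewrite -p2 e4.
  + exists (b j12); rewrite nE; apply: in_all => //.
    * by rewrite e1.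
    * by rewrite e2.
    * by rewrite -p1 e1.
    * by rewrite -p2 e2.
  + exists (b j12); rewrite nE; apply: in_all => //.
    * by rewrite e1.
    * by rewrite e2.
    * by rewrite -p2 e2.
    * by rewrite -p1 e1.
- case/orP: qN => [q1|/eqP N1]; [left|right].
    exists ((b \o i1) (Ordinal (ltnW q1))), ((b \o i1) (Ordinal q1)).
    split; [exact: mem_b|exact: mem_b|].
    by apply/eqP => /(injectiveP _ u1)/(congr1 val).
  by move=> c; rewrite /p -[leqRHS]N1 -[leqRHS]card_ord max_card.
Qed.

End selections.

(** * Random variables with all absolute moments finite *)

Section all_moments.
Context {d : measure_display} {T : measurableType d} {R : realType}.
Variable P : probability T R.
Implicit Types Y Z : T -> R.

(** This class is closed under sums and products, so integrability of every polynomial in the block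
    masses follows from that of the masses. *)
Definition all_moments Y := measurable_fun setT Y /\
  forall n, (\int[P]_w (`|Y w| ^+ n)%:E < +oo)%E.

Local Notation mean Y := (\int[P]_w Y w).

Lemma measurable_normX Y n : measurable_fun setT Y ->
  measurable_fun setT (fun w => (`|Y w| ^+ n)%:E).
Proof.
move=> mY; apply/measurable_EFinP; apply: measurable_funX.
exact: measurableT_comp.
Qed.

Lemma all_moments_integrable Y : all_moments Y -> P.-integrable setT (EFin \o Y).
Proof.
by move=> [mY /(_ 1%N) Y1]; apply/integrableP; split => //; exact/measurable_EFinP.
Qed.

Lemma all_moments_cst (c : R) : all_moments (fun=> c).
Proof.
split=> [|n]; first exact: measurable_cst.
by rewrite integral_cst//= probability_setT mule1 ltry.
Qed.

Lemma all_momentsM Y Z : all_moments Y -> all_moments Z -> all_moments (fun w => Y w * Z w).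
Proof.
move=> [mY Yoo] [mZ Zoo]; split=> [|n]; first exact: measurable_funM.
apply: (@le_lt_trans _ _ (\int[P]_w ((`|Y w| ^+ (2 * n))%:E + (`|Z w| ^+ (2 * n))%:E))%E).
  apply: ge0_le_integral => //.
  - by apply: measurable_normX; exact: measurable_funM.
  - by apply: emeasurable_funD; exact: measurable_normX.
  - move=> w _; rewrite -EFinD lee_fin normrM exprMn mulnC !exprM.
    have := sqr_ge0 (`|Y w| ^+ n - `|Z w| ^+ n).
    have a0 : 0 <= `|Y w| ^+ n by []. have b0 : 0 <= `|Z w| ^+ n by [].
    by nra.
rewrite ge0_integralD//.
- by rewrite lte_add_pinfty// ?Yoo ?Zoo.
- exact: measurable_normX.
- exact: measurable_normX.
Qed.

Lemma all_momentsD Y Z : all_moments Y -> all_moments Z -> all_moments (fun w => Y w + Z w).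
Proof.
move=> [mY Yoo] [mZ Zoo]; split=> [|n]; first exact: measurable_funD.
apply: (@le_lt_trans _ _ (\int[P]_w ((2 ^+ n)%:E * ((`|Y w| ^+ n)%:E + (`|Z w| ^+ n)%:E)))%E).
  apply: ge0_le_integral => //.
  - by apply: measurable_normX; exact: measurable_funD.
  - by apply: measurable_funeM; apply: emeasurable_funD; exact: measurable_normX.
  - move=> w _; rewrite -EFinD -EFinM lee_fin.
    have ab : `|Y w + Z w| <= 2 * Num.max `|Y w| `|Z w|.
      by apply: le_trans (ler_normD _ _) _; rewrite mulr_natl mulr2n lerD// le_max lexx ?orbT.
    apply: (@le_trans _ _ ((2 * Num.max `|Y w| `|Z w|) ^+ n)); first by rewrite lerXn2r// ?nnegrE// mulr_ge0// le_max normr_ge0.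
    rewrite exprMn ler_wpM2l ?exprn_ge0//; case: (leP `|Y w| `|Z w|) => _.
      by rewrite lerDr.
    by rewrite lerDl.
rewrite ge0_integralZl//.
- rewrite ge0_integralD//; try exact: measurable_normX.
  by rewrite lte_mul_pinfty ?lee_fin ?exprn_ge0// lte_add_pinfty// ?Yoo ?Zoo.
- by apply: emeasurable_funD; exact: measurable_normX.
- by move=> w _; rewrite adde_ge0// lee_fin.
Qed.

Lemma all_moments_sum (J : Type) (r : seq J) (Q : pred J) (F : J -> T -> R) :
  (forall j, Q j -> all_moments (F j)) -> all_moments (fun w => \sum_(j <- r | Q j) F j w).
Proof.
move=> H; elim: r => [|j r IHr].
  by under [X in all_moments X]eq_fun do rewrite big_nil; exact: all_moments_cst.
under [X in all_moments X]eq_fun do rewrite big_cons.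
by case Qj: (Q j) => //; apply: all_momentsD => //; exact: H.
Qed.

Lemma all_moments_prod (J : Type) (r : seq J) (Q : pred J) (F : J -> T -> R) :
  (forall j, Q j -> all_moments (F j)) -> all_moments (fun w => \prod_(j <- r | Q j) F j w).
Proof.
move=> H; elim: r => [|j r IHr].
  by under [X in all_moments X]eq_fun do rewrite big_nil; exact: all_moments_cst.
under [X in all_moments X]eq_fun do rewrite big_cons.
by case Qj: (Q j) => //; apply: all_momentsM => //; exact: H.
Qed.

Lemma all_momentsX Y n : all_moments Y -> all_moments (fun w => Y w ^+ n).
Proof.
move=> aY; elim: n => [|n IHn].
  by under [X in all_moments X]eq_fun do rewrite expr0; exact: all_moments_cst.
by under [X in all_moments X]eq_fun do rewrite exprS; exact: all_momentsM.
Qed.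

Lemma all_momentsZ (c : R) Y : all_moments Y -> all_moments (fun w => c * Y w).
Proof. by move=> aY; apply: all_momentsM => //; exact: all_moments_cst. Qed.

Lemma all_momentsB Y Z : all_moments Y -> all_moments Z -> all_moments (fun w => Y w - Z w).
Proof.
move=> aY aZ; apply: all_momentsD => //.
under [X in all_moments X]eq_fun do rewrite -mulN1r.
exact: all_momentsZ.
Qed.

Lemma meanZ (c : R) Y : all_moments Y -> mean (fun w => c * Y w) = c * mean Y.
Proof. by move=> aY; rewrite RintegralZl//; exact: all_moments_integrable. Qed.

Lemma meanD Y Z : all_moments Y -> all_moments Z ->
  mean (fun w => Y w + Z w) = mean Y + mean Z.
Proof. by move=> aY aZ; rewrite RintegralD//; exact: all_moments_integrable. Qed.

Lemma meanB Y Z : all_moments Y -> all_moments Z ->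
  mean (fun w => Y w - Z w) = mean Y - mean Z.
Proof. by move=> aY aZ; rewrite RintegralB//; exact: all_moments_integrable. Qed.

Lemma mean_cst (c : R) : mean (fun=> c) = c.
Proof. by rewrite Rintegral_cst//= probability_setT mulr1. Qed.

Lemma mean_sum (J : Type) (r : seq J) (Q : pred J) (F : J -> T -> R) :
  (forall j, Q j -> all_moments (F j)) ->
  mean (fun w => \sum_(j <- r | Q j) F j w) = \sum_(j <- r | Q j) mean (F j).
Proof.
move=> H; elim: r => [|j r IHr].
  by under eq_Rintegral do rewrite big_nil; rewrite big_nil mean_cst.
under eq_Rintegral do rewrite big_cons; rewrite big_cons.
by case Qj: (Q j) => //; rewrite meanD ?IHr//; [exact: H|exact: all_moments_sum].
Qed.

Lemma mean_ae Y Z : measurable_fun setT Y -> measurable_fun setT Z ->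
  {ae P, forall w, Y w = Z w} -> mean Y = mean Z.
Proof.
move=> mY mZ YZ; rewrite /Rintegral; congr fine; apply: ae_eq_integral => //.
- exact/measurable_EFinP.
- exact/measurable_EFinP.
- by apply: filterS YZ => w /= -> _.
Qed.

Lemma all_moments_dom Y Z : all_moments Y -> measurable_fun setT Z ->
  (forall w, `|Z w| <= `|Y w|) -> all_moments Z.
Proof.
move=> [mY Yoo] mZ ZY; split=> // n; apply: le_lt_trans (Yoo n).
apply: ge0_le_integral => //; try exact: measurable_normX.
by move=> w _; rewrite lee_fin lerXn2r// nnegrE.
Qed.

End all_moments.

(** * Poisson variables and independence *)

Section poisson_variable.
Context {d : measure_display} {T : measurableType d} {R : realType}.
Variables (P : probability T R) (X : T -> \bar R) (lam : R).
Hypotheses (mX : measurable_fun setT X) (lam_ge0 : 0 <= lam)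
  (PX : forall n : nat, P [set w | X w = n%:R%:E] = poisson_prob lam 0%N [set n]).

Local Notation p n := (poisson_prob lam 0%N [set n]).

(** The case [lam = 0] is separate because the law is then the Dirac mass at 0, not given by the
    formula for the weights. *)
Lemma poisson_prob_set1S n : (n.+1%:R%:E * p n.+1 = lam%:E * p n)%E.
Proof.
rewrite /poisson_prob; case: ifPn => lam_gt0.
  rewrite !esum_set1 ?lee_fin ?poisson_pmf_ge0// -!EFinM /poisson_pmf lam_gt0.
  congr EFin; rewrite factS natrM exprS.
  by field; rewrite nat1r !pnatr_eq0 -lt0n fact_gt0.
have -> : lam = 0 by apply/eqP; rewrite eq_le lam_ge0 leNgt lam_gt0.
by rewrite mul0e diracE memNset ?mule0//= .
Qed.

Let measurable_level n : measurable [set w | X w = n%:R%:E].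
Proof.
rewrite (_ : [set _ | _] = X @^-1` [set n%:R%:E])//.
by rewrite -[X in measurable X]setTI; exact: mX.
Qed.

Let triv_level : trivIset setT (fun n : nat => [set w | X w = n%:R%:E]).
Proof.
apply/trivIsetP => i j _ _ ij; apply/seteqP; split=> // w [/= ->] [] /eqP.
by rewrite eqr_nat (negPf ij).
Qed.

(** Only the probabilities of the integer values are given, but they already sum to the total mass
    1; no mass is left for other values, +oo included. *)
Lemma poisson_variable_nat : P (\bigcup_n [set w | X w = n%:R%:E]) = 1%E.
Proof.
rewrite measure_bigcup//=.
under eq_eseriesr do rewrite PX.
rewrite -(@probability_setT _ _ _ (poisson_prob lam 0%N)).
have {2}<- : \bigcup_n [set n] = [set: nat] by rewrite bigcup_imset1 image_id.
rewrite measure_bigcup//=.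
by apply/trivIsetP => i j _ _ ij; apply/seteqP; split=> // x [/= ->] /eqP; rewrite (negPf ij).
Qed.

Lemma poisson_variable_nat_ae : {ae P, forall w, exists n : nat, X w = n%:R%:E}.
Proof.
exists (~` \bigcup_n [set w | X w = n%:R%:E]); split.
- by apply: measurableC; exact: bigcup_measurable.
- rewrite probability_setC ?poisson_variable_nat ?subee//.
  exact: bigcup_measurable.
- by move=> w /= H [n _ Xn]; apply: H; exists n.
Qed.

Lemma integral_poisson_variable (g : T -> \bar R) (psi : nat -> \bar R) :
  measurable_fun setT g -> (forall w, 0 <= g w)%E -> (forall n, 0 <= psi n)%E ->
  (forall n w, X w = n%:R%:E -> g w = psi n) ->
  (\int[P]_w g w = \sum_(n <oo) psi n * p n)%E.
Proof.
move=> mg g0 psi0 gpsi.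
set D := \bigcup_n [set w | X w = n%:R%:E].
have mD : measurable D by apply: bigcup_measurable.
have PD0 : P (~` D) = 0%E by rewrite probability_setC// poisson_variable_nat subee.
transitivity (\int[P]_(w in D) g w)%E.
  rewrite (ge0_negligible_integral (N := ~` D))//; first by rewrite setTD setCK.
  - exact: measurableC.
rewrite ge0_integral_bigcup//; last by apply: measurable_funS mg.
apply: eq_eseriesr => n _.
rewrite -PX -integral_cst//; apply: eq_integral => w /[!inE] /= Xw.
exact: gpsi.
Qed.

Local Notation Y := (fine \o X).

Let mY : measurable_fun setT Y. Proof. exact: measurableT_comp. Qed.

(** The Chen-Stein identity E[Y phi(Y)] = lam E[phi(Y + 1)] for a power phi, obtained by shifting
    the index in the series. Absolute values make both sides meaningful before integrability is
    known. *)
Lemma poisson_variable_momentS k : (\int[P]_w (`|Y w| ^+ k.+1)%:E =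
  lam%:E * \int[P]_w ((`|Y w| + 1) ^+ k)%:E)%E.
Proof.
rewrite (integral_poisson_variable (psi := fun n => (n%:R ^+ k.+1)%:E)); last 4 first.
- exact: measurable_normX.
- by move=> w; rewrite lee_fin.
- by move=> n; rewrite lee_fin exprn_ge0.
- by move=> n w /= -> /=; rewrite ger0_norm.
rewrite (integral_poisson_variable (psi := fun n => (n.+1%:R ^+ k)%:E)); last 4 first.
- apply/measurable_EFinP; apply: measurable_funX; apply: measurable_funD => //.
  exact: measurableT_comp.
- by move=> w; rewrite lee_fin exprn_ge0// addr_ge0.
- by move=> n; rewrite lee_fin exprn_ge0.
- by move=> n w /= -> /=; rewrite ger0_norm// natr1.
rewrite nneseries_recl//=; last by move=> n _; rewrite mule_ge0.
rewrite expr0n/= mul0e add0e -nneseriesZl//; last by move=> n _; rewrite mule_ge0.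
rewrite -[LHS](nneseries_addn 1)//.
  apply: eq_eseriesr => n _; rewrite addn1 exprSr EFinM -muleA poisson_prob_set1S.
  by rewrite muleCA.
by move=> n; rewrite mule_ge0.
Qed.

(** Induction on the order through [poisson_variable_momentS], with (y + 1)^k <= 2^k (y^k + 1) to
    return to moments of Y. *)
Lemma poisson_variable_all_moments : all_moments P Y.
Proof.
split=> // n; elim: n {-2}n (leqnn n) => [|N IHN] [|k] // kN;
  try by under eq_integral do rewrite expr0; rewrite integral_cst//= probability_setT mul1e ltry.
rewrite poisson_variable_momentS lte_mul_pinfty//.
apply: (@le_lt_trans _ _ (\int[P]_w ((2 ^+ k)%:E * ((`|Y w| ^+ k)%:E + 1)))%E).
  apply: ge0_le_integral => //.
  - apply/measurable_EFinP; apply: measurable_funX; apply: measurable_funD => //.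
    exact: measurableT_comp.
  - by apply: measurable_funeM; apply: emeasurable_funD => //; exact: measurable_normX.
  - move=> w _; rewrite -EFinD -EFinM lee_fin; set y := `|Y w|.
    have y0 : 0 <= y by exact: normr_ge0.
    apply: (@le_trans _ _ ((2 * Num.max y 1) ^+ k)).
      rewrite lerXn2r// ?nnegrE ?addr_ge0 ?mulr_ge0 ?le_max ?y0//.
      by rewrite mulr_natl mulr2n lerD// le_max lexx ?orbT.
    rewrite exprMn ler_wpM2l ?exprn_ge0//; case: (leP y 1) => _.
      by rewrite expr1n lerDr exprn_ge0.
    by rewrite lerDl.
rewrite ge0_integralZl//; last 2 first.
- by apply: emeasurable_funD => //; exact: measurable_normX.
- by move=> w _; rewrite adde_ge0// lee_fin.
rewrite lte_mul_pinfty//.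
rewrite ge0_integralD//; last exact: measurable_normX.
rewrite lte_add_pinfty//; first exact: IHN.
by rewrite integral_cst//= probability_setT mul1e ltry.
Qed.

Local Notation xi := (fun w => Y w - lam).

Lemma centered_poisson_all_moments : all_moments P xi.
Proof.
apply: all_momentsB; first exact: poisson_variable_all_moments.
exact: all_moments_cst.
Qed.

Lemma poisson_variable_meanS k : \int[P]_w (Y w ^+ k.+1) = lam * \int[P]_w ((Y w + 1) ^+ k).
Proof.
have aY := poisson_variable_all_moments.
have aY1 : all_moments P (fun w => `|Y w| + 1).
  apply: all_momentsD; last exact: all_moments_cst.
  apply: all_moments_dom aY _ _ => [|w]; first exact: measurableT_comp.
  by rewrite normr_id.
have YN : {ae P, forall w, Y w = `|Y w|}.
  by apply: filterS poisson_variable_nat_ae => w /= [n ->] /=; rewrite ger0_norm.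
transitivity (\int[P]_w (`|Y w| ^+ k.+1)).
  apply: mean_ae => //; [exact: measurable_funX|by apply: measurable_funX; exact: measurableT_comp|].
  by apply: filterS YN => w /= ->; rewrite normr_id.
rewrite {1}/Rintegral poisson_variable_momentS fineM//; last first.
  by apply: integrable_fin_num => //; apply: all_moments_integrable; exact: all_momentsX.
congr (_ * _); apply: mean_ae.
- by have [] := all_momentsX k aY1.
- by apply: measurable_funX; exact: measurable_funD.
- by apply: filterS YN => w /= {2}->.
Qed.

(** Write xi^(k+1) as Y xi^k - lam xi^k, expand xi^k in powers of Y and apply the uncentered
    identity to each power; the shift of Y by 1 becomes a shift of xi by 1. *)
Lemma centered_poisson_stein k : \int[P]_w (xi w ^+ k.+1) =
  lam * \int[P]_w ((xi w + 1) ^+ k) - lam * \int[P]_w (xi w ^+ k).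
Proof.
have aY := poisson_variable_all_moments; have axi := centered_poisson_all_moments.
have aY1 : all_moments P (fun w => Y w + 1) by apply: all_momentsD => //; exact: all_moments_cst.
rewrite -[X in _ - X]meanZ; last exact: all_momentsX.
have -> : (fun w => xi w ^+ k.+1) = (fun w => Y w * xi w ^+ k - lam * xi w ^+ k).
  by apply/funext => w; rewrite exprS mulrBl.
rewrite meanB; last 2 first.
- by apply: all_momentsM => //; exact: all_momentsX.
- by apply: all_momentsZ; exact: all_momentsX.
congr (_ - _).
transitivity (\int[P]_w (\sum_(i < k.+1) ((- lam) ^+ i *+ 'C(k, i)) * Y w ^+ (k - i).+1)).
  apply: eq_Rintegral => w _; rewrite exprDn mulr_sumr; apply: eq_bigr => i _.
  by rewrite exprS mulrnAr mulrnAl; congr (_ *+ _); ring.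
rewrite mean_sum; last by move=> i _; apply: all_momentsZ; exact: all_momentsX.
transitivity (lam * \int[P]_w (\sum_(i < k.+1) ((- lam) ^+ i *+ 'C(k, i)) * (Y w + 1) ^+ (k - i))).
  rewrite mean_sum; last by move=> i _; apply: all_momentsZ; exact: all_momentsX.
  rewrite mulr_sumr; apply: eq_bigr => i _; rewrite !meanZ ?poisson_variable_meanS; first by ring.
  - exact: all_momentsX.
  - exact: all_momentsX.
congr (_ * _); apply: eq_Rintegral => w _.
rewrite (_ : xi w + 1 = Y w + 1 - lam); last by ring.
by rewrite exprDn; apply: eq_bigr => i _; rewrite mulrnAl mulrC.
Qed.

(** In the binomial expansion of (xi + 1)^k the term of top degree cancels the subtracted moment. *)
Lemma centered_poisson_momentS k : \int[P]_w (xi w ^+ k.+1) =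
  lam * \sum_(i < k) (\int[P]_w (xi w ^+ i)) *+ 'C(k, i).
Proof.
have axi := centered_poisson_all_moments.
rewrite centered_poisson_stein -mulrBr; congr (_ * _).
under [X in X - _]eq_Rintegral do rewrite addrC exprDn.
rewrite mean_sum; last first.
  by move=> i _; under [X in all_moments _ X]eq_fun do rewrite expr1n mul1r -mulr_natl; apply: all_momentsZ; exact: all_momentsX.
rewrite big_ord_recr/= binn; under [X in _ + X - _]eq_Rintegral do rewrite expr1n mul1r mulr1n.
rewrite addrK; apply: eq_bigr => i _.
under eq_Rintegral do rewrite expr1n mul1r -mulr_natl.
by rewrite meanZ ?mulr_natl//; exact: all_momentsX.
Qed.

(** The recursion [centered_poisson_momentS] involves only nonnegative coefficients and lower
    moments. The nonnegativity of every word mean rests on this. *)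
Lemma centered_poisson_moment_ge0 k : 0 <= \int[P]_w (xi w ^+ k).
Proof.
elim: k {-2}k (leqnn k) => [|N IHN] [|k] // kN;
  try by under eq_Rintegral do rewrite expr0; rewrite mean_cst.
rewrite centered_poisson_momentS mulr_ge0// sumr_ge0// => i _; rewrite mulrn_wge0// IHN//.
by rewrite (leq_trans (ltnW (ltn_ord i))).
Qed.

Lemma centered_poisson_moments : [/\ \int[P]_w (xi w ^+ 0) = 1, \int[P]_w (xi w ^+ 1) = 0,
  \int[P]_w (xi w ^+ 2) = lam & \int[P]_w (xi w ^+ 4) = lam + 3 * lam ^+ 2].
Proof.
have e0 : \int[P]_w (xi w ^+ 0) = 1 by under eq_Rintegral do rewrite expr0; rewrite mean_cst.
have e1 : \int[P]_w (xi w ^+ 1) = 0 by rewrite centered_poisson_momentS big_ord0 mulr0.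
have e2 : \int[P]_w (xi w ^+ 2) = lam.
  by rewrite centered_poisson_momentS !big_ord_recr big_ord0/= e0 add0r mulr1.
split=> //; rewrite centered_poisson_momentS !big_ord_recr big_ord0/= e0 e1 e2.
rewrite [binomial 3 2](_ : _ = 3%N)// add0r mul0rn addr0 mulr1n.
by rewrite -mulr_natl; ring.
Qed.

End poisson_variable.

Section finite_unions.
Context {d : measure_display} {T : measurableType d} {J : finType}.
Implicit Types (D : J -> set T) (Q : pred J).

Lemma bigsetUP D Q z : (\big[setU/set0]_(j | Q j) D j) z <-> exists2 j, Q j & D j z.
Proof. by rewrite -(bigcup_pred Q); split=> -[j Qj Dj]; exists j. Qed.

Definition disjoint_family D := forall i j, i != j -> [disjoint D i & D j].

Lemma disjoint_family_inj D i j z : disjoint_family D -> D i z -> D j z -> i = j.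
Proof.
by move=> tD Di Dj; apply/eqP; apply: contraT => /tD /disj_setPS/(_ z (conj Di Dj)).
Qed.

Context {R : realType}.

Lemma measure_bigsetU_fin (m : {measure set T -> \bar R}) D Q :
  (forall j, measurable (D j)) -> disjoint_family D ->
  m (\big[setU/set0]_(j | Q j) D j) = (\sum_(j | Q j) m (D j))%E.
Proof.
move=> mD tD; have := index_enum_uniq J.
elim: (index_enum J) => [|j r IHr] /=; first by rewrite !big_nil measure0.
move=> /andP[jr ur]; rewrite !big_cons; case: ifPn => Qj; last exact: IHr.
rewrite measureU//=; first by rewrite IHr.
- by apply: bigsetU_measurable.
- apply/seteqP; split=> // z [Dj] /=; rewrite -bigcup_seq_cond => -[i /= /andP[ir _] Di].
  by move: jr; rewrite (disjoint_family_inj tD Dj Di) ir.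
Qed.

End finite_unions.

(** * Void probabilities and independence of occupied cells *)

Section poisson_void.
Context {d dO : measure_display} {Z : measurableType d} {Omega : measurableType dO}.
Context {R : realType}.
Variables (mu : {sigma_finite_measure set Z -> \bar R}) (P : probability Omega R).
Variable eta : R.-ker Omega ~> Z.
Hypothesis PE : poisson_measure P mu eta.

Local Notation mean Y := (\int[P]_w Y w).
Local Notation lam B := (fine (mu B)).

Lemma measurable_eta B : measurable B -> measurable_fun setT (eta ^~ B).
Proof. exact: measurable_kernel. Qed.

Lemma eta_poisson B : measurable B -> (mu B < +oo)%E -> forall n : nat,
  P [set w | eta w B = n%:R%:E] = poisson_prob (lam B) 0%N [set n].
Proof. exact: PE.1. Qed.

Lemma eta_nat B : measurable B -> (mu B < +oo)%E ->
  {ae P, forall w, exists n : nat, eta w B = n%:R%:E}.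
Proof.
move=> mB Boo; apply: (@poisson_variable_nat_ae _ _ _ _ (eta ^~ B) (lam B)) => //.
- exact: measurable_eta.
- exact: eta_poisson.
Qed.

Lemma poisson_prob_set0 (l : R) : 0 <= l -> poisson_prob l 0%N [set 0%N] = (expR (- l))%:E.
Proof.
move=> l0; rewrite /poisson_prob; case: ifPn => l_gt0.
  rewrite esum_set1 ?lee_fin ?poisson_pmf_ge0// /poisson_pmf l_gt0.
  by rewrite expr0 fact0 invr1 !mul1r.
have -> : l = 0 by apply/eqP; rewrite eq_le l0 leNgt l_gt0.
by rewrite oppr0 expR0 diracE mem_set.
Qed.

Lemma eta_void B : measurable B -> (mu B < +oo)%E ->
  P [set w | eta w B = 0%E] = (expR (- lam B))%:E.
Proof.
by move=> mB Boo; rewrite -poisson_prob_set0 ?fine_ge0// -eta_poisson.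
Qed.

Lemma measurable_eta_eq B (x : \bar R) : measurable B -> measurable [set w | eta w B = x].
Proof.
move=> mB; rewrite (_ : [set _ | _] = (eta ^~ B) @^-1` [set x])//.
by rewrite -[X in measurable X]setTI; exact: measurable_eta.
Qed.

Definition multiple_points B := [set w | ~ (eta w B = 0%E \/ eta w B = 1%E)].

Lemma measurable_multiple_points B : measurable B -> measurable (multiple_points B).
Proof.
move=> mB; rewrite (_ : multiple_points B =
  ~` ([set w | eta w B = 0%E] `|` [set w | eta w B = 1%E]))//.
by apply: measurableC; apply: measurableU; exact: measurable_eta_eq.
Qed.

(** The probability is 1 - (1 + l) exp(-l), and exp(-l) >= 1 - l bounds it by 1 - (1 + l)(1 - l) =
    l^2. The quadratic order makes the sum over fine cells negligible. *)
Lemma multiple_points_le B : measurable B -> (mu B < +oo)%E ->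
  (P (multiple_points B) <= (lam B ^+ 2)%:E)%E.
Proof.
move=> mB Boo; set l := lam B; have l0 : 0 <= l by exact: fine_ge0.
rewrite (_ : multiple_points B =
  ~` ([set w | eta w B = 0%E] `|` [set w | eta w B = 1%:R%:E]))//.
rewrite probability_setC; last by apply: measurableU; exact: measurable_eta_eq.
rewrite measureU//=; try exact: measurable_eta_eq; last first.
  by apply/seteqP; split=> // w [/= ->] [] /eqP; rewrite eq_sym oner_eq0.
rewrite eta_void// eta_poisson// -/l.
have -> : poisson_prob l 0%N [set 1%N] = (l * expR (- l))%:E.
  have := poisson_prob_set1S l0 0; rewrite mul1e => ->.
  by rewrite poisson_prob_set0// EFinM.
rewrite [leLHS](_ : _ = (1 - (expR (- l) + l * expR (- l)))%:E)// lee_fin.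
have := expR_ge1Dx (- l); nra.
Qed.

Section bits.
Context {J : finType}.
Variable D : J -> set Z.
Hypotheses (mD : forall j, measurable (D j)) (Doo : forall j, (mu (D j) < +oo)%E)
  (tD : disjoint_family D).

Lemma finite_bigsetU (Q : pred J) : (mu (\big[setU/set0]_(j | Q j) D j) < +oo)%E.
Proof. by rewrite measure_bigsetU_fin//; apply: lte_sum_pinfty => j _; exact: Doo. Qed.

Definition occupied w j : bool := eta w (D j) != 0%E.

Let void_ind w j : R := (~~ occupied w j)%:R.

(** Several disjoint cells are empty exactly when their union is, and the Poisson law of this single
    set gives a product of exponentials. Joint information is thus read off one-set laws. *)
Let mean_void (S : {set J}) :
  mean (fun w => \prod_(j in S) void_ind w j) = \prod_(j in S) expR (- lam (D j)).
Proof.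
set U := \big[setU/set0]_(j | j \in S) D j.
have mU : measurable U by apply: bigsetU_measurable.
transitivity (mean (\1_[set w | eta w U = 0%E])).
  apply: eq_Rintegral => w _; rewrite indicE.
  have -> : (w \in [set w | eta w U = 0%E]) = (eta w U == 0%E).
    by apply/idP/eqP => [/set_mem//|H]; exact/mem_set.
  rewrite /U measure_bigsetU_fin// /void_ind -natr_prod; congr (_%:R).
  elim: (index_enum J) => [|j r IHr]; first by rewrite !big_nil eqxx.
  rewrite !big_cons/=; case: ifP => _ //.
  by rewrite IHr /occupied negbK mulnb padde_eq0// sume_ge0.
transitivity (fine (P [set w | eta w U = 0%E])).
  by rewrite /Rintegral integral_indic ?setIT//; exact: measurable_eta_eq.
rewrite eta_void//; last exact: finite_bigsetU.
rewrite measure_bigsetU_fin// -expR_sum/= sumrN.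
rewrite -sum_fine// => j _.
by rewrite ge0_fin_numE.
Qed.

Let measurable_void j : measurable_fun setT (fun w => void_ind w j).
Proof.
rewrite (_ : (fun _ => _) = \1_[set w | eta w (D j) = 0%E]).
  by apply: measurable_indic; exact: measurable_eta_eq.
apply/funext => w; rewrite indicE /void_ind /occupied negbK; congr ((nat_of_bool _)%:R).
by apply/eqP/idP => [H|/set_mem//]; exact/mem_set.
Qed.

Let void_moments j : all_moments P (fun w => void_ind w j).
Proof.
apply: all_moments_dom (all_moments_cst P 1) (measurable_void j) _ => w.
by rewrite /void_ind; case: occupied; rewrite /= !(normr0, normr1).
Qed.

Definition occupied_prob j (b : bool) : R :=
  if b then 1 - expR (- lam (D j)) else expR (- lam (D j)).

Let bit_fun (u : J -> bool -> R) w j :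
  u j (occupied w j) = (u j false - u j true) * void_ind w j + u j true.
Proof.
rewrite /void_ind; case: occupied => /=; first by rewrite mulr0 add0r.
by rewrite mulr1 subrK.
Qed.

Lemma bit_moments u j : all_moments P (fun w => u j (occupied w j)).
Proof.
under [X in all_moments _ X]eq_fun do rewrite bit_fun.
by apply: all_momentsD; [exact: all_momentsZ|exact: all_moments_cst].
Qed.

(** A function of one bit is affine in the void indicator; expanding the product over subsets of
    cells reduces the claim to the factorized void probabilities. *)
Lemma mean_bits (u : J -> bool -> R) : mean (fun w => \prod_j u j (occupied w j)) =
  \prod_j (u j false * occupied_prob j false + u j true * occupied_prob j true).
Proof.
pose c (S : {set J}) := \prod_(j in S) (u j false - u j true) * \prod_(j in ~: S) u j true.
transitivity (mean (fun w => \sum_(S in {set J}) c S * \prod_(j in S) void_ind w j)).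
  apply: eq_Rintegral => w _; under eq_bigr do rewrite bit_fun.
  rewrite bigA_distr; apply: eq_bigr => S _; rewrite (bigID (mem S))/=.
  rewrite (eq_bigr (fun j => (u j false - u j true) * void_ind w j)); last by move=> j ->.
  rewrite big_split [X in _ * X](eq_bigr (fun j => u j true)); last by move=> j /negPf->.
  rewrite /c [X in _ = _ * X * _](eq_bigl (fun j => j \notin S)) => [|j]; last by rewrite inE.
  by rewrite -!mulrA [X in _ * X]mulrC.
rewrite mean_sum; last by move=> S _; apply: all_momentsZ; exact: all_moments_prod.
transitivity (\sum_(S in {set J}) c S * \prod_(j in S) expR (- lam (D j))).
  by apply: eq_bigr => S _; rewrite meanZ ?mean_void//; exact: all_moments_prod.
rewrite [RHS](eq_bigr (fun j => (u j false - u j true) * expR (- lam (D j)) + u j true)); last first.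
  by move=> j _; rewrite /occupied_prob; ring.
rewrite bigA_distr; apply: eq_bigr => S _; rewrite [RHS](bigID (mem S))/=.
rewrite [X in _ = X * _](eq_bigr (fun j => (u j false - u j true) * expR (- lam (D j)))); last by move=> j ->.
rewrite big_split [X in _ = _ * X](eq_bigr (fun j => u j true)); last by move=> j /negPf->.
rewrite /c [X in _ * X * _](eq_bigl (fun j => j \notin S)) => [|j]; last by rewrite inE.
by rewrite -!mulrA [X in _ * X]mulrC.
Qed.

End bits.

Section block_counts.
Context {I V : finType}.
Variable D : I * V -> set Z.
Hypotheses (mD : forall j, measurable (D j)) (Doo : forall j, (mu (D j) < +oo)%E)
  (tD : disjoint_family D).

(** A substitute for the mass of block i, exact when every cell (i, v) of that block has mass 0 or
    1. *)
Definition occupied_cells w i : R := \sum_v (occupied D w (i, v))%:R.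

Let cnt (c : {ffun V -> bool}) : R := \sum_v (c v)%:R.

Let prob i (c : {ffun V -> bool}) : R := \prod_v occupied_prob D (i, v) (c v).

Let fun_occupied (phi : R -> R) w i : phi (occupied_cells w i) =
  \sum_(c : {ffun V -> bool}) phi (cnt c) * \prod_v (occupied D w (i, v) == c v)%:R.
Proof.
rewrite (bigD1 [ffun v => occupied D w (i, v)])//= [X in _ * X]big1 ?mulr1; last first.
  by move=> v _; rewrite ffunE eqxx.
rewrite big1 ?addr0; last first.
  move=> c /eqP cN; suff -> : \prod_v (occupied D w (i, v) == c v)%:R = 0 :> R by rewrite mulr0.
  apply/eqP; rewrite prodf_seq_eq0; apply/hasP.
  have [v cv] : exists v, occupied D w (i, v) != c v.
    apply/existsP; apply: contraT; rewrite negb_exists => /forallP H; exfalso; apply: cN.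
    by apply/ffunP => v; rewrite ffunE; have := H v; rewrite negbK => /eqP ->.
  by exists v; rewrite ?mem_index_enum//= (negPf cv) eqxx.
by congr phi; apply: eq_bigr => v _; rewrite ffunE.
Qed.

Lemma occupied_cells_moments (phi : R -> R) i :
  all_moments P (fun w => phi (occupied_cells w i)).
Proof.
under [X in all_moments _ X]eq_fun do rewrite fun_occupied.
apply: all_moments_sum => c _; apply: all_momentsZ; apply: all_moments_prod => v _.
exact: (bit_moments mD (fun _ b => (b == c v)%:R)).
Qed.

Let mean_one (phi : R -> R) i : mean (fun w => phi (occupied_cells w i)) =
  \sum_(c : {ffun V -> bool}) phi (cnt c) * prob i c.
Proof.
have tDi : disjoint_family (fun v => D (i, v)).
  by move=> v v' vv'; apply: tD; apply: contra_neq vv' => -[].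
under eq_Rintegral do rewrite fun_occupied.
have mom c : all_moments P (fun w => \prod_v (occupied D w (i, v) == c v)%:R).
  by apply: all_moments_prod => v _; exact: (bit_moments mD (fun _ b => (b == c v)%:R)).
rewrite mean_sum; last by move=> c _; exact: all_momentsZ.
apply: eq_bigr => c _; rewrite meanZ//; congr (_ * _).
rewrite (mean_bits (D := fun v => D (i, v)) _ _ tDi (fun v b => (b == c v)%:R))//.
by apply: eq_bigr => v _; case: (c v); rewrite /= !(mul0r, mul1r, addr0, add0r).
Qed.

(** Each factor is split according to the occupancy pattern of its block; the mean of a joint
    pattern factorizes by [mean_bits]. *)
Lemma mean_occupied_cells (phi : I -> R -> R) :
  mean (fun w => \prod_i phi i (occupied_cells w i)) =
  \prod_i mean (fun w => phi i (occupied_cells w i)).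
Proof.
under [in RHS]eq_bigr do rewrite mean_one.
rewrite bigA_distr_bigA.
transitivity (mean (fun w => \sum_(b : {ffun I -> {ffun V -> bool}})
    (\prod_i phi i (cnt (b i))) * \prod_j (occupied D w j == b j.1 j.2)%:R)).
  apply: eq_Rintegral => w _; under eq_bigr do rewrite fun_occupied.
  rewrite bigA_distr_bigA; apply: eq_bigr => b _; rewrite big_split; congr (_ * _).
  by rewrite pair_bigA; apply: eq_bigr => -[].
have mom (b : {ffun I -> {ffun V -> bool}}) :
    all_moments P (fun w => \prod_j (occupied D w j == b j.1 j.2)%:R).
  by apply: all_moments_prod => j _; exact: (bit_moments mD (fun _ x => (x == b j.1 j.2)%:R)).
rewrite mean_sum; last by move=> b _; exact: all_momentsZ.
apply: eq_bigr => b _; rewrite meanZ// big_split; congr (_ * _).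
rewrite (mean_bits mD Doo tD (fun j x => (x == b j.1 j.2)%:R)).
rewrite /prob pair_bigA; apply: eq_bigr => -[i v] _ /=.
by case: (b i v); rewrite /= !(mul0r, mul1r, addr0, add0r).
Qed.

End block_counts.
End poisson_void.

Lemma measurable_pointwise_bits {d} {Z : measurableType d} {R : realType} (h : Z -> R)
    n (r : 'I_n -> R) (v : 'I_n -> bool) : measurable_fun setT h ->
  measurable [set z | forall m, (h z <= r m) = v m].
Proof.
move=> mh; rewrite (_ : [set _ | _] = \bigcap_(m in [set: 'I_n]) [set z | (h z <= r m) = v m]).
  apply: fin_bigcap_measurable => // m _.
  rewrite (_ : [set _ | _] = (fun z => h z <= r m) @^-1` [set v m])//.
  have mf : measurable_fun setT (fun z => h z <= r m) by exact: measurable_fun_ler.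
  by rewrite -[X in measurable X]setTI; exact: mf.
by apply/seteqP; split=> z /= H m //; [move=> _; exact: H|exact: H].
Qed.

Lemma le_measure_bigsetU {d} {T : measurableType d} {R : realType}
    (m : {measure set T -> \bar R}) (J : finType) (A : J -> set T) :
  (forall j, measurable (A j)) -> (m (\big[setU/set0]_j A j) <= \sum_j m (A j))%E.
Proof.
move=> mA; elim: (index_enum J) => [|j r IHr]; first by rewrite !big_nil measure0.
rewrite !big_cons; set B := \big[setU/set0]_(j <- r) A j in IHr *.
have mB : measurable B by exact: bigsetU_measurable.
by apply: (@le_trans _ _ (m (A j) + m B)%E); [exact: measureU2|rewrite leeD2l].
Qed.

Lemma cvg_dist_le {R : realType} (a rho : nat -> R) (l c : R) :
  (forall n, `|a n - l| <= c * rho n) -> rho n @[n --> \oo] --> 0 ->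
  a n @[n --> \oo] --> l.
Proof.
move=> al rho0; have c0 : c * rho n @[n --> \oo] --> 0.
  by rewrite -(mulr0 c); exact: cvgMr.
apply: (@squeeze_cvgr _ _ _ _ (fun n => l - c * rho n) (fun n => l + c * rho n)).
- by apply: nearW => n; have := al n; rewrite ler_distl.
- by rewrite -[X in _ --> X]subr0; apply: cvgB => //; exact: cvg_cst.
- by rewrite -[X in _ --> X]addr0; apply: cvgD => //; exact: cvg_cst.
Qed.

Section mean_close.
Context {d : measure_display} {T : measurableType d} {R : realType}.
Variable P : probability T R.

Lemma bounded_all_moments (Y : T -> R) (M : R) : measurable_fun setT Y ->
  (forall w, `|Y w| <= M) -> all_moments P Y.
Proof.
move=> mY YM; apply: all_moments_dom (all_moments_cst P M) mY _ => w.
by rewrite (le_trans (YM w))// ler_norm.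
Qed.

Lemma mean_close (Y Y' : T -> R) (M : R) (A : set T) :
  measurable_fun setT Y -> measurable_fun setT Y' -> measurable A ->
  (forall w, `|Y w| <= M) -> (forall w, `|Y' w| <= M) ->
  (forall w, ~ A w -> Y w = Y' w) ->
  `|\int[P]_w Y w - \int[P]_w Y' w| <= 2 * M * fine (P A).
Proof.
move=> mY mY' mA YM Y'M YY'.
have aY := bounded_all_moments mY YM; have aY' := bounded_all_moments mY' Y'M.
have aD := all_momentsB aY aY'.
rewrite -meanB//; apply: le_trans (le_normr_Rintegral _ _) _ => //.
  exact: all_moments_integrable.
have aA : all_moments P (\1_A : T -> R).
  apply: (bounded_all_moments (M := 1)) => // w.
  by rewrite indicE; case: (_ \in _); rewrite /= !(normr0, normr1).
have -> : 2 * M * fine (P A) = \int[P]_w (2 * M * \1_A w).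
  by rewrite meanZ// [in RHS]/Rintegral integral_indic// setIT.
apply: le_Rintegral => //.
- apply: all_moments_integrable; apply: all_moments_dom aD _ _ => [|w].
    by apply: measurableT_comp => //; exact: measurable_funB.
  by rewrite normr_id.
- by apply: all_moments_integrable; exact: all_momentsZ.
- move=> w _; rewrite indicE; case: (boolP (w \in A)) => [_|/negP wA].
    by rewrite mulr1 mulr_natl mulr2n (le_trans (ler_normB _ _))// lerD.
  by rewrite YY' ?subrr ?normr0 ?mulr0// => /mem_set.
Qed.

End mean_close.

(** * Mutual independence of the masses of disjoint blocks *)

Section independence.
Context {d dO : measure_display} {Z : measurableType d} {Omega : measurableType dO}.
Context {R : realType}.
Variables (mu : {sigma_finite_measure set Z -> \bar R}) (P : probability Omega R).
Variable eta : R.-ker Omega ~> Z.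
Hypotheses (ZE : borel_space Z R) (muE : no_atoms mu) (PE : poisson_measure P mu eta).

Local Notation mean Y := (\int[P]_w Y w).
Local Notation lam B := (fine (mu B)).

Lemma measurable_point (h : Z -> R) (x : Z) : injective h -> measurable_fun setT h ->
  d.-measurable [set x].
Proof.
move=> ih mh; rewrite (_ : [set x] = h @^-1` [set h x]).
  by rewrite -[X in measurable X]setTI; exact: mh.
by apply/seteqP; split=> y /= => [->//|/ih].
Qed.

Lemma point_null (x : Z) : mu [set x] = 0%E.
Proof.
have [h [ih mh _]] := ZE; have mx := measurable_point x ih mh.
apply/eqP; apply: contraT => mux.
have /(muE mx)[B [mB Bx B0 Bx0]] : (0 < mu [set x])%E by rewrite lt_neqAle eq_sym mux measure_ge0.
have [Bxx|nBx] := pselect (B x).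
  by move: Bx0; rewrite (_ : _ `\` _ = set0) ?measure0 ?ltxx//; apply/seteqP; split=> // y [/= -> /(_ Bxx)].
move: B0; rewrite (_ : B = set0) ?measure0 ?ltxx//; apply/seteqP; split=> // y By.
by have /= yx := Bx _ By; rewrite yx in By.
Qed.

Section cells.
Context {I : finType}.
Variable D : I -> set Z.
Hypotheses (mD : forall i, measurable (D i)) (Doo : forall i, (mu (D i) < +oo)%E)
  (tD : disjoint_family D).
Variable h : Z -> R.
Hypotheses (ih : injective h) (mh : measurable_fun setT h).

(** An enumeration of the rationals; a number that codes no rational gives the level 0, which at
    most repeats a cut. *)
Definition rational_level (m : nat) : R := ratr (odflt 0 (unpickle m : option rat)).

(** The points of one block on prescribed sides of the first n rational levels. The partitions
    refine as n grows and, [h] being injective, separate any two points in the end. *)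
Definition cell n (j : I * {ffun 'I_n -> bool}) : set Z :=
  D j.1 `&` [set z | forall m : 'I_n, (h z <= rational_level m) = j.2 m].

Lemma measurable_cell n j : measurable (@cell n j).
Proof. by apply: measurableI => //; exact: measurable_pointwise_bits. Qed.

Lemma cell_finite n j : (mu (@cell n j) < +oo)%E.
Proof.
apply: le_lt_trans (Doo j.1); apply: le_measure; rewrite ?inE//.
- exact: measurable_cell.
- exact: subIsetl.
Qed.

Lemma disjoint_cell n : disjoint_family (@cell n).
Proof.
move=> -[i v] [i' v'] jj'; apply/disj_setPS => z [[/= Di zv] [/= Di' zv']].
move: jj'; rewrite (disjoint_family_inj tD Di Di') (_ : v = v') ?eqxx//.
by apply/ffunP => m; rewrite -zv zv'.
Qed.

Lemma disjoint_cell1 n i : disjoint_family (fun v => @cell n (i, v)).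
Proof. by move=> v v' vv'; apply: disjoint_cell; apply: contra_neq vv' => -[]. Qed.

Lemma bigsetU_cell n i : \big[setU/set0]_v @cell n (i, v) = D i.
Proof.
apply/seteqP; split=> z; first by move=> /bigsetUP[v _ []].
move=> Dz; apply/bigsetUP; exists [ffun m : 'I_n => h z <= rational_level m] => //.
by split=> //= m; rewrite ffunE.
Qed.

Lemma cell_sum (m : {measure set Z -> \bar R}) n i : m (D i) = (\sum_v m (@cell n (i, v)))%E.
Proof.
rewrite -(bigsetU_cell n i) measure_bigsetU_fin// => [v|]; first exact: measurable_cell.
exact: disjoint_cell1.
Qed.

(** The pairs not yet separated by n levels. Their product measure is the sum of the squared cell
    masses, which turns the smallness of that sum into a statement about the diagonal. *)
Definition cell_pairs n i : set (Z * Z) :=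
  \big[setU/set0]_v (@cell n (i, v) `*` @cell n (i, v)).

Lemma cell_pairsP n i z : cell_pairs n i z <-> [/\ D i z.1, D i z.2 &
  forall m, (m < n)%N -> (h z.1 <= rational_level m) = (h z.2 <= rational_level m)].
Proof.
split=> [/bigsetUP[v _ [[/= D1 z1] [/= D2 z2]]]|[D1 D2 z12]].
  by split=> // m mn; rewrite (z1 (Ordinal mn)) (z2 (Ordinal mn)).
apply/bigsetUP; exists [ffun m : 'I_n => h z.1 <= rational_level m] => //.
by split; split=> //= m; rewrite ffunE// -z12.
Qed.

Lemma measurable_cell_pairs n i : measurable (cell_pairs n i).
Proof. by apply: bigsetU_measurable => v _; apply: measurableX; exact: measurable_cell. Qed.

Lemma measure_cell_pairs n i :
  ((mu \x mu) (cell_pairs n i) = (\sum_v lam (@cell n (i, v)) ^+ 2)%:E)%E.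
Proof.
rewrite -sumEFin.
transitivity (\sum_v (mu \x mu)%E (@cell n (i, v) `*` @cell n (i, v)))%E.
  apply: measure_bigsetU_fin => [v|v v' vv'].
    by apply: measurableX; exact: measurable_cell.
  apply/disj_setPS => z [[/= z1 _] [/= z1' _]].
  by rewrite (disjoint_family_inj (@disjoint_cell1 n i) z1 z1') eqxx in vv'.
apply: eq_bigr => v _.
rewrite product_measure1E; [|exact: measurable_cell|exact: measurable_cell].
by rewrite expr2 EFinM fineK// ge0_fin_numE//; exact: cell_finite.
Qed.

(** A rational lies between two distinct values of [h], so pairs never separated lie on the
    diagonal; its sections are points, which are null because [mu] has no atoms. *)
Lemma same_cells_null i : (mu \x mu)%E (\bigcap_n cell_pairs n i) = 0%E.
Proof.
have mC : measurable (\bigcap_n cell_pairs n i).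
  by apply: bigcapT_measurable => n; exact: measurable_cell_pairs.
rewrite /= /product_measure1 integral0_eq// => x _ /=.
apply: subset_measure0 (point_null x) => //.
- exact: measurable_xsection.
- exact: measurable_point ih mh.
move=> y; rewrite /xsection/= inE => xy; apply: ih; apply/eqP; apply: contraT => neq.
have lev (s t : Z) : h s < h t -> (\bigcap_n cell_pairs n i) (s, t) \/
    (\bigcap_n cell_pairs n i) (t, s) -> False.
  move=> /rat_in_itvoo[r]; rewrite in_itv/= => /andP[sr rt] H.
  have rE : rational_level (pickle r) = ratr r by rewrite /rational_level pickleK.
  have : (h s <= ratr r) = (h t <= ratr r).
    by case: H => /(_ (pickle r).+1 Logic.I)/cell_pairsP[_ _ /(_ _ (ltnSn _))]/=; rewrite rE.
  by rewrite (ltW sr) leNgt rt.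
by case: (ltgtP (h y) (h x)) neq => // [yx|xy'] _; [have := lev _ _ yx|have := lev _ _ xy'];
  case; [right|left].
Qed.

(** Continuity from above of the product measure along the decreasing sets [cell_pairs], of finite
    measure from n = 0 on. *)
Lemma cell_squares_cvg0 i : \sum_v lam (@cell n (i, v)) ^+ 2 @[n --> \oo] --> (0 : R).
Proof.
suff /fine_cvg : (\sum_v lam (@cell n (i, v)) ^+ 2)%:E @[n --> \oo] --> (0 : R)%:E by [].
have H : (mu \x mu)%E \o (cell_pairs ^~ i) @ \oo --> (mu \x mu)%E (\bigcap_n cell_pairs n i).
  apply: nonincreasing_cvg_mu.
  - by change ((mu \x mu)%E (cell_pairs 0 i) < +oo)%E; rewrite measure_cell_pairs ltry.
  - by move=> n; exact: measurable_cell_pairs.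
  - by apply: bigcapT_measurable => n; exact: measurable_cell_pairs.
  - move=> n m nm; apply/subsetPset => z /cell_pairsP[D1 D2 z12]; apply/cell_pairsP; split=> // k kn.
    by apply: z12; exact: leq_trans nm.
rewrite same_cells_null in H.
by under eq_fun do rewrite -measure_cell_pairs.
Qed.

(** The exceptional event that some cell has a mass other than 0 and 1. Off it, counting occupied
    cells gives the true masses. *)
Definition crowded n : set Omega := \big[setU/set0]_j multiple_points eta (@cell n j).

Lemma measurable_crowded n : measurable (crowded n).
Proof.
apply: bigsetU_measurable => j _; apply: measurable_multiple_points; exact: measurable_cell.
Qed.

Lemma crowded_le n : fine (P (crowded n)) <= \sum_i \sum_v lam (@cell n (i, v)) ^+ 2.
Proof.
rewrite -lee_fin fineK ?fin_num_measure//; last exact: measurable_crowded.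
apply: le_trans (le_measure_bigsetU _ _) _.
  by move=> j; apply: measurable_multiple_points; exact: measurable_cell.
rewrite pair_bigA -sumEFin; apply: lee_sum => -[i v] _ /=.
by apply: multiple_points_le => //; [exact: measurable_cell|exact: cell_finite].
Qed.

Lemma uncrowded n w i : ~ crowded n w ->
  occupied_cells eta (@cell n) w i = fine (eta w (D i)).
Proof.
move=> cw; rewrite (cell_sum (eta w) n i).
have e01 v : eta w (@cell n (i, v)) = (occupied eta (@cell n) w (i, v))%:R%:E.
  have : ~ multiple_points eta (cell (i, v)) w.
    by move=> H; apply: cw; apply/bigsetUP; exists (i, v).
  move=> /contrapT[e|e]; rewrite /occupied e; first by rewrite eqxx.
  by rewrite -[1%E]/(1%:E) eqe oner_eq0.
by rewrite (eq_bigr _ (fun v _ => e01 v)) sumEFin.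
Qed.

End cells.

Section independent_counts.
Context {I : finType}.
Variable D : I -> set Z.
Hypotheses (mD : forall i, measurable (D i)) (Doo : forall i, (mu (D i) < +oo)%E)
  (tD : disjoint_family D).

Let Y i w := fine (eta w (D i)).

Let mY i : measurable_fun setT (Y i).
Proof. by apply: measurableT_comp => //; exact: measurable_eta. Qed.

(** For each n the cell counts factorize exactly, and they differ from the masses only on [crowded],
    whose probability is at most [rho n]. Both sides of the factorization pass to the limit. *)
Lemma mean_prod_bounded (phi : I -> R -> R) (M : R) :
  (forall i, measurable_fun setT (phi i)) -> (forall i y, `|phi i y| <= M) ->
  mean (fun w => \prod_i phi i (Y i w)) = \prod_i mean (fun w => phi i (Y i w)).
Proof.
move=> mphi phiM; have [h [ih mh _]] := ZE.
pose N n i w := occupied_cells eta (cell D h (n := n)) w i.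
pose rho n := \sum_i \sum_v lam (cell D h (n := n) (i, v)) ^+ 2.
have rho0 : rho n @[n --> \oo] --> 0.
  rewrite -(@big1 R 0 +%R I (index_enum I) predT (fun=> 0))//.
  by apply: cvg_big => [|i _]; [exact: add_continuous|exact: cell_squares_cvg0].
have Mb n i w : `|phi i (N n i w)| <= M by exact: phiM.
have mN n i : measurable_fun setT (fun w => phi i (N n i w)).
  by have [] := occupied_cells_moments P eta (@measurable_cell _ D mD h mh n) (phi i) i.
have mphiY i : measurable_fun setT (fun w => phi i (Y i w)) by exact: measurableT_comp.
(* Stated for an arbitrary set of indices, so that [predT] serves the product and [pred1 i] the
   single means. *)
have close (Q : pred I) n : `|mean (fun w => \prod_(i | Q i) phi i (N n i w)) -
    mean (fun w => \prod_(i | Q i) phi i (Y i w))| <= (2 * \prod_(i | Q i) M) * rho n.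
  have M0 i (_ : Q i) : 0 <= M by apply: le_trans (phiM i 0).
  apply: (@le_trans _ _ (2 * \prod_(i | Q i) M * fine (P (crowded D h n)))); last first.
    by rewrite ler_wpM2l ?crowded_le// mulr_ge0// prodr_ge0.
  apply: mean_close.
  - have H i (_ : Q i) : all_moments P (fun w => phi i (N n i w)).
      by apply: (@bounded_all_moments _ _ _ _ _ M) => // w; exact: Mb.
    by have [] := all_moments_prod (index_enum I) H.
  - have H i (_ : Q i) : all_moments P (fun w => phi i (Y i w)).
      by apply: (@bounded_all_moments _ _ _ _ _ M) => // w; exact: phiM.
    by have [] := all_moments_prod (index_enum I) H.
  - exact: measurable_crowded.
  - by move=> w; rewrite normr_prod; apply: ler_prod => i Qi; rewrite normr_ge0 phiM.
  - by move=> w; rewrite normr_prod; apply: ler_prod => i Qi; rewrite normr_ge0 phiM.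
  - by move=> w cw; apply: eq_bigr => i _; rewrite /N uncrowded.
have cvgL := cvg_dist_le (close predT) rho0.
have cvgR : \prod_i mean (fun w => phi i (N n i w)) @[n --> \oo] -->
    \prod_i mean (fun w => phi i (Y i w)).
  apply: cvg_big => [|i _]; first exact: mul_continuous.
  have := cvg_dist_le (close (pred1 i)) rho0.
  under eq_fun do under eq_Rintegral do rewrite big_pred1_eq.
  by under [X in _ --> X -> _]eq_Rintegral do rewrite big_pred1_eq.
apply: cvg_unique cvgL _ => //.
apply: cvg_trans cvgR; apply: near_eq_cvg; apply: nearW => n.
by rewrite (mean_occupied_cells PE)//;
  [exact: measurable_cell|exact: cell_finite|exact: disjoint_cell].
Qed.

End independent_counts.
End independence.

Lemma mean_cvg {d : measure_display} {T : measurableType d} {R : realType}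
    (P : probability T R) (Yn : nat -> T -> R) (Y g : T -> R) :
  (forall n, measurable_fun setT (Yn n)) -> measurable_fun setT Y -> all_moments P g ->
  (forall w, Yn n w @[n --> \oo] --> Y w) -> (forall n w, `|Yn n w| <= `|g w|) ->
  \int[P]_w Yn n w @[n --> \oo] --> \int[P]_w Y w.
Proof.
move=> mYn mY ag YnY Yng.
have [|||||Yi _ H] := @dominated_convergence _ _ _ P setT measurableT
    (fun n => EFin \o Yn n) (EFin \o Y) (fun w => `|g w|%:E).
- by move=> n; exact/measurable_EFinP.
- exact/measurable_EFinP.
- by apply: nearW => w _; apply: cvg_EFin; [apply: nearW|exact: YnY].
- have ag' : all_moments P (fun w => `|g w|).
    apply: (all_moments_dom ag) => [|w]; last by rewrite normr_id.
    by apply: measurableT_comp => //; case: ag.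
  exact: all_moments_integrable ag'.
- by apply: nearW => w n _; rewrite /= lee_fin.
by apply: fine_cvg; rewrite fineK//; apply: integrable_fin_num.
Qed.

(** * Product moments and Stein identities of compensated masses *)

Section independent_moments.
Context {d dO : measure_display} {Z : measurableType d} {Omega : measurableType dO}.
Context {R : realType}.
Variables (mu : {sigma_finite_measure set Z -> \bar R}) (P : probability Omega R).
Variable eta : R.-ker Omega ~> Z.
Hypotheses (ZE : borel_space Z R) (muE : no_atoms mu) (PE : poisson_measure P mu eta).

Local Notation mean Y := (\int[P]_w Y w).
Local Notation lam B := (fine (mu B)).
Local Notation xi := (compensated mu eta).

Lemma xi_moments B : measurable B -> (mu B < +oo)%E -> all_moments P (xi B).
Proof.
move=> mB Boo.
apply: (@centered_poisson_all_moments _ _ _ _ (eta ^~ B) (lam B)); rewrite ?fine_ge0//.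
- exact: measurable_eta.
- exact: eta_poisson PE _ _ _.
Qed.

Lemma xi_stein B k : measurable B -> (mu B < +oo)%E -> mean (fun w => xi B w ^+ k.+1) =
  lam B * mean (fun w => (xi B w + 1) ^+ k) - lam B * mean (fun w => xi B w ^+ k).
Proof.
move=> mB Boo.
apply: (@centered_poisson_stein _ _ _ _ (eta ^~ B) (lam B)); rewrite ?fine_ge0//.
- exact: measurable_eta.
- exact: eta_poisson PE _ _ _.
Qed.

Lemma xi_moment_ge0 B k : measurable B -> (mu B < +oo)%E -> 0 <= mean (fun w => xi B w ^+ k).
Proof.
move=> mB Boo.
apply: (@centered_poisson_moment_ge0 _ _ _ _ (eta ^~ B) (lam B)); rewrite ?fine_ge0//.
- exact: measurable_eta.
- exact: eta_poisson PE _ _ _.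
Qed.

Lemma xi_small_moments B : measurable B -> (mu B < +oo)%E ->
  [/\ mean (fun w => xi B w ^+ 0) = 1, mean (fun w => xi B w ^+ 1) = 0,
      mean (fun w => xi B w ^+ 2) = lam B &
      mean (fun w => xi B w ^+ 4) = lam B + 3 * lam B ^+ 2].
Proof.
move=> mB Boo.
apply: (@centered_poisson_moments _ _ _ _ (eta ^~ B) (lam B)); rewrite ?fine_ge0//.
- exact: measurable_eta.
- exact: eta_poisson PE _ _ _.
Qed.

Section family.
Context {I : finType}.
Variable D : I -> set Z.
Hypotheses (mD : forall i, measurable (D i)) (Doo : forall i, (mu (D i) < +oo)%E)
  (tD : disjoint_family D).

Let Y i w := fine (eta w (D i)).

Let mY i : measurable_fun setT (Y i).
Proof. by apply: measurableT_comp => //; exact: measurable_eta. Qed.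

(** Each factor is replaced by 0 where it exceeds M in absolute value; the truncated product
    factorizes, and dominated convergence removes the truncation. *)
Lemma mean_prod_indep (phi : I -> R -> R) : (forall i, measurable_fun setT (phi i)) ->
  (forall i, all_moments P (fun w => phi i (Y i w))) ->
  mean (fun w => \prod_i phi i (Y i w)) = \prod_i mean (fun w => phi i (Y i w)).
Proof.
move=> mphi aphi.
pose psi (M : nat) i y := phi i y * (`|phi i y| <= M%:R :> R)%R%:R.
have mpsi M i : measurable_fun setT (psi M i).
  apply: measurable_funM => //.
  rewrite (_ : (fun _ => _) = \1_[set y | `|phi i y| <= M%:R]).
    apply: measurable_indic; rewrite -[X in measurable X]setTI.
    by apply: (measurable_fun_ler (f := fun y => `|phi i y|) (g := cst M%:R)) => //;
      apply: measurableT_comp.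
  apply/funext => y; rewrite indicE; congr ((nat_of_bool _)%:R).
  by apply/idP/idP => [H|/set_mem//]; exact/mem_set.
have psi_le M i y : `|psi M i y| <= M%:R.
  by rewrite /psi; case: (leP `|phi i y|) => [H|_]; rewrite /= ?(mulr1n, mulr0n, mulr1, mulr0, normr0).
have psi_phi M i y : `|psi M i y| <= `|phi i y|.
  by rewrite /psi; case: (leP `|phi i y|) => [H|_]; rewrite /= ?(mulr1n, mulr0n, mulr1, mulr0, normr0).
have psi_cvg i y : psi M i y @[M --> \oo] --> phi i y.
  apply: cvg_near_cst; near=> M; rewrite /psi (_ : (_ <= _) = true) ?mulr1n ?mulr1//.
  by near: M; exact: nbhs_infty_ger.
have mpsiY M i : measurable_fun setT (fun w => psi M i (Y i w)) by exact: measurableT_comp.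
have H1 : mean (fun w => \prod_i psi M i (Y i w)) @[M --> \oo] -->
    mean (fun w => \prod_i phi i (Y i w)).
  apply: (mean_cvg (g := fun w => \prod_i phi i (Y i w))).
  - by move=> M; apply: measurable_prod => i _.
  - by apply: measurable_prod => i _; case: (aphi i).
  - by apply: all_moments_prod => i _; exact: aphi.
  - by move=> w; apply: cvg_big => [|i _]; [exact: mul_continuous|exact: psi_cvg].
  - by move=> M w; rewrite !normr_prod; apply: ler_prod => i _; rewrite normr_ge0 psi_phi.
have H2 : \prod_i mean (fun w => psi M i (Y i w)) @[M --> \oo] -->
    \prod_i mean (fun w => phi i (Y i w)).
  apply: cvg_big => [|i _]; first exact: mul_continuous.
  by apply: (mean_cvg (g := fun w => phi i (Y i w))) => //; case: (aphi i).
apply: cvg_unique H1 _ => //; apply: cvg_trans H2; apply: near_eq_cvg; apply: nearW => M.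
by rewrite (mean_prod_bounded ZE muE PE mD Doo tD (mpsi M) (psi_le M)).
Unshelve. all: by end_near. Qed.

Lemma mean_monomial (k : I -> nat) :
  mean (fun w => \prod_i xi (D i) w ^+ k i) = \prod_i mean (fun w => xi (D i) w ^+ k i).
Proof.
apply: (mean_prod_indep (phi := fun i y => (y - lam (D i)) ^+ k i)) => i.
  by apply: measurable_funX; apply: measurable_funB.
by apply: all_momentsX; exact: xi_moments.
Qed.

(** The Mecke formula restricted to functions of finitely many blocks: multiplication by xi_i is
    traded for the difference of [Psi] when one point is added in block i. *)
Definition stein_function (Psi : (I -> R) -> R) := forall i,
  [/\ all_moments P (fun w => Psi (fun j => xi (D j) w)),
      all_moments P (fun w => Psi (fun j => xi (D j) w + (j == i)%:R)) &
      mean (fun w => xi (D i) w * Psi (fun j => xi (D j) w)) =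
      lam (D i) * (mean (fun w => Psi (fun j => xi (D j) w + (j == i)%:R))
                   - mean (fun w => Psi (fun j => xi (D j) w)))].

Lemma stein_monomial (k : I -> nat) : stein_function (fun x => \prod_i x i ^+ k i).
Proof.
have aX i n : all_moments P (fun w => xi (D i) w ^+ n).
  by apply: all_momentsX; exact: xi_moments.
have aXb i (b : R) n : all_moments P (fun w => (xi (D i) w + b) ^+ n).
  by apply: all_momentsX; apply: all_momentsD; [exact: xi_moments|exact: all_moments_cst].
move=> i; split; try by apply: all_moments_prod.
have shiftE : mean (fun w => \prod_j (xi (D j) w + (j == i)%:R) ^+ k j) =
    mean (fun w => (xi (D i) w + 1) ^+ k i) * \prod_(j | j != i) mean (fun w => xi (D j) w ^+ k j).
  rewrite (mean_prod_indep (phi := fun j y => (y - lam (D j) + (j == i)%:R) ^+ k j)) => [|j|j].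
  - rewrite (bigD1 i)//= eqxx; congr (_ * _); apply: eq_bigr => j /negPf->.
    by apply: eq_Rintegral => w _; rewrite addr0.
  - by apply: measurable_funX; apply: measurable_funD => //; exact: measurable_funB.
  - exact: aXb.
have -> : (fun w => xi (D i) w * \prod_j xi (D j) w ^+ k j) =
    (fun w => \prod_j xi (D j) w ^+ (k j + (j == i))).
  apply/funext => w; rewrite (bigD1 i)//= [RHS](bigD1 i)//= eqxx addn1 exprS mulrA.
  by congr (_ * _); apply: eq_bigr => j /negPf->; rewrite addn0.
rewrite shiftE !mean_monomial (bigD1 i)//= eqxx addn1 xi_stein// [X in _ = _ * (_ - X)](bigD1 i)//=.
rewrite (eq_bigr (fun j => mean (fun w => xi (D j) w ^+ k j))); last first.
  by move=> j /negPf->; rewrite addn0.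
by ring.
Qed.

Lemma stein_sum (J : finType) (c : J -> R) (Psi : J -> (I -> R) -> R) :
  (forall j, stein_function (Psi j)) -> stein_function (fun x => \sum_j c j * Psi j x).
Proof.
move=> H i.
have a1 j : all_moments P (fun w => Psi j (fun j => xi (D j) w)) by case: (H j i).
have a2 j : all_moments P (fun w => Psi j (fun j => xi (D j) w + (j == i)%:R)) by case: (H j i).
have a3 j : all_moments P (fun w => xi (D i) w * Psi j (fun j => xi (D j) w)).
  by apply: all_momentsM => //; exact: xi_moments.
split; try by apply: all_moments_sum => j _; exact: all_momentsZ.
have -> : (fun w => xi (D i) w * \sum_j c j * Psi j (fun j => xi (D j) w)) =
    (fun w => \sum_j c j * (xi (D i) w * Psi j (fun j => xi (D j) w))).
  by apply/funext => w; rewrite mulr_sumr; apply: eq_bigr => j _; rewrite mulrCA.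
rewrite !mean_sum; try by move=> j _; exact: all_momentsZ.
rewrite -sumrB mulr_sumr; apply: eq_bigr => j _; rewrite !meanZ//.
by case: (H j i) => _ _ ->; ring.
Qed.

(** Products of linear forms arise because the mass of a block is a sum over a finer partition. The
    free monomial makes the induction work: expanding the first form raises one exponent. *)
Lemma stein_linear_forms (s : seq (I -> R)) (k : I -> nat) :
  stein_function (fun x => \prod_(a <- s) (\sum_i a i * x i) * \prod_i x i ^+ k i).
Proof.
elim: s k => [|a s IHs] k.
  have := stein_monomial k; congr stein_function.
  by apply/funext => x; rewrite big_nil mul1r.
have := stein_sum a (fun j => IHs (fun i => k i + (i == j))%N); congr stein_function.
apply/funext => x; rewrite big_cons -mulrA mulr_suml; apply: eq_bigr => j _.
rewrite -mulrA; congr (_ * _); rewrite mulrCA; congr (_ * _).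
rewrite (bigD1 j)//= [in RHS](bigD1 j)//= eqxx addn1 exprS -mulrA; congr (_ * (_ * _)).
by apply: eq_bigr => i /negPf->; rewrite addn0.
Qed.

Lemma stein_linear_prod (s : seq (I -> R)) :
  stein_function (fun x => \prod_(a <- s) (\sum_i a i * x i)).
Proof.
have := stein_linear_forms s (fun=> 0%N); congr stein_function.
by apply/funext => x; rewrite [X in _ * X]big1 ?mulr1// => i _; rewrite expr0.
Qed.

End family.
End independent_moments.

Lemma ae_forall_fin {d} {T : measurableType d} {R : realType}
    (m : {measure set T -> \bar R}) (J : finType) (Q : J -> T -> Prop) :
  (forall j, {ae m, forall w, Q j w}) -> {ae m, forall w, forall j, Q j w}.
Proof. by move=> H; apply: filter_forall. Qed.

Lemma sum_option {R : nmodType} {I : finType} (F : option I -> R) :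
  \sum_o F o = F None + \sum_i F (Some i).
Proof.
rewrite (bigD1 None)//=; congr (_ + _).
rewrite (reindex_omap Some id) => [|[i|]]//=.
by apply: eq_bigl => i; rewrite eqxx.
Qed.

Lemma sum_ffun_ord_recl {R : nmodType} {I : finType} n (F : {ffun 'I_n.+1 -> I} -> R) :
  \sum_b F b = \sum_b0 \sum_(b' : {ffun 'I_n -> I}) F [ffun i => oapp b' b0 (unlift ord0 i)].
Proof.
rewrite pair_bigA/= (reindex (fun p : I * {ffun 'I_n -> I} =>
  [ffun i => oapp p.2 p.1 (unlift ord0 i)]))//=.
exists (fun b => (b ord0, [ffun i => b (lift ord0 i)])) => [[b0 b'] _|b _] /=.
  by rewrite ffunE unlift_none/=; congr (_, _); apply/ffunP => i; rewrite !ffunE liftK.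
by apply/ffunP => i; rewrite ffunE; case: unliftP => [k ->|->] /=; rewrite ?ffunE.
Qed.

Lemma prod_seq_count {R : comPzSemiRingType} {I : finType} (F : I -> R) (s : seq I) :
  \prod_(b <- s) F b = \prod_b F b ^+ count_mem b s.
Proof.
elim: s => [|c s IHs]; first by rewrite big_nil big1// => b _; rewrite expr0.
rewrite big_cons IHs (bigD1 c)//= [RHS](bigD1 c)//= eqxx add1n exprS mulrA; congr (_ * _).
by apply: eq_bigr => b; rewrite eq_sym => /negPf->.
Qed.

Section word_differences.
Context {R : comRingType} {I : eqType}.

(** The words left after deleting a nonempty set of occurrences of [b]: the expansion of the add-one
    difference of a monomial in the variable [b]. *)
Fixpoint word_delta (b : I) (s : seq I) : seq (seq I) :=
  if s is b' :: s' then
    (if b' == b then s' :: word_delta b s' else [::]) ++ map (cons b') (word_delta b s')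
  else [::].

Lemma word_deltaE (x : I -> R) b s : \prod_(b' <- s) (x b' + (b' == b)%:R) =
  \prod_(b' <- s) x b' + \sum_(u <- word_delta b s) \prod_(b' <- u) x b'.
Proof.
elim: s => [|b' s IHs] /=; first by rewrite !big_nil addr0.
rewrite !big_cons IHs big_cat big_map/=.
under [X in _ + (_ + X)]eq_bigr do rewrite big_cons.
rewrite -mulr_sumr; case: ifP => _ /=; last by rewrite big_nil mulr0n; ring.
by rewrite big_cons mulr1n; ring.
Qed.

Lemma word_delta_notin b s : b \notin s -> word_delta b s = [::].
Proof.
elim: s => //= b' s IHs; rewrite inE negb_or eq_sym => /andP[/negPf-> bs].
by rewrite IHs.
Qed.

Lemma word_delta_uniq b s : uniq s -> {in word_delta b s, forall u,
  [/\ uniq u, {subset u <= s} & b \notin u]}.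
Proof.
elim: s => //= b' s IHs /andP[b's us] u; rewrite mem_cat => /orP[].
  case: eqP => // <-; rewrite word_delta_notin// inE => /eqP->.
  by split=> // c cs; rewrite inE cs orbT.
move=> /mapP[v /[dup] vs /(IHs us)[uv vss bv] ->] /=; split.
- by rewrite uv andbT; apply: contra b's => /vss.
- by move=> c; rewrite !inE => /orP[->//|/vss->]; rewrite orbT.
- rewrite inE negb_or bv andbT; apply: contraTneq vs => ->.
  by rewrite word_delta_notin.
Qed.

End word_differences.

Section complement_blocks.
Context {d : measure_display} {Z : measurableType d} {J : finType}.

(** Adjoining the complement turns a disjoint family into a partition, so that two families have a
    common refinement. *)
Definition block_or_rest (F : J -> set Z) (oj : option J) : set Z :=
  if oj is Some j then F j else ~` \big[setU/set0]_j F j.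

Lemma measurable_block_or_rest F oj : (forall j, measurable (F j)) ->
  measurable (block_or_rest F oj).
Proof.
by move=> mF; case: oj => [j|] //=; apply: measurableC; exact: bigsetU_measurable.
Qed.

Lemma disjoint_block_or_rest F : disjoint_family F -> disjoint_family (block_or_rest F).
Proof.
move=> tF [j|] [j'|] //= jj'.
- by apply: tF; apply: contra_neq jj' => ->.
- apply/disj_setPS => z [Fj] /=; apply; apply/bigsetUP; by exists j.
- apply/disj_setPS => z [/= + Fj]; apply; apply/bigsetUP; by exists j'.
Qed.

Lemma block_or_rest_cover F z : exists oj, block_or_rest F oj z.
Proof.
have [[j Fj]|nF] := pselect (exists j, F j z); first by exists (Some j).
by exists None => /= /bigsetUP[j _ Fj]; apply: nF; exists j.
Qed.

End complement_blocks.

Section word_means.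
Context {d dO : measure_display} {Z : measurableType d} {Omega : measurableType dO}.
Context {R : realType}.
Variables (mu : {sigma_finite_measure set Z -> \bar R}) (P : probability Omega R).
Variable eta : R.-ker Omega ~> Z.
Hypotheses (ZE : borel_space Z R) (muE : no_atoms mu) (PE : poisson_measure P mu eta).

Local Notation mean Y := (\int[P]_w Y w).
Local Notation lam B := (fine (mu B)).
Local Notation xi := (compensated mu eta).

(** Additivity holds almost everywhere only: [fine] is additive on finite masses, and a mass of
    finite mean is finite almost surely. *)
Lemma xi_bigsetU (J : finType) (D : J -> set Z) (Q : pred J) :
  (forall j, measurable (D j)) -> (forall j, (mu (D j) < +oo)%E) -> disjoint_family D ->
  {ae P, forall w, xi (\big[setU/set0]_(j | Q j) D j) w = \sum_(j | Q j) xi (D j) w}.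
Proof.
move=> mD Doo tD.
have := ae_forall_fin (fun j => eta_nat PE (mD j) (Doo j)).
apply: filterS => w /= etan; rewrite /compensated !measure_bigsetU_fin// sumrB.
rewrite !sum_fine// => j _; first by rewrite ge0_fin_numE.
by have [n ->] := etan j.
Qed.

Lemma xi_set0 w : xi set0 w = 0.
Proof. by rewrite /compensated !measure0 subrr. Qed.

Section two_families.
Context {A I : finType}.
Variables (C : A -> set Z) (B : I -> set Z).
Hypotheses (mC : forall a, measurable (C a)) (Coo : forall a, (mu (C a) < +oo)%E)
  (tC : disjoint_family C).
Hypotheses (mB : forall b, measurable (B b)) (Boo : forall b, (mu (B b) < +oo)%E)
  (tB : disjoint_family B).

(** The part outside both families may have infinite measure. It lies in no block of either family,
    so it is replaced by the empty set. *)
Definition common_block (o : option A * option I) : set Z :=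
  if o == (None, None) then set0 else block_or_rest C o.1 `&` block_or_rest B o.2.

Let mE o : measurable (common_block o).
Proof.
rewrite /common_block; case: ifP => _ //.
by apply: measurableI; exact: measurable_block_or_rest.
Qed.

Let Eoo o : (mu (common_block o) < +oo)%E.
Proof.
have le_mu X Y : measurable X -> measurable Y -> (mu Y < +oo)%E -> (mu (X `&` Y) < +oo)%E.
  move=> mX mY; apply: le_lt_trans; apply: le_measure; last exact: subIsetr.
    by rewrite inE; exact: measurableI.
  by rewrite inE.
case: o (mE o) => -[a|] [b|] _; rewrite /common_block//= ?measure0//.
- by apply: le_mu.
- by rewrite setIC; apply: le_mu => //; exact: (@measurable_block_or_rest _ _ _ B None).
- by apply: le_mu => //; exact: (@measurable_block_or_rest _ _ _ C None).
Qed.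

Let tE : disjoint_family common_block.
Proof.
move=> o o' oo'; apply/disj_setPS => z []; rewrite /common_block; case: ifP => // _ [Co Bo].
case: ifP => // _ [Co' Bo']; move: oo'.
rewrite (surjective_pairing o) (surjective_pairing o').
rewrite (disjoint_family_inj (disjoint_block_or_rest tC) Co Co').
by rewrite (disjoint_family_inj (disjoint_block_or_rest tB) Bo Bo') eqxx.
Qed.

Let CE a : C a = \big[setU/set0]_(o | o.1 == Some a) common_block o.
Proof.
apply/seteqP; split=> z.
  move=> Ca; have [cb Bob] := block_or_rest_cover B z.
  by apply/bigsetUP; exists (Some a, cb) => //=; rewrite /common_block.
by move=> /bigsetUP[[ca cb] /= /eqP->]; rewrite /common_block/= => -[].
Qed.

Let BE b : B b = \big[setU/set0]_(o | o.2 == Some b) common_block o.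
Proof.
apply/seteqP; split=> z.
  move=> Bb; have [ca Coa] := block_or_rest_cover C z.
  by apply/bigsetUP; exists (ca, Some b) => //=; rewrite /common_block; case: ifP => // /eqP[].
by move=> /bigsetUP[[ca cb] /= /eqP->]; rewrite /common_block; case: ifP => // _ [].
Qed.

Let formC a (o : option A * option I) : R := (o.1 == Some a)%:R.
Let formB b (o : option A * option I) : R := (o.2 == Some b)%:R.

Definition word_var (I' : Type) (F : I' -> set Z) (s : seq I') w : R :=
  \prod_(b <- s) xi (F b) w.

Lemma word_var_moments (I' : finType) (F : I' -> set Z) s :
  (forall b, measurable (F b)) -> (forall b, (mu (F b) < +oo)%E) ->
  all_moments P (word_var F s).
Proof. by move=> mF Foo; apply: all_moments_prod => b _; exact: xi_moments. Qed.

Let xi_formC a : {ae P, forall w, xi (C a) w = \sum_o formC a o * xi (common_block o) w}.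
Proof.
have := xi_bigsetU (fun o => o.1 == Some a) mE Eoo tE.
apply: filterS => w /=; rewrite -CE => ->; rewrite big_mkcond; apply: eq_bigr => o _.
by rewrite /formC; case: eqP; rewrite ?mul1r ?mul0r.
Qed.

Let xi_formB b : {ae P, forall w, xi (B b) w = \sum_o formB b o * xi (common_block o) w}.
Proof.
have := xi_bigsetU (fun o => o.2 == Some b) mE Eoo tE.
apply: filterS => w /=; rewrite -BE => ->; rewrite big_mkcond; apply: eq_bigr => o _.
by rewrite /formB; case: eqP; rewrite ?mul1r ?mul0r.
Qed.

Let xi_forms : {ae P, forall w,
  (forall a, xi (C a) w = \sum_o formC a o * xi (common_block o) w) /\
  (forall b, xi (B b) w = \sum_o formB b o * xi (common_block o) w)}.
Proof. by apply: filterS2 (ae_forall_fin xi_formC) (ae_forall_fin xi_formB) => w eC eB; split. Qed.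

(** The mass of [C a] is expanded over the common blocks and the Stein identity is applied to each.
    A point added in [C a] does not affect the other factors from [C], as [a] is not in [cs]; in the
    word over [B] it alters only the letter [b] whose block contains it. *)
Lemma mean_word_step a (cs : seq A) (s : seq I) : a \notin cs ->
  mean (fun w => xi (C a) w * (word_var C cs w * word_var B s w)) =
  \sum_b lam (C a `&` B b) * \sum_(u <- word_delta b s)
    mean (fun w => word_var C cs w * word_var B u w).
Proof.
move=> acs.
pose forms := map formC cs ++ map formB s.
pose Psi (x : option A * option I -> R) := \prod_(f <- forms) (\sum_o f o * x o).
have st := stein_linear_prod ZE muE PE mE Eoo tE forms.
have aC cs' : all_moments P (word_var C cs') by exact: word_var_moments.
have aB s' : all_moments P (word_var B s') by exact: word_var_moments.
have aX o : all_moments P (xi (common_block o)) by exact: (xi_moments PE).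
have mof Y : all_moments P Y -> measurable_fun setT Y by case.
have Psi_word : {ae P, forall w, word_var C cs w * word_var B s w =
    Psi (fun o => xi (common_block o) w)}.
  apply: filterS xi_forms => w [/= eC eB]; rewrite /Psi big_cat !big_map /word_var.
  by congr (_ * _); apply: eq_bigr => x _; rewrite ?eC ?eB.
transitivity (mean (fun w => \sum_o formC a o *
    (xi (common_block o) w * Psi (fun o => xi (common_block o) w)))).
  have aS : all_moments P (fun w => \sum_o formC a o *
      (xi (common_block o) w * Psi (fun o => xi (common_block o) w))).
    by apply: all_moments_sum => o _; apply: all_momentsZ; apply: all_momentsM => //; case: (st o).
  apply: mean_ae.
  - by apply: mof; apply: all_momentsM; [exact: (xi_moments PE)|exact: all_momentsM].
  - exact: mof.
  - apply: filterS2 xi_forms Psi_word => w [/= eC eB] ->.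
    by rewrite eC mulr_suml; apply: eq_bigr => o _; rewrite mulrA.
rewrite mean_sum; last first.
  by move=> o _; apply: all_momentsZ; apply: all_momentsM => //; case: (st o).
pose Delta o := mean (fun w => Psi (fun j => xi (common_block j) w + (j == o)%:R)) -
  mean (fun w => Psi (fun j => xi (common_block j) w)).
transitivity (\sum_ob lam (common_block (Some a, ob)) * Delta (Some a, ob)).
  transitivity (\sum_(o | o.1 == Some a) lam (common_block o) * Delta o).
    rewrite [RHS]big_mkcond; apply: eq_bigr => o _.
    rewrite meanZ; last by apply: all_momentsM => //; case: (st o).
    by case: (st o) => _ _ ->; rewrite /formC; case: eqP => _; rewrite ?mul1r ?mul0r.
  rewrite (reindex (fun ob => (Some a, ob)))/=.
    by apply: eq_bigl => ob; rewrite eqxx.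
  by exists snd => [//|[ca cb]]; rewrite inE/= => /eqP->.
have shiftE oo w : Psi (fun j => xi (common_block j) w + (j == (Some a, oo))%:R) =
    \prod_(f <- forms) ((\sum_o f o * xi (common_block o) w) + f (Some a, oo)).
  apply: eq_bigr => f _; under eq_bigr do rewrite mulrDr.
  rewrite big_split/=; congr (_ + _).
  rewrite (bigD1 (Some a, oo))//= eqxx mulr1 big1 ?addr0// => o /negPf->.
  by rewrite mulr0.
have formC0 oo a' : a' \in cs -> formC a' (Some a, oo) = 0.
  by move=> a'cs; rewrite /formC/=; case: eqP => // -[aa']; rewrite aa' a'cs in acs.
(* A point in [C a] outside all blocks of [B] changes no factor, so the difference at [None] is
   0. *)
rewrite sum_option/= [X in X + _](_ : _ = 0) ?add0r; last first.
  rewrite /Delta [X in X - _](_ : _ = mean (fun w => Psi (fun j => xi (common_block j) w))).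
    by rewrite subrr mulr0.
  apply: eq_Rintegral => w _; rewrite shiftE; apply: eq_big_seq => f.
  rewrite mem_cat => /orP[/mapP[a' a'cs ->]|/mapP[b _ ->]]; first by rewrite formC0// addr0.
  by rewrite /formB/= addr0.
apply: eq_bigr => b _; congr (_ * _); rewrite /Delta.
transitivity (mean (fun w => word_var C cs w * \prod_(b' <- s) (xi (B b') w + (b' == b)%:R)) -
    mean (fun w => word_var C cs w * word_var B s w)).
  have [_ a2 _] := st (Some a, Some b); have [a1 _ _] := st (Some a, Some b).
  congr (_ - _).
    apply: mean_ae; [exact: mof| |].
      apply: mof; apply: all_momentsM => //; apply: all_moments_prod => b' _.
      by apply: all_momentsD; [exact: (xi_moments PE)|exact: all_moments_cst].
    apply: filterS xi_forms => w [/= eC eB]; rewrite shiftE big_cat !big_map /word_var/=.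
    congr (_ * _); first by apply: eq_big_seq => a' a'cs; rewrite formC0// addr0 eC.
    by apply: eq_bigr => b' _; rewrite eB /formB/= (inj_eq Some_inj) eq_sym.
  apply: mean_ae; [exact: mof|by apply: mof; exact: all_momentsM|].
  by apply: filterS Psi_word => w /= ->.
under [X in X - _]eq_Rintegral do rewrite word_deltaE mulrDr.
rewrite meanD; last 2 first.
- by apply: all_momentsM => //; exact: aB.
- by apply: all_momentsM => //; apply: all_moments_sum => u _; exact: aB.
rewrite addrAC subrr add0r; under eq_Rintegral do rewrite mulr_sumr.
by rewrite mean_sum// => u _; apply: all_momentsM => //; exact: aB.
Qed.

Fixpoint word_coef (bs s : seq I) : R :=
  if bs is b :: bs' then \sum_(u <- word_delta b s) word_coef bs' u
  else mean (word_var B s).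

Lemma mean_injective_word q (j : 'I_q -> A) (s : seq I) : injective j ->
  mean (fun w => word_var C (codom j) w * word_var B s w) =
  \sum_(b : {ffun 'I_q -> I}) (\prod_i lam (C (j i) `&` B (b i))) * word_coef (codom b) s.
Proof.
elim: q j s => [|q IHq] j s j_inj.
  rewrite (big_pred1 (ffun0 (card_ord 0))) => [|b]; last by apply/esym/eqP/ffunP => -[].
  rewrite big_ord0 mul1r !codomE !enum_ord0 /=; apply: eq_Rintegral => w _.
  by rewrite /word_var big_nil mul1r.
pose j' := j \o lift ord0.
have j'_inj : injective j' by move=> x y /j_inj/lift_inj.
have codomS (T : Type) (f : 'I_q.+1 -> T) : codom f = f ord0 :: codom (f \o lift ord0).
  by rewrite !codomE enum_ordSl /= -map_comp.
transitivity (mean (fun w => xi (C (j ord0)) w * (word_var C (codom j') w * word_var B s w))).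
  by apply: eq_Rintegral => w _; rewrite /word_var codomS big_cons mulrA.
rewrite mean_word_step; last by apply/codomP => -[x /j_inj].
rewrite sum_ffun_ord_recl; apply: eq_bigr => b _.
under eq_bigr do rewrite IHq//.
rewrite exchange_big/= mulr_sumr; apply: eq_bigr => b' _.
rewrite big_ord_recl ffunE unlift_none/= -mulrA -mulr_sumr; congr (_ * (_ * _)).
  by apply: eq_bigr => i _; rewrite ffunE liftK.
rewrite codomS /= ffunE unlift_none/=; apply: eq_bigr => u _; congr word_coef.
by apply: eq_codom => i; rewrite /= ffunE liftK.
Qed.

Lemma mean_word (s : seq I) :
  mean (word_var B s) = word_moment (fun b k => mean (fun w => xi (B b) w ^+ k)) s.
Proof.
rewrite /word_moment -(mean_monomial ZE muE PE mB Boo tB).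
by apply: eq_Rintegral => w _; rewrite /word_var prod_seq_count.
Qed.

Lemma mean_word_ge0 s : 0 <= mean (word_var B s).
Proof. by rewrite mean_word prodr_ge0// => b _; exact: (xi_moment_ge0 PE). Qed.

Lemma word_coef_ge0 bs s : 0 <= word_coef bs s.
Proof.
elim: bs s => [|b bs IHbs] s /=; first exact: mean_word_ge0.
by rewrite sumr_ge0.
Qed.

Lemma word_coef_notin b bs s : uniq s -> b \notin s -> b \in bs -> word_coef bs s = 0.
Proof.
elim: bs s => //= b' bs IHbs s us bs'; rewrite inE => /predU1P[<-|bbs].
  by rewrite word_delta_notin// big_nil.
rewrite big_seq big1// => u /(word_delta_uniq us)[uu us' _].
by apply: IHbs => //; apply: contra bs' => /us'.
Qed.

(** No letter can be removed twice from a word without repetition. Hence boxes with a repeated block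
    do not contribute to the pairing with a square-free monomial. *)
Lemma word_coef_not_uniq bs s : uniq s -> ~~ uniq bs -> word_coef bs s = 0.
Proof.
elim: bs s => //= b bs IHbs s us; rewrite negb_and negbK => bbs.
rewrite big_seq big1// => u /(word_delta_uniq us)[uu _ bu].
by case/orP: bbs => [/word_coef_notin|]; [exact|exact: IHbs].
Qed.

End two_families.
End word_means.

(** * Square-integrable functions *)

Section square_integrable.
Context {d : measure_display} {T : measurableType d} {R : realType}.
Variable m : {measure set T -> \bar R}.
Implicit Types u v g : T -> R.

Lemma Lfun2_measurable u : u \in Lfun m 2%:E -> measurable_fun setT u.
Proof. by rewrite inE => /andP[+ _]; rewrite inE. Qed.

Lemma Lnorm2_sqr (f : T -> \bar R) :
  ('N[m]_2%:E[f] ^+ 2 = \int[m]_x (`|f x| ^+ 2))%E.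
Proof.
transitivity ('N[m]_2%:E[f] `^ 2)%E.
  case: ('N[m]_2%:E[f])%E (Lnorm_ge0 m 2%:E f) => [r r0| _|//].
    by rewrite poweR_EFin powR_mulrn// EFin_expe.
  by rewrite poweRyr// expe2 mulyy.
rewrite poweR_Lnorm//; apply: eq_integral => x _.
case: (f x) => [r| |].
- by rewrite poweR_EFin powR_mulrn// EFin_expe.
- by rewrite [`|_|%E](_ : _ = +oo%E)// poweRyr// expe2 mulyy.
- by rewrite [`|_|%E](_ : _ = +oo%E)// poweRyr// expe2 mulyy.
Qed.

Lemma Lfun2P u : measurable_fun setT u ->
  (\int[m]_x (u x ^+ 2)%:E < +oo)%E <-> u \in Lfun m 2%:E.
Proof.
move=> mu_; split=> [uoo|/Lfun2_integrable_sqr/integrableP[_]]; last first.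
  by under eq_integral do rewrite /= ger0_norm ?sqr_ge0//.
rewrite inE; apply/andP; split; rewrite inE//= /finite_norm.
have := Lnorm2_sqr (EFin \o u).
rewrite (eq_integral (fun x => (u x ^+ 2)%:E)) => [E|x _]; last first.
  by rewrite abse_EFin -EFin_expe real_normK ?num_real.
move: uoo; rewrite -E; case: ('N[m]_2%:E[_])%E (Lnorm_ge0 m 2%:E (EFin \o u)) => [r _ _||//]; first exact: ltry.
by rewrite [X in (X < _)%E -> _]mulyy.
Qed.

Lemma Lfun2D u v : u \in Lfun m 2%:E -> v \in Lfun m 2%:E -> (fun x => u x + v x) \in Lfun m 2%:E.
Proof. by have [_ H] := Lfun_addr_closed m (lee1n 2); exact: H. Qed.

Lemma Lfun2_sum (J : Type) (r : seq J) (Q : pred J) (F : J -> T -> R) :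
  (forall j, Q j -> F j \in Lfun m 2%:E) ->
  (fun x => \sum_(j <- r | Q j) F j x) \in Lfun m 2%:E.
Proof.
move=> H; elim: r => [|j r IHr].
  rewrite (_ : (fun _ => _) = cst 0); last by apply/funext => x; rewrite big_nil.
  apply/Lfun2P; first exact: measurable_cst.
  by under eq_integral do rewrite expr0n/=; rewrite integral0.
rewrite (_ : (fun _ => _) = fun x => (if Q j then F j x else 0) + \sum_(j <- r | Q j) F j x).
  case Qj: (Q j); first by apply: Lfun2D => //; exact: H.
  by rewrite (_ : (fun _ => _) = fun x => \sum_(j <- r | Q j) F j x)//; apply/funext => x; rewrite add0r.
by apply/funext => x; rewrite big_cons; case: ifP => _; rewrite ?add0r.
Qed.

Lemma Lfun2Z (c : R) u : u \in Lfun m 2%:E -> (fun x => c * u x) \in Lfun m 2%:E.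
Proof.
move=> uL; rewrite (_ : (fun _ => _) = c \o* u).
  by apply: Lfun_scale => //; exact: ler1n.
by apply/funext => x /=; rewrite mulrC.
Qed.

Lemma Lfun2B u v : u \in Lfun m 2%:E -> v \in Lfun m 2%:E -> (fun x => u x - v x) \in Lfun m 2%:E.
Proof.
move=> uL vL; rewrite (_ : (fun _ => _) = fun x => u x + -1 * v x).
  by apply: Lfun2D => //; exact: Lfun2Z.
by apply/funext => x; rewrite mulN1r.
Qed.

Lemma Lfun2_integrable_mul u v : u \in Lfun m 2%:E -> v \in Lfun m 2%:E ->
  m.-integrable setT (EFin \o (fun x => u x * v x)).
Proof. by move=> uL vL; apply/Lfun1_integrable; exact: Lfun2_mul_Lfun1. Qed.

Lemma Lfun2_norm_fin u : u \in Lfun m 2%:E -> ('N[m]_2%:E[EFin \o u] \is a fin_num)%E.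
Proof.
rewrite inE => /andP[_]; rewrite inE/= /finite_norm => H.
by rewrite ge0_fin_numE// Lnorm_ge0.
Qed.

Lemma cauchy_schwarz u v : u \in Lfun m 2%:E -> v \in Lfun m 2%:E ->
  `|\int[m]_x (u x * v x)| <= fine 'N[m]_2%:E[EFin \o u] * fine 'N[m]_2%:E[EFin \o v].
Proof.
move=> uL vL; apply: le_trans (le_normr_Rintegral _ _) _ => //.
  exact: Lfun2_integrable_mul.
rewrite -lee_fin EFinM (fineK (Lfun2_norm_fin uL)) (fineK (Lfun2_norm_fin vL)).
have H : ('N[m]_1[EFin \o (u \* v)%R] <= 'N[m]_2%:E[EFin \o u] * 'N[m]_2%:E[EFin \o v])%E.
  apply: hoelder => //; [exact: Lfun2_measurable|exact: Lfun2_measurable|].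
  by rewrite [RHS]splitr !div1r.
apply: le_trans H; rewrite Lnorm1 /Rintegral fineK//.
by apply: integrable_fin_num => //; apply: (integrable_abse (Lfun2_integrable_mul uL vL)).
Qed.

Lemma L2_cvg_mul (u : nat -> T -> R) v g : (forall n, u n \in Lfun m 2%:E) ->
  v \in Lfun m 2%:E -> g \in Lfun m 2%:E ->
  ('N[m]_2%:E[EFin \o (v \- u n)%R] @[n --> \oo] --> 0)%E ->
  \int[m]_x (u n x * g x) @[n --> \oo] --> \int[m]_x (v x * g x).
Proof.
move=> uL vL gL /fine_cvg H.
apply: (cvg_dist_le (c := fine 'N[m]_2%:E[EFin \o g]) _ H) => n.
rewrite distrC -RintegralB//; try exact: Lfun2_integrable_mul.
rewrite mulrC; have := cauchy_schwarz (Lfun2B vL (uL n)) gL.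
by under eq_Rintegral do rewrite mulrBl.
Qed.

Lemma L2_limit (u : nat -> T -> R) v : (forall n, u n \in Lfun m 2%:E) ->
  measurable_fun setT v -> ('N[m]_2%:E[EFin \o (v \- u n)%R] @[n --> \oo] --> 0)%E ->
  v \in Lfun m 2%:E.
Proof.
move=> uL mv H; have [N _ /(_ N (leqnn N))/= vN] := cvg_is_fine H.
have vuN : (v \- u N) \in Lfun m 2%:E.
  rewrite inE; apply/andP; split; rewrite inE/=.
    by apply: measurable_funB => //; exact: Lfun2_measurable.
  by rewrite /finite_norm -ge0_fin_numE ?Lnorm_ge0.
rewrite (_ : v = fun x => (v \- u N) x + u N x); first exact: Lfun2D.
by apply/funext => x; rewrite /= subrK.
Qed.

End square_integrable.

Lemma all_moments_Lfun2 {d : measure_display} {T : measurableType d} {R : realType}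
  (P : probability T R) (Y : T -> R) : all_moments P Y -> Y \in Lfun P 2%:E.
Proof.
move=> [mY Yoo]; apply/Lfun2P => //; have := Yoo 2%N.
by congr (_ < _)%E; apply: eq_integral => w _; rewrite real_normK ?num_real.
Qed.

(** * Multiple integrals and block averages *)

Section boxes.
Context {d : measure_display} {Z : measurableType d} {R : realType}.
Variable mu : {sigma_finite_measure set Z -> \bar R}.
Local Notation lam B := (fine (mu B)).

Definition box q (D : 'I_q -> set Z) : set (q.-tuple Z) := [set x | forall i, D i (tnth x i)].

Lemma measurable_box q (D : 'I_q -> set Z) : (forall i, measurable (D i)) -> measurable (box D).
Proof.
move=> mD; rewrite (_ : box D = \bigcap_(i in [set: 'I_q]) ((@tnth q Z ^~ i) @^-1` D i)).
  apply: fin_bigcap_measurable => // i _.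
  by rewrite -[X in measurable X]setTI; exact: measurable_tnth.
by apply/seteqP; split=> x /= H i; [move=> _; exact: H|exact: H].
Qed.

Lemma box_indicE q (D : 'I_q -> set Z) x : \prod_i \1_(D i) (tnth x i) = \1_(box D) x :> R.
Proof.
rewrite indicE; case: (boolP (x \in box D)) => [/set_mem Dx|/negP nDx].
  by rewrite big1// => i _; rewrite indicE mem_set//; exact: Dx.
have [i Di] : exists i, ~ D i (tnth x i).
  by apply/existsNP => Dx; apply: nDx; apply/mem_set.
by rewrite (bigD1 i)//= indicE memNset// mul0r.
Qed.

Lemma box_setI q (C D : 'I_q -> set Z) x :
  \1_(box C) x * \1_(box D) x = \1_(box (fun i => C i `&` D i)) x :> R.
Proof.
rewrite -!box_indicE -big_split; apply: eq_bigr => i _.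
by rewrite indicI.
Qed.

Section finite_boxes.
Context {q : nat}.
Variable D : 'I_q -> set Z.
Hypotheses (mD : forall i, measurable (D i)) (Doo : forall i, (mu (D i) < +oo)%E).

Lemma box_measureE : power_measure mu q (box D) = (\prod_i lam (D i))%:E.
Proof.
rewrite power_measure_box// -prodEFin; apply: eq_bigr => i _.
by rewrite fineK// ge0_fin_numE.
Qed.

Lemma Lfun2_box : (\1_(box D) : _ -> R) \in Lfun (power_measure mu q) 2%:E.
Proof.
have mB := measurable_box mD.
apply/Lfun2P; first exact: measurable_indic.
rewrite (eq_integral (fun x => (\1_(box D) x)%:E)) => [|x _]; last first.
  by rewrite indicE; case: (_ \in _); rewrite /= ?expr1n ?expr0n.
rewrite integral_indic// setIT.
by rewrite [X in (X < _)%E](_ : _ = (\prod_i lam (D i))%:E) ?ltry//; exact: box_measureE.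
Qed.

Lemma Rintegral_box : \int[power_measure mu q]_x (\1_(box D) x) = \prod_i lam (D i).
Proof.
rewrite /Rintegral integral_indic ?setIT; last 2 first.
- exact: measurableT.
- exact: measurable_box.
by rewrite [X in fine X](_ : _ = (\prod_i lam (D i))%:E)//; exact: box_measureE.
Qed.

End finite_boxes.

Definition block_int q (f : q.-tuple Z -> R) (D : 'I_q -> set Z) : R :=
  \int[power_measure mu q]_x (f x * \1_(box D) x).

Lemma block_int_box q (C D : 'I_q -> set Z) :
  (forall i, measurable (C i)) -> (forall i, measurable (D i)) ->
  (forall i, (mu (C i) < +oo)%E) ->
  block_int (\1_(box C)) D = \prod_i lam (C i `&` D i).
Proof.
move=> mC mD Coo; rewrite /block_int; under eq_Rintegral do rewrite box_setI.
apply: Rintegral_box => i; first exact: measurableI.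
apply: le_lt_trans (Coo i); apply: le_measure; last exact: subIsetl.
  by rewrite inE; exact: measurableI.
by rewrite inE.
Qed.

Lemma block_int_sum q (J : finType) (Q : pred J) (c : J -> R) (F : J -> q.-tuple Z -> R)
    (D : 'I_q -> set Z) :
  (forall i, measurable (D i)) -> (forall i, (mu (D i) < +oo)%E) ->
  (forall j, F j \in Lfun (power_measure mu q) 2%:E) ->
  block_int (fun x => \sum_(j | Q j) c j * F j x) D = \sum_(j | Q j) c j * block_int (F j) D.
Proof.
move=> mD Doo FL; rewrite /block_int.
have iF j : (power_measure mu q).-integrable setT (EFin \o (fun x => F j x * \1_(box D) x)).
  by apply: Lfun2_integrable_mul => //; exact: Lfun2_box.
under eq_Rintegral do rewrite mulr_suml.
under [RHS]eq_bigr => j _ do rewrite -RintegralZl//.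
rewrite /Rintegral sum_fine => [|j _]; last first.
  apply: integrable_fin_num => //; have := integrableZl measurableT (c j) (iF j).
  by congr (_.-integrable _ _).
congr fine; rewrite -integral_sum//; last first.
  move=> j; have := integrableZl measurableT (c j) (iF j).
  by congr (_.-integrable _ _).
by apply: eq_integral => x _; rewrite sumEFin; congr EFin; apply: eq_bigr => j _; rewrite mulrA.
Qed.

End boxes.

Section step_kernels.
Context {d dO : measure_display} {Z : measurableType d} {Omega : measurableType dO}.
Context {R : realType}.
Variables (mu : {sigma_finite_measure set Z -> \bar R}) (P : probability Omega R).
Variable eta : R.-ker Omega ~> Z.
Hypotheses (ZE : borel_space Z R) (muE : no_atoms mu) (PE : poisson_measure P mu eta).

Local Notation mean Y := (\int[P]_w Y w).
Local Notation lam B := (fine (mu B)).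
Local Notation xi := (compensated mu eta).

Lemma sk_disjoint_family q (e : step_kernel mu q) : disjoint_family (sk_set (s := e)).
Proof. by move=> i j ij; exact: sk_disjoint. Qed.

Lemma sk_funE q (e : step_kernel mu q) x : sk_fun e x =
  \sum_(j : {ffun 'I_q -> 'I_(sk_size e)} | injectiveb j)
    sk_coef j * \1_(box (fun i => sk_set (j i))) x.
Proof. by apply: eq_bigr => j _; rewrite box_indicE. Qed.

Lemma sk_integralE q (e : step_kernel mu q) w : sk_integral eta e w =
  \sum_(j : {ffun 'I_q -> 'I_(sk_size e)} | injectiveb j)
    sk_coef j * word_var mu eta (sk_set (s := e)) (codom j) w.
Proof.
apply: eq_bigr => j _; congr (_ * _).
by rewrite /word_var codomE big_map big_enum.
Qed.

Lemma sk_fun_Lfun2 q (e : step_kernel mu q) : sk_fun e \in Lfun (power_measure mu q) 2%:E.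
Proof.
rewrite (funext (sk_funE e)).
apply: Lfun2_sum => j _; apply: Lfun2Z; apply: Lfun2_box => i.
- exact: sk_measurable.
- exact: sk_finite.
Qed.

Lemma sk_integral_moments q (e : step_kernel mu q) : all_moments P (sk_integral eta e).
Proof.
rewrite (funext (sk_integralE e)).
apply: all_moments_sum => j _; apply: all_momentsZ; apply: (word_var_moments PE).
- exact: sk_measurable.
- exact: sk_finite.
Qed.

Section pairing.
Context {I : finType}.
Variable B : I -> set Z.
Hypotheses (mB : forall b, measurable (B b)) (Boo : forall b, (mu (B b) < +oo)%E)
  (tB : disjoint_family B).

Local Notation coef b s := (word_coef mu P eta B (codom b) s).

(** The step kernel enters only through its integrals over the boxes of [B], a form that does not
    refer to its own sets and survives L2 limits. *)
Lemma mean_sk_integral_word q (e : step_kernel mu q) s :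
  mean (fun w => sk_integral eta e w * word_var mu eta B s w) =
  \sum_(b : {ffun 'I_q -> I}) coef b s * block_int mu (sk_fun e) (fun i => B (b i)).
Proof.
under eq_Rintegral do rewrite sk_integralE mulr_suml.
have aC (j : {ffun 'I_q -> 'I_(sk_size e)}) : all_moments P (fun w =>
    word_var mu eta (sk_set (s := e)) (codom j) w * word_var mu eta B s w).
  apply: all_momentsM; last exact: (word_var_moments PE).
  by apply: (word_var_moments PE); [exact: sk_measurable|exact: sk_finite].
rewrite [LHS](_ : _ = \sum_(j : {ffun 'I_q -> 'I_(sk_size e)} | injectiveb j) sk_coef j *
    mean (fun w => word_var mu eta (sk_set (s := e)) (codom j) w * word_var mu eta B s w)).
  transitivity (\sum_(j : {ffun 'I_q -> 'I_(sk_size e)} | injectiveb j) sk_coef j *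
      \sum_(b : {ffun 'I_q -> I}) (\prod_i lam (sk_set (j i) `&` B (b i))) * coef b s).
    apply: eq_bigr => j /injectiveP j_inj; congr (_ * _).
    apply: (mean_injective_word ZE muE PE) => //.
    - exact: sk_measurable.
    - exact: sk_finite.
    - exact: sk_disjoint_family.
  under eq_bigr do rewrite mulr_sumr.
  rewrite exchange_big; apply: eq_bigr => b _ /=.
  rewrite (funext (sk_funE e)).
  rewrite block_int_sum//; last first.
    by move=> j; apply: Lfun2_box => i; [exact: sk_measurable|exact: sk_finite].
  rewrite mulr_sumr; apply: eq_bigr => j _.
  rewrite block_int_box//; [by ring|move=> i; exact: sk_measurable|move=> i; exact: sk_finite].
under eq_Rintegral do under eq_bigr do rewrite -mulrA.
rewrite mean_sum; last by move=> j _; exact: all_momentsZ.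
by apply: eq_bigr => j _; rewrite meanZ.
Qed.

Lemma multiple_integral_Lfun2 q (f : q.-tuple Z -> R) (X : {RV P >-> R}) :
  is_multiple_integral mu eta f X -> (X : Omega -> R) \in Lfun P 2%:E.
Proof.
move=> [e [_ H]]; apply: L2_limit H => // n.
exact: all_moments_Lfun2 (sk_integral_moments _).
Qed.

(** Both sides of [mean_sk_integral_word] are continuous in L2, by Cauchy-Schwarz against the
    monomial on one side and the indicators of the boxes on the other. *)
Lemma mean_integral_word q (f : q.-tuple Z -> R) (X : {RV P >-> R}) s :
  f \in Lfun (power_measure mu q) 2%:E -> is_multiple_integral mu eta f X ->
  mean (fun w => X w * word_var mu eta B s w) =
  \sum_(b : {ffun 'I_q -> I}) coef b s * block_int mu f (fun i => B (b i)).
Proof.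
move=> fL /[dup] HX [e [ef eX]]; have XL := multiple_integral_Lfun2 HX.
have H1 : mean (fun w => sk_integral eta (e n) w * word_var mu eta B s w) @[n --> \oo] -->
    mean (fun w => X w * word_var mu eta B s w).
  apply: L2_cvg_mul => //.
  - by move=> n; exact: all_moments_Lfun2 (sk_integral_moments _).
  - by apply: all_moments_Lfun2; exact: (word_var_moments PE).
have H2 : \sum_(b : {ffun 'I_q -> I}) coef b s * block_int mu (sk_fun (e n)) (fun i => B (b i))
    @[n --> \oo] --> \sum_(b : {ffun 'I_q -> I}) coef b s * block_int mu f (fun i => B (b i)).
  apply: cvg_big => [|b _]; first exact: add_continuous.
  apply: cvgMr; apply: L2_cvg_mul => //.
  - by move=> n; exact: sk_fun_Lfun2.
  - exact: Lfun2_box.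
apply: cvg_unique H1 _ => //; apply: cvg_trans H2; apply: near_eq_cvg; apply: nearW => n.
by rewrite mean_sk_integral_word.
Qed.

End pairing.
End step_kernels.

Section block_averages.
Context {d : measure_display} {Z : measurableType d} {R : realType}.
Variable mu : {sigma_finite_measure set Z -> \bar R}.
Local Notation lam B := (fine (mu B)).

Section one_kernel.
Context {I : finType} {q : nat}.
Variables (B : I -> set Z) (f : q.-tuple Z -> R).
Hypotheses (mB : forall b, measurable (B b)) (Boo : forall b, (mu (B b) < +oo)%E)
  (tB : disjoint_family B) (fL : f \in Lfun (power_measure mu q) 2%:E).

(* The off-diagonal block averages of [f]; blocks of measure zero get the
   value [0], since division by zero gives [0]. *)
Definition block_average (b : {ffun 'I_q -> I}) : R :=
  if injectiveb b then block_int mu f (fun i => B (b i)) / \prod_i lam (B (b i)) else 0.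

Definition step_fun (c : {ffun 'I_q -> I} -> R) (x : q.-tuple Z) : R :=
  \sum_b c b * \1_(box (fun i => B (b i))) x.

Lemma step_fun_Lfun2 c : step_fun c \in Lfun (power_measure mu q) 2%:E.
Proof. by apply: Lfun2_sum => b _; apply: Lfun2Z; exact: Lfun2_box. Qed.

(** This makes the value 0 of an average on a null box consistent: average times measure is the
    integral there too. *)
Lemma box_null (b : 'I_q -> I) : \prod_i lam (B (b i)) = 0 ->
  block_int mu f (fun i => B (b i)) = 0.
Proof.
move=> B0; have mb : measurable (box (fun i => B (b i))) by exact: measurable_box.
rewrite /block_int /Rintegral [X in fine X](_ : _ = 0%E)//.
transitivity (\int[power_measure mu q]_(x in ~` box (fun i => B (b i))) 0%E)%E; last exact: integral0.
rewrite (negligible_integral (N := box (fun i => B (b i))))//.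
- rewrite setTD; apply: eq_integral => x; rewrite inE /= => nbx.
  by rewrite indicE memNset// mulr0.
- by apply: Lfun2_integrable_mul => //; exact: Lfun2_box.
- have := box_measureE (D := fun i => B (b i)) (fun=> mB _) (fun=> Boo _).
  by rewrite B0.
Qed.

Lemma block_average_mul (b : {ffun 'I_q -> I}) : injective b ->
  block_average b * \prod_i lam (B (b i)) = block_int mu f (fun i => B (b i)).
Proof.
move=> /injectiveP b_inj; rewrite /block_average b_inj.
have [B0|B0] := eqVneq (\prod_i lam (B (b i))) 0; last by rewrite divfK.
by rewrite B0 mulr0 box_null.
Qed.

Lemma block_average_ge0 b : {ae power_measure mu q, forall x, 0 <= f x} -> 0 <= block_average b.
Proof.
move=> f0; rewrite /block_average; case: ifP => // _.
rewrite divr_ge0//; last by rewrite prodr_ge0// => i _; exact: fine_ge0.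
have mf := Lfun2_measurable fL.
have mb : measurable (box (fun i => B (b i))) by exact: measurable_box.
have bL := Lfun2_box (D := fun i => B (b i)) (fun=> mB _) (fun=> Boo _).
rewrite /block_int [leRHS](_ : _ = \int[power_measure mu q]_x (Num.max (f x) 0 * \1_(box (fun i => B (b i))) x)).
  by apply: Rintegral_ge0 => x _; rewrite mulr_ge0// le_max lexx orbT.
rewrite /Rintegral; congr fine; apply: ae_eq_integral => //.
- by apply/measurable_EFinP; apply: measurable_funM => //; exact: measurable_indic.
- apply/measurable_EFinP; apply: measurable_funM; last exact: measurable_indic.
  exact: measurable_maxr.
- by apply: filterS f0 => x /= fx _; rewrite (max_idPl fx).
Qed.

(** The averages define the L2 projection onto the span of the off-diagonal boxes: on the box of an
    injective [b], the function [f] and its step function have the same integral. *)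
Lemma step_fun_orthogonal (c : {ffun 'I_q -> I} -> R) : (forall b, c b != 0 -> injective b) ->
  \int[power_measure mu q]_x ((f x - step_fun block_average x) * step_fun c x) = 0.
Proof.
move=> c_inj; have aL := step_fun_Lfun2 block_average.
transitivity (\sum_b c b * (block_int mu f (fun i => B (b i)) -
    block_int mu (step_fun block_average) (fun i => B (b i)))).
  have bL b := Lfun2_box (D := fun i => B (b i)) (fun=> mB _) (fun=> Boo _).
  have i1 b : (power_measure mu q).-integrable setT
      (EFin \o (fun x => (f x - step_fun block_average x) * \1_(box (fun i => B (b i))) x)).
    by apply: Lfun2_integrable_mul; [exact: Lfun2B|exact: bL].
  have i2 b : (power_measure mu q).-integrable setT (EFin \o (fun x => c b *
      ((f x - step_fun block_average x) * \1_(box (fun i => B (b i))) x))).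
    exact: (integrableZl measurableT (c b) (i1 b)).
  transitivity (\sum_b \int[power_measure mu q]_x (c b *
      ((f x - step_fun block_average x) * \1_(box (fun i => B (b i))) x))).
    rewrite /Rintegral sum_fine => [|b _]; last by apply: integrable_fin_num => //; exact: i2.
    congr fine; rewrite -integral_sum//; apply: eq_integral => x _.
    rewrite sumEFin; congr EFin; rewrite mulr_sumr; apply: eq_bigr => b _.
    by rewrite mulrCA.
  apply: eq_bigr => b _; rewrite RintegralZl//; congr (_ * _).
  rewrite /block_int -RintegralB//.
  - by apply: eq_Rintegral => x _; rewrite mulrBl.
  - by apply: Lfun2_integrable_mul => //; exact: bL.
  - by apply: Lfun2_integrable_mul => //; exact: bL.
rewrite big1// => b _; have [->|/c_inj b_inj] := eqVneq (c b) 0; first by rewrite mul0r.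
rewrite [X in _ - X](_ : _ = block_int mu f (fun i => B (b i))) ?subrr ?mulr0//.
rewrite /step_fun block_int_sum//; last by move=> b'; exact: Lfun2_box.
rewrite (bigD1 b)//= big1 ?addr0 => [|b' bb']; last first.
  rewrite block_int_box//; have [i bi] : exists i, b' i != b i.
    apply/existsP; apply: contraT; rewrite negb_exists => /forallP H.
    by move: bb'; rewrite (_ : b' = b) ?eqxx//; apply/ffunP => i; apply/eqP; have := H i; rewrite negbK.
  rewrite (bigD1 i)//= (_ : B (b' i) `&` B (b i) = set0) ?measure0 ?mul0r ?mulr0//.
  by apply/disj_set2P; exact: tB.
rewrite block_int_box// -block_average_mul//; congr (_ * _).
by apply: eq_bigr => i _; rewrite setIid.
Qed.

End one_kernel.
End block_averages.

(** * Comparison of F with its block projection G *)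

Section projection.
Context {d dO : measure_display} {Z : measurableType d} {Omega : measurableType dO}.
Context {R : realType}.
Variables (mu : {sigma_finite_measure set Z -> \bar R}) (P : probability Omega R).
Variable eta : R.-ker Omega ~> Z.
Hypotheses (ZE : borel_space Z R) (muE : no_atoms mu) (PE : poisson_measure P mu eta).

Local Notation mean Y := (\int[P]_w Y w).
Local Notation lam B := (fine (mu B)).
Local Notation xi := (compensated mu eta).

Variables (k : nat) (q : 'I_k -> nat) (f : forall i : 'I_k, (q i).-tuple Z -> R)
  (Ig : 'I_k -> {RV P >-> R}).
Arguments f : clear implicits.
Hypotheses (fL : forall i, f i \in Lfun (power_measure mu (q i)) 2%:E)
  (f_ge0 : forall i, {ae power_measure mu (q i), forall x, 0 <= f i x})
  (fI : forall i, is_multiple_integral mu eta (f i) (Ig i)).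
Variables (I : finType) (B : I -> set Z).
Hypotheses (mB : forall b, measurable (B b)) (Boo : forall b, (mu (B b) < +oo)%E)
  (tB : disjoint_family B).

Definition block_index := {i : 'I_k & {ffun 'I_(q i) -> I}}.

Definition average (p : block_index) : R := block_average mu B (f (tag p)) (tagged p).
Definition index_word (p : block_index) : seq I := codom (tagged p).

Definition step_sum (c : block_index -> R) w : R :=
  \sum_p c p * word_var mu eta B (index_word p) w.

Definition integral_sum_rv w : R := \sum_(i < k) Ig i w.

Local Notation F := integral_sum_rv.
Local Notation G := (step_sum average).
Local Notation wv s := (word_var mu eta B s).

Lemma step_sum_moments c : all_moments P (step_sum c).
Proof. by apply: all_moments_sum => p _; apply: all_momentsZ; exact: (word_var_moments PE). Qed.

Lemma integral_sum_Lfun2 : F \in Lfun P 2%:E.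
Proof. by apply: Lfun2_sum => i _; exact: (multiple_integral_Lfun2 PE (fI i)). Qed.

Let aX s : all_moments P (wv s). Proof. exact: (word_var_moments PE). Qed.

Let iFX s : P.-integrable setT (EFin \o (fun w => F w * wv s w)).
Proof. by apply: Lfun2_integrable_mul; [exact: integral_sum_Lfun2|exact: all_moments_Lfun2]. Qed.

Lemma mean_step_word (p : block_index) s : injective (tagged p) ->
  mean (fun w => wv (index_word p) w * wv s w) =
  (\prod_i lam (B (tagged p i))) * word_coef mu P eta B (index_word p) s.
Proof.
move=> p_inj; rewrite (mean_injective_word ZE muE PE)//.
rewrite (bigD1 (tagged p))//= [X in _ + X]big1 ?addr0 => [|b bp].
  by congr (_ * _); apply: eq_bigr => i _; rewrite setIid.
have [i bi] : exists i, b i != tagged p i.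
  apply/existsP; apply: contraT; rewrite negb_exists => /forallP H.
  by move: bp; rewrite (_ : b = tagged p) ?eqxx//; apply/ffunP => i; apply/eqP; have := H i; rewrite negbK.
rewrite (bigD1 i)//= (_ : B (tagged p i) `&` B (b i) = set0) ?measure0 ?mul0r//.
by apply/disj_set2P; apply: tB; rewrite eq_sym.
Qed.

(** On the box of an injective index, average times measure is the integral of the kernel, so F and
    G contribute equally. Boxes with a repeated block, absent from G, are all that remains. *)
Lemma mean_error_word s : mean (fun w => (F w - G w) * wv s w) =
  \sum_(p : block_index | ~~ injectiveb (tagged p))
    word_coef mu P eta B (index_word p) s * block_int mu (f (tag p)) (fun i => B (tagged p i)).
Proof.
transitivity (mean (fun w => F w * wv s w) - mean (fun w => G w * wv s w)).
  under eq_Rintegral do rewrite mulrBl; rewrite RintegralB//.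
  by apply: all_moments_integrable; apply: all_momentsM => //; exact: step_sum_moments.
have -> : mean (fun w => F w * wv s w) = \sum_(p : block_index)
    word_coef mu P eta B (index_word p) s * block_int mu (f (tag p)) (fun i => B (tagged p i)).
  transitivity (\sum_(i < k) mean (fun w => Ig i w * wv s w)).
    have iIX i : P.-integrable setT (EFin \o (fun w => Ig i w * wv s w)).
      by apply: Lfun2_integrable_mul; [exact: (multiple_integral_Lfun2 PE (fI i))|exact: all_moments_Lfun2].
    rewrite /Rintegral sum_fine => [|i _]; last by apply: integrable_fin_num => //; exact: iIX.
    congr fine; rewrite -integral_sum//; apply: eq_integral => w _.
    by rewrite sumEFin /F mulr_suml.
  rewrite -(sig_big_dep (fun=> true) (fun _ _ => true) (fun i (b : {ffun 'I_(q i) -> I}) =>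
    word_coef mu P eta B (codom b) s * block_int mu (f i) (fun l => B (b l))))/=.
  by apply: eq_bigr => i _; rewrite (mean_integral_word ZE muE PE mB Boo tB s (fL i) (fI i)).
have -> : mean (fun w => G w * wv s w) = \sum_(p : block_index | injectiveb (tagged p))
    word_coef mu P eta B (index_word p) s * block_int mu (f (tag p)) (fun i => B (tagged p i)).
  under eq_Rintegral do rewrite mulr_suml.
  rewrite mean_sum => [|p _]; last by apply: all_momentsM => //; exact: all_momentsZ.
  rewrite [RHS]big_mkcond; apply: eq_bigr => p _.
  under eq_Rintegral do rewrite -mulrA.
  rewrite meanZ; last exact: all_momentsM.
  case: ifPn => [/injectiveP p_inj|/negPf pN]; last by rewrite /average /block_average pN mul0r.
  rewrite mean_step_word// mulrA block_average_mul//.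
  by rewrite mulrC.
by rewrite (bigID (fun p : block_index => injectiveb (tagged p)))/= addrAC subrr add0r.
Qed.

Lemma average_ge0 p : 0 <= average p.
Proof. by apply: block_average_ge0 => //; exact: f_ge0. Qed.

Lemma mean_error_word_ge0 s : 0 <= mean (fun w => (F w - G w) * wv s w).
Proof.
rewrite mean_error_word sumr_ge0// => p _.
rewrite mulr_ge0//; first exact: (word_coef_ge0 ZE muE PE).
have mf := Lfun2_measurable (fL (tag p)).
have mb : measurable (box (fun i => B (tagged p i))) by exact: measurable_box.
(* The kernel is nonnegative only almost everywhere; its positive part has the same integral and is
   nonnegative everywhere. *)
rewrite /block_int [leRHS](_ : _ = \int[power_measure mu (q (tag p))]_x
    (Num.max (f (tag p) x) 0 * \1_(box (fun i => B (tagged p i))) x)).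
  by apply: Rintegral_ge0 => x _; rewrite mulr_ge0// le_max lexx orbT.
rewrite /Rintegral; congr fine; apply: ae_eq_integral => //.
- by apply/measurable_EFinP; apply: measurable_funM => //; exact: measurable_indic.
- apply/measurable_EFinP; apply: measurable_funM; last exact: measurable_indic.
  exact: measurable_maxr.
- by apply: filterS (f_ge0 (tag p)) => x /= fx _; rewrite (max_idPl fx).
Qed.

Lemma mean_error_word_uniq s : uniq s -> mean (fun w => (F w - G w) * wv s w) = 0.
Proof.
move=> us; rewrite mean_error_word big1// => p pN.
by rewrite (word_coef_not_uniq _ _ _ _ us)// mul0r.
Qed.

Let EL : (fun w => F w - G w) \in Lfun P 2%:E.
Proof.
by apply: Lfun2B; [exact: integral_sum_Lfun2|apply: all_moments_Lfun2; exact: step_sum_moments].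
Qed.

Let iEX s : P.-integrable setT (EFin \o (fun w => (F w - G w) * wv s w)).
Proof. by apply: Lfun2_integrable_mul => //; exact: all_moments_Lfun2. Qed.

Lemma mean_error_sum (J : finType) (c : J -> R) (s : J -> seq I) :
  mean (fun w => (F w - G w) * \sum_j c j * wv (s j) w) =
  \sum_j c j * mean (fun w => (F w - G w) * wv (s j) w).
Proof.
have i2 j : P.-integrable setT (EFin \o (fun w => c j * ((F w - G w) * wv (s j) w))).
  exact: (integrableZl measurableT (c j) (iEX (s j))).
transitivity (\sum_j mean (fun w => c j * ((F w - G w) * wv (s j) w))).
  rewrite /Rintegral sum_fine => [|j _]; last by apply: integrable_fin_num => //; exact: i2.
  congr fine; rewrite -integral_sum//; apply: eq_integral => w _.
  by rewrite sumEFin mulr_sumr; congr EFin; apply: eq_bigr => j _; rewrite mulrCA.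
by apply: eq_bigr => j _; rewrite RintegralZl.
Qed.

Lemma word_var_cat s t w : wv (s ++ t) w = wv s w * wv t w.
Proof. by rewrite /word_var big_cat. Qed.

Lemma mean_error_cube : 0 <= mean (fun w => (F w - G w) * G w ^+ 3).
Proof.
rewrite (_ : (fun w => _) = fun w => (F w - G w) * \sum_(p : block_index * block_index * block_index)
    (average p.1.1 * average p.1.2 * average p.2) *
    wv (index_word p.1.1 ++ index_word p.1.2 ++ index_word p.2) w).
  rewrite mean_error_sum sumr_ge0// => p _.
  by rewrite mulr_ge0 ?mean_error_word_ge0// !mulr_ge0 ?average_ge0.
apply/funext => w; congr (_ * _).
rewrite -(pair_bigA _ (fun p r => average p.1 * average p.2 * average r *
  wv (index_word p.1 ++ index_word p.2 ++ index_word r) w))/=.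
rewrite -(pair_bigA _ (fun p r => \sum_l average p * average r * average l *
  wv (index_word p ++ index_word r ++ index_word l) w))/=.
rewrite exprS expr2 {1}/step_sum mulr_suml; apply: eq_bigr => p _.
rewrite {1}/step_sum mulr_suml mulr_sumr; apply: eq_bigr => r _.
rewrite /step_sum 2!mulr_sumr; apply: eq_bigr => l _.
by rewrite !word_var_cat; ring.
Qed.

Lemma mean_error_step (c : block_index -> R) : (forall p, c p != 0 -> injective (tagged p)) ->
  mean (fun w => (F w - G w) * step_sum c w) = 0.
Proof.
move=> c_inj; rewrite mean_error_sum big1// => p _.
have [->|/c_inj/injectiveP p_inj] := eqVneq (c p) 0; first by rewrite mul0r.
by rewrite mean_error_word_uniq ?mulr0.
Qed.

Lemma fourth_moment_le : ((mean (fun w => G w ^+ 4))%:E <= \int[P]_w (F w ^+ 4)%:E)%E.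
Proof.
have mF := Lfun2_measurable integral_sum_Lfun2.
have aG := step_sum_moments average.
(* If F^4 has infinite integral the right side is +oo and there is nothing to prove. *)
have [Foo|] := boolP (\int[P]_w (F w ^+ 4)%:E < +oo)%E; last first.
  by rewrite -leNgt leye_eq => /eqP->; rewrite leey.
have iF : P.-integrable setT (EFin \o (fun w => F w ^+ 4)).
  apply/integrableP; split; first by apply/measurable_EFinP; exact: measurable_funX.
  apply: le_lt_trans Foo; rewrite le_eqVlt; apply/orP; left; apply/eqP.
  by apply: eq_integral => w _; rewrite /= ger0_norm// (exprM _ 2 2) sqr_ge0.
have iE : P.-integrable setT (EFin \o (fun w => (F w - G w) * G w ^+ 3)).
  by apply: Lfun2_integrable_mul => //; apply: all_moments_Lfun2; exact: all_momentsX.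
have iE4 : P.-integrable setT (EFin \o (fun w => 4 * ((F w - G w) * G w ^+ 3))).
  exact: (integrableZl measurableT 4 iE).
have iG : P.-integrable setT (EFin \o (fun w => G w ^+ 4)).
  by apply: all_moments_integrable; exact: all_momentsX.
rewrite -[leRHS]fineK; last by apply: integrable_fin_num => //; exact: iF.
rewrite lee_fin -/(Rintegral P setT (fun w => F w ^+ 4)).
apply: (@le_trans _ _ (mean (fun w => G w ^+ 4 + 4 * ((F w - G w) * G w ^+ 3)))).
  by rewrite RintegralD// RintegralZl// lerDl mulr_ge0// mean_error_cube.
apply: le_Rintegral => //.
  exact: (integrableD measurableT iG iE4).
move=> w _; rewrite -subr_ge0; set u := F w; set v := G w.
(* The tangent inequality for the fourth power, made explicit as a sum of squares: u^4 - v^4 - 4 (u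
   - v) v^3. *)
rewrite (_ : _ - _ = (u - v) ^+ 2 * ((u + v) ^+ 2 + 2 * v ^+ 2)); last by ring.
by rewrite mulr_ge0 ?sqr_ge0// addr_ge0 ?sqr_ge0// mulr_ge0// sqr_ge0.
Qed.

(** Pythagoras: F - G is orthogonal to all off-diagonal step sums, so E F^2 - E G^2 = E (F - G)^2
    and G is the nearest of them to F. *)
Lemma second_moment_split (c : block_index -> R) : (forall p, c p != 0 -> injective (tagged p)) ->
  mean (fun w => F w ^+ 2) - mean (fun w => G w ^+ 2) <= mean (fun w => (F w - step_sum c w) ^+ 2)
  /\ mean (fun w => G w ^+ 2) <= mean (fun w => F w ^+ 2).
Proof.
move=> c_inj; have FL := integral_sum_Lfun2.
have GL : G \in Lfun P 2%:E by apply: all_moments_Lfun2; exact: step_sum_moments.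
have cL : step_sum c \in Lfun P 2%:E by apply: all_moments_Lfun2; exact: step_sum_moments.
have G_inj p : average p != 0 -> injective (tagged p).
  by rewrite /average /block_average; case: ifP => [/injectiveP//|_]; rewrite eqxx.
have i2 (u v : Omega -> R) : u \in Lfun P 2%:E -> v \in Lfun P 2%:E ->
  P.-integrable setT (EFin \o (fun w => u w * v w)) by exact: Lfun2_integrable_mul.
have isq (u : Omega -> R) : u \in Lfun P 2%:E -> P.-integrable setT (EFin \o (fun w => u w ^+ 2)).
  exact: Lfun2_integrable_sqr.
have pyth (c' : block_index -> R) : (forall p, c' p != 0 -> injective (tagged p)) ->
    mean (fun w => (F w - step_sum c' w) ^+ 2) =
    mean (fun w => (F w - G w) ^+ 2) + mean (fun w => (G w - step_sum c' w) ^+ 2).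
  move=> c'_inj; have c'L : step_sum c' \in Lfun P 2%:E.
    by apply: all_moments_Lfun2; exact: step_sum_moments.
  have GcL := Lfun2B GL c'L.
  transitivity (mean (fun w => ((F w - G w) ^+ 2 + (G w - step_sum c' w) ^+ 2) +
      2 * ((F w - G w) * G w - (F w - G w) * step_sum c' w))).
    by apply: eq_Rintegral => w _; ring.
  have iB : P.-integrable setT (EFin \o (fun w => (F w - G w) * G w - (F w - G w) * step_sum c' w)).
    exact: (integrableB measurableT (i2 _ _ EL GL) (i2 _ _ EL c'L)).
  have iS : P.-integrable setT (EFin \o (fun w => (F w - G w) ^+ 2 + (G w - step_sum c' w) ^+ 2)).
    exact: (integrableD measurableT (isq _ EL) (isq _ GcL)).
  rewrite RintegralD//; last exact: (integrableZl measurableT 2 iB).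
  rewrite RintegralZl// RintegralB//; try exact: i2.
  rewrite mean_error_step// mean_error_step// subrr mulr0 addr0 RintegralD//; exact: isq.
have E0 : mean (fun w => F w ^+ 2) = mean (fun w => (F w - G w) ^+ 2) + mean (fun w => G w ^+ 2).
  have := pyth (fun=> 0); rewrite (_ : step_sum (fun=> 0) = fun=> 0); last first.
    by apply/funext => w; rewrite /step_sum big1// => p _; rewrite mul0r.
  under eq_Rintegral do rewrite subr0; under [X in _ + X]eq_Rintegral do rewrite subr0.
  by apply => p; rewrite eqxx.
rewrite E0 addrK (pyth c c_inj) lerDl lerDr; split; apply: Rintegral_ge0 => w _; exact: sqr_ge0.
Qed.

End projection.

(** * Step approximation *)

Section atoms.
Context {d : measure_display} {Z : measurableType d} {N : finType}.
Variable S : N -> set Z.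

(** The cells of the Venn diagram of [S], indexed by the sets that contain them. The empty index is
    excluded, since the outside of all sets may have infinite measure. They refine the sets of all
    step kernels at once. *)
Definition atom (c : {set N}) : set Z :=
  [set z | c != finset.set0 /\ forall k, (z \in S k) = (k \in c)].

Lemma measurable_atom c : (forall k, measurable (S k)) -> measurable (atom c).
Proof.
move=> mS; have [->|c0] := eqVneq c finset.set0.
  by rewrite (_ : atom _ = set0)//; apply/seteqP; split=> // z []; rewrite eqxx.
rewrite (_ : atom c = \bigcap_(k in [set: N]) if k \in c then S k else ~` S k).
  apply: fin_bigcap_measurable; first exact: finite_finset.
  by move=> k _; case: ifP => _ //; exact: measurableC.
apply/seteqP; split=> [z [_ zS] k _|z zS].
  by case: ifPn => kc; [apply/set_mem; rewrite zS|move=> /mem_set; rewrite zS (negPf kc)].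
split=> // k; have := zS k Logic.I; case: ifPn => kc zk; first by rewrite mem_set.
by rewrite memNset.
Qed.

Lemma disjoint_atom : disjoint_family atom.
Proof.
move=> c c' cc'; apply/disj_setPS => z [[_ zc] [_ zc']].
by move: cc'; rewrite (_ : c = c') ?eqxx//; apply/setP => k; rewrite -zc zc'.
Qed.

Lemma atom_sub (k : N) (c : {set N}) : k \in c -> atom c `<=` S k.
Proof. by move=> kc z [_ zc]; apply/set_mem; rewrite zc. Qed.

Lemma atom_cover k : S k = \big[setU/set0]_(c : {set N} | k \in c) atom c.
Proof.
apply/seteqP; split=> z.
  move=> Sz; apply/bigsetUP; exists (finset (fun k' => z \in S k')); first by rewrite inE mem_set.
  split; last by move=> k'; rewrite inE.
  by apply/set0Pn; exists k; rewrite inE mem_set.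
by move=> /bigsetUP[c kc cz]; exact: atom_sub cz.
Qed.

Lemma atom_finite {R : realType} (mu : {measure set Z -> \bar R}) c :
  (forall k, measurable (S k)) -> (forall k, (mu (S k) < +oo)%E) -> (mu (atom c) < +oo)%E.
Proof.
move=> mS Soo; have [->|/set0Pn[k kc]] := eqVneq c finset.set0.
  by rewrite (_ : atom _ = set0) ?measure0//; apply/seteqP; split=> // z []; rewrite eqxx.
apply: le_lt_trans (Soo k); apply: le_measure; last exact: atom_sub.
  by rewrite inE; exact: measurable_atom.
by rewrite inE.
Qed.

End atoms.

Section refinement.
Context {d : measure_display} {Z : measurableType d} {R : realType}.
Variable mu : {sigma_finite_measure set Z -> \bar R}.
Context {N : finType} {q : nat}.
Variables (S : N -> set Z) (e : step_kernel mu q) (phi : 'I_(sk_size e) -> N).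
Hypothesis Sphi : forall a, S (phi a) = sk_set a.

(** The coefficients of the step kernel on the finer boxes. The value 0 at a non-injective [b] loses
    nothing: an atom cannot lie in two of the disjoint sets of [e] unless it is empty. *)
Definition refined_coef (b : {ffun 'I_q -> {set N}}) : R :=
  if injectiveb b then \sum_(j : {ffun 'I_q -> 'I_(sk_size e)} | injectiveb j)
    sk_coef j * \prod_i (phi (j i) \in b i)%:R
  else 0.

(* [v i A] is either the value at [A] of the compensated random measure or the
   indicator of [A] at the i-th coordinate of a fixed point. *)
Lemma refined_coefE (v : 'I_q -> set Z -> R) : (forall i, v i set0 = 0) ->
  (forall i k, v i (S k) = \sum_(c : {set N} | k \in c) v i (atom S c)) ->
  \sum_(j : {ffun 'I_q -> 'I_(sk_size e)} | injectiveb j) sk_coef j * \prod_i v i (sk_set (j i)) =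
  \sum_b refined_coef b * \prod_i v i (atom S (b i)).
Proof.
move=> v0 vS.
transitivity (\sum_(j : {ffun 'I_q -> 'I_(sk_size e)} | injectiveb j) sk_coef j *
    \sum_(b : {ffun 'I_q -> {set N}}) \prod_i ((phi (j i) \in b i)%:R * v i (atom S (b i)))).
  apply: eq_bigr => j _; congr (_ * _).
  rewrite -(bigA_distr_bigA (fun i (c : {set N}) => (phi (j i) \in c)%:R * v i (atom S c))).
  apply: eq_bigr => i _; rewrite -Sphi vS big_mkcond; apply: eq_bigr => c _.
  by case: ifP => _; rewrite ?mul1r ?mul0r.
under eq_bigr do rewrite mulr_sumr.
rewrite exchange_big; apply: eq_bigr => b _ /=; rewrite /refined_coef.
case: ifPn => [_|/injectiveP b_ninj].
  by rewrite mulr_suml; apply: eq_bigr => j _; rewrite big_split mulrA.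
rewrite mul0r big1// => j /injectiveP j_inj.
(* Two distinct coordinates share an atom while [j] asks for different sets of [e], so either a
   membership fails or the atom is empty and [v] vanishes. *)
have [i [i' [ii' bi]]] : exists i i', i != i' /\ b i = b i'.
  apply: contrapT => H; apply: b_ninj => i i' bi; apply/eqP; apply: contraT => ii'.
  by exfalso; apply: H; exists i, i'.
suff -> : \prod_i ((phi (j i) \in b i)%:R * v i (atom S (b i))) = 0 :> R by rewrite mulr0.
rewrite (bigD1 i)//= (bigD1 i')/=; last by rewrite eq_sym.
have [ki|] := boolP (phi (j i) \in b i); last by rewrite !mul0r.
have [ki'|] := boolP (phi (j i') \in b i'); last by rewrite !mul0r mulr0.
rewrite (_ : atom S (b i) = set0) ?v0 ?mulr0 ?mul0r//.
apply/seteqP; split=> // z zb.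
have z1 := atom_sub ki zb; rewrite bi in zb; have z2 := atom_sub ki' zb.
rewrite !Sphi in z1 z2; have tE : disjoint_family (sk_set (s := e)) by exact: sk_disjoint_family.
have := disjoint_family_inj tE z1 z2.
by move=> /j_inj/eqP; rewrite (negPf ii').
Qed.

Lemma refined_coef_inj b : refined_coef b != 0 -> injective b.
Proof. by rewrite /refined_coef; case: ifP => [/injectiveP//|_]; rewrite eqxx. Qed.

Lemma refined_step_fun x : sk_fun e x = step_fun (atom S) refined_coef x.
Proof.
rewrite /sk_fun (refined_coefE (v := fun i A => \1_A (tnth x i))).
- by apply: eq_bigr => b _; rewrite box_indicE.
- by move=> i; rewrite indicE memNset.
move=> i k; rewrite indicE; have [xk|/negP xk] := boolP (tnth x i \in S k).
  have := set_mem xk; rewrite {1}(atom_cover S k) => /bigsetUP[c kc xc].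
  rewrite (bigD1 c)//= indicE mem_set// big1 ?addr0// => c' /andP[_ c'c].
  rewrite indicE memNset// => xc'.
  by rewrite (disjoint_family_inj (disjoint_atom S) xc' xc) eqxx in c'c.
rewrite big1// => c kc; rewrite indicE memNset// => xc.
by apply: xk; apply/mem_set; exact: atom_sub xc.
Qed.

End refinement.

(** * Products of a function along index maps *)

Section selections.
Context {d : measure_display} {Z : measurableType d} {R : realType}.
Variable mu : {sigma_finite_measure set Z -> \bar R}.

Definition select q N (s : 'I_q -> 'I_N) (x : N.-tuple Z) : q.-tuple Z :=
  [tuple tnth x (s i) | i < q].

Lemma measurable_select q N (s : 'I_q -> 'I_N) : measurable_fun setT (select s).
Proof.
apply/measurable_fun_tnthP => i.
rewrite (_ : _ \o _ = (fun x => tnth x (s i))); first exact: measurable_tnth.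
by apply/funext => x /=; rewrite tnth_mktuple.
Qed.

Definition select_prod q N (s1 s2 s3 s4 : 'I_q -> 'I_N) (g : q.-tuple Z -> R) (x : N.-tuple Z) : R :=
  g (select s1 x) * g (select s2 x) * g (select s3 x) * g (select s4 x).

(* Conditions on four index maps under which the integral of
   [select_prod s1 s2 s3 s4 f] is controlled by the fourth cumulant. *)
Definition cumulant_selection q N (s1 s2 s3 s4 : 'I_q -> 'I_N) := [/\
  forall j, (#|[pred i | s1 i == j]| + #|[pred i | s2 i == j]| + #|[pred i | s3 i == j]|
    + #|[pred i | s4 i == j]| \in [:: 2; 4])%N,
  exists j, (j \in codom s1) && (j \in codom s2),
  exists j, (j \in codom s1) && (j \in codom s3),
  (1 < q)%N || (N == 1)%N & (0 < q)%N].

Lemma cumulant_selection_cover q N (s1 s2 s3 s4 : 'I_q -> 'I_N) j :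
  cumulant_selection s1 s2 s3 s4 ->
  exists i, [|| s1 i == j, s2 i == j, s3 i == j | s4 i == j].
Proof.
move=> [/(_ j) + _ _ _ _]; apply: contraPP => H.
have c0 (s : 'I_q -> 'I_N) : (forall i, s i != j) -> #|[pred i | s i == j]| = 0%N.
  by move=> sj; apply: eq_card0 => i; rewrite !inE; apply/negbTE; exact: sj.
by rewrite !c0// => i; apply/negP => /eqP sj; apply: H; exists i; rewrite sj eqxx ?orbT.
Qed.

Section step_functions.
Context {I : finType}.
Variable B : I -> set Z.
Hypotheses (mB : forall b, measurable (B b)) (Boo : forall b, (mu (B b) < +oo)%E)
  (tB : disjoint_family B).
Local Notation lam B := (fine (mu B)).

Lemma step_fun_at q (c : {ffun 'I_q -> I} -> R) (b : {ffun 'I_q -> I}) x :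
  box (fun i => B (b i)) x -> step_fun B c x = c b.
Proof.
move=> xb; rewrite /step_fun (bigD1 b)//= indicE mem_set// mulr1 big1 ?addr0// => b' b'b.
rewrite indicE memNset ?mulr0// => xb'; move: b'b; rewrite (_ : b' = b) ?eqxx//.
by apply/ffunP => i; exact: (disjoint_family_inj tB (xb' i) (xb i)).
Qed.

Lemma step_fun_out q (c : {ffun 'I_q -> I} -> R) x i :
  (forall a, ~ B a (tnth x i)) -> step_fun B c x = 0.
Proof.
move=> xi; rewrite /step_fun big1// => b _.
by rewrite indicE memNset ?mulr0// => /(_ i); exact: xi.
Qed.

(** If every coordinate of x lies in a block, all factors are constant on that box. Otherwise some
    index map reads the uncovered coordinate, because the maps cover all of them, and both sides are
    0. *)
Lemma step_fun_select q N (s1 s2 s3 s4 : 'I_q -> 'I_N) (c : {ffun 'I_q -> I} -> R) x :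
  cumulant_selection s1 s2 s3 s4 ->
  select_prod s1 s2 s3 s4 (step_fun B c) x =
  step_fun B (fun b : {ffun 'I_N -> I} => c [ffun i => b (s1 i)] * c [ffun i => b (s2 i)] *
    c [ffun i => b (s3 i)] * c [ffun i => b (s4 i)]) x.
Proof.
move=> sel; have [[b xb]|nb] := pselect (exists b : {ffun 'I_N -> I}, box (fun i => B (b i)) x).
  have selE (s : 'I_q -> 'I_N) : step_fun B c (select s x) = c [ffun i => b (s i)].
    by apply: step_fun_at => i; rewrite tnth_mktuple ffunE.
  by rewrite /select_prod (step_fun_at _ xb) !selE.
have [j xj] : exists j, forall a, ~ B a (tnth x j).
  apply: contrapT => H; apply: nb.
  have /choice[b xb] : forall j, exists a, B a (tnth x j).
    by move=> j; apply: contrapT => /forallNP xj; apply: H; exists j.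
  by exists [ffun j => b j] => j; rewrite ffunE.
rewrite (step_fun_out _ xj) /select_prod.
have [i] := cumulant_selection_cover j sel.
have out (s : 'I_q -> 'I_N) : s i == j -> step_fun B c (select s x) = 0.
  by move=> /eqP sj; apply: (@step_fun_out q c (select s x) i); rewrite tnth_mktuple sj.
by case/or4P => /out ->; rewrite ?mulr0 ?mul0r ?mulr0 ?mul0r.
Qed.

Lemma integral_step_fun q (c : {ffun 'I_q -> I} -> R) :
  (\int[power_measure mu q]_x (step_fun B c x)%:E = (\sum_b c b * \prod_i lam (B (b i)))%:E)%E.
Proof.
have mb (b : {ffun 'I_q -> I}) : measurable (box (fun i => B (b i))) by exact: measurable_box.
have bE (b : {ffun 'I_q -> I}) : power_measure mu q (box (fun i => B (b i))) =
    (\prod_i lam (B (b i)))%:E by exact: (box_measureE (D := fun i => B (b i))).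
have i1 (b : {ffun 'I_q -> I}) : (power_measure mu q).-integrable setT
    (fun x => (\1_(box (fun i => B (b i))) x)%:E).
  apply/integrableP; split; first by apply/measurable_EFinP; exact: measurable_indic.
  rewrite (eq_integral (fun x => (\1_(box (fun i => B (b i))) x)%:E)) => [|x _].
    by rewrite integral_indic// setIT [ltLHS](bE b) ltry.
  by rewrite /= ger0_norm.
have ib (b : {ffun 'I_q -> I}) : (power_measure mu q).-integrable setT
    (fun x => (c b)%:E * (\1_(box (fun i => B (b i))) x)%:E)%E.
  by apply: integrableZl => //; exact: i1.
under eq_integral do (rewrite -sumEFin; under eq_bigr do rewrite EFinM).
rewrite integral_sum// -sumEFin; apply: eq_bigr => b _.
rewrite integralZl//.
by rewrite integral_indic// setIT EFinM; congr (_ * _)%E; exact: bE.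
Qed.

End step_functions.
End selections.

Section step_approximation.
Context {d dO : measure_display} {Z : measurableType d} {Omega : measurableType dO}.
Context {R : realType}.
Variables (mu : {sigma_finite_measure set Z -> \bar R}) (P : probability Omega R).
Variable eta : R.-ker Omega ~> Z.
Hypotheses (ZE : borel_space Z R) (muE : no_atoms mu) (PE : poisson_measure P mu eta).

Local Notation mean Y := (\int[P]_w Y w).
Local Notation lam B := (fine (mu B)).
Local Notation xi := (compensated mu eta).

Variables (k : nat) (q : 'I_k -> nat) (f : forall i : 'I_k, (q i).-tuple Z -> R)
  (Ig : 'I_k -> {RV P >-> R}).
Arguments f : clear implicits.
Hypotheses (fL : forall i, f i \in Lfun (power_measure mu (q i)) 2%:E)
  (f_ge0 : forall i, {ae power_measure mu (q i), forall x, 0 <= f i x})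
  (fI : forall i, is_multiple_integral mu eta (f i) (Ig i)).

Section blocks.
Variables (I : finType) (B : I -> set Z).
Hypotheses (mB : forall b, measurable (B b)) (Boo : forall b, (mu (B b) < +oo)%E)
  (tB : disjoint_family B).

Local Notation G := (step_sum mu eta B (average mu f B)).
Local Notation m := (fun b n => mean (fun w => xi (B b) w ^+ n)).

Let aX s : all_moments P (word_var mu eta B s). Proof. exact: (word_var_moments PE). Qed.

Lemma mean_step_sum2 : mean (fun w => G w ^+ 2) =
  moment2 m (average mu f B) (@index_word k q I).
Proof.
transitivity (mean (fun w => \sum_(p : block_index q I * block_index q I)
    (average mu f B p.1 * average mu f B p.2) *
    word_var mu eta B (index_word p.1 ++ index_word p.2) w)).
  apply: eq_Rintegral => w _.
  rewrite -(pair_bigA _ (fun p r => average mu f B p * average mu f B r *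
    word_var mu eta B (index_word p ++ index_word r) w))/=.
  rewrite expr2 {1}/step_sum mulr_suml; apply: eq_bigr => p _.
  rewrite /step_sum mulr_sumr; apply: eq_bigr => r _.
  by rewrite word_var_cat; ring.
rewrite mean_sum => [|p _]; last exact: all_momentsZ.
rewrite /moment2 pair_bigA; apply: eq_bigr => p _.
by rewrite meanZ// (mean_word ZE muE PE).
Qed.

Lemma mean_step_sum4 : mean (fun w => G w ^+ 4) =
  moment4 m (average mu f B) (@index_word k q I).
Proof.
transitivity (mean (fun w => \sum_(p : block_index q I * block_index q I * block_index q I *
    block_index q I) (average mu f B p.1.1.1 * average mu f B p.1.1.2 * average mu f B p.1.2 *
    average mu f B p.2) * word_var mu eta B (index_word p.1.1.1 ++ index_word p.1.1.2 ++
    index_word p.1.2 ++ index_word p.2) w)).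
  apply: eq_Rintegral => w _.
  rewrite -(pair_bigA _ (fun p r => average mu f B p.1.1 * average mu f B p.1.2 *
    average mu f B p.2 * average mu f B r *
    word_var mu eta B (index_word p.1.1 ++ index_word p.1.2 ++ index_word p.2 ++ index_word r) w))/=.
  rewrite -(pair_bigA _ (fun p r => \sum_l average mu f B p.1 * average mu f B p.2 *
    average mu f B r * average mu f B l *
    word_var mu eta B (index_word p.1 ++ index_word p.2 ++ index_word r ++ index_word l) w))/=.
  rewrite -(pair_bigA _ (fun p r => \sum_l' \sum_l average mu f B p * average mu f B r *
    average mu f B l' * average mu f B l *
    word_var mu eta B (index_word p ++ index_word r ++ index_word l' ++ index_word l) w))/=.
  rewrite 2!exprS expr2 {1}/step_sum mulr_suml; apply: eq_bigr => p _.
  rewrite {1}/step_sum mulr_suml mulr_sumr; apply: eq_bigr => r _.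
  rewrite {1}/step_sum mulr_suml 2!mulr_sumr; apply: eq_bigr => l _.
  rewrite /step_sum 3!mulr_sumr; apply: eq_bigr => l' _.
  by rewrite !word_var_cat; ring.
rewrite mean_sum => [|p _]; last exact: all_momentsZ.
rewrite /moment4 !pair_bigA; apply: eq_bigr => p _.
by rewrite meanZ// (mean_word ZE muE PE).
Qed.

Hypothesis q_gt0 : forall i, (0 < q i)%N.

(** The integral expands over the maps [b] from coordinates to blocks, with weight the product of
    the lam of the b j. [selected_cumulant_ge] bounds this weight by the cumulant of the four words
    read from [b]. *)
Lemma selection_le i N (s1 s2 s3 s4 : 'I_(q i) -> 'I_N) : cumulant_selection s1 s2 s3 s4 ->
  (\int[power_measure mu N]_x
     (select_prod s1 s2 s3 s4 (step_fun B (block_average mu B (f i))) x)%:E <=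
   (mean (fun w => G w ^+ 4) - 3 * mean (fun w => G w ^+ 2) ^+ 2)%:E)%E.
Proof.
move=> sel; under eq_integral do rewrite (step_fun_select tB _ _ sel).
rewrite integral_step_fun// lee_fin mean_step_sum2 mean_step_sum4.
pose h (s : 'I_(q i) -> 'I_N) (b : {ffun 'I_N -> I}) : block_index q I :=
  Tagged (fun j => {ffun 'I_(q j) -> I}) [ffun l => b (s l)].
have hE s b : index_word (h s b) = codom (b \o s).
  by apply: eq_codom => l; rewrite /= ffunE.
have m_ok b := xi_small_moments PE (mB b) (Boo b).
have m0 b : m b 0%N = 1 by case: (m_ok b).
have m1 b : m b 1%N = 0 by case: (m_ok b).
have m2 b : m b 2%N = lam (B b) by case: (m_ok b).
have m3 b : 0 <= m b 3%N by exact: (xi_moment_ge0 PE).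
have m4 b : m b 4%N = lam (B b) + 3 * lam (B b) ^+ 2 by case: (m_ok b).
have lam0 b : 0 <= lam (B b) by exact: fine_ge0.
have [D [j12 /andP[j1 j2]] [j13 /andP[j1' j3]] qN q0] := sel.
have e_uniq (p : block_index q I) : average mu f B p != 0 ->
    uniq (index_word p) && (index_word p != [::]).
  rewrite /average /block_average; case: ifP; last by rewrite eqxx.
  move=> p_inj _; apply/andP; split; first by [].
  by rewrite -size_eq0 size_codom card_ord -lt0n.
(* Every coordinate is read by one of the four index maps, so [b] can be recovered from its
   words. *)
have h_inj : injective (fun b => (h s1 b, h s2 b, h s3 b, h s4 b)).
  move=> b b' [/(congr1 (@index_word k q I)) + /(congr1 (@index_word k q I)) +
    /(congr1 (@index_word k q I)) + /(congr1 (@index_word k q I)) +].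
  rewrite !hE => e1 e2 e3 e4; apply/ffunP => j.
  have eq_at (s : 'I_(q i) -> 'I_N) l : codom (b \o s) = codom (b' \o s) -> s l == j -> b j = b' j.
    move=> ess /eqP <-; have := congr1 (fun t => nth (b (s l)) t (enum_rank l)) ess.
    by rewrite !nth_codom enum_rankK.
  by have [l /or4P[]] := cumulant_selection_cover j sel; exact: eq_at.
have := @fourth_cumulant_ge _ _ _ m (fun b => lam (B b)) (average mu f B) (@index_word k q I)
  lam0 m0 m1 m2 m3 m4 (average_ge0 fL f_ge0 mB Boo) e_uniq _ (h s1) (h s2) (h s3) (h s4)
  (fun b : {ffun 'I_N -> I} => \prod_j lam (B (b j))) h_inj.
apply => b; rewrite !hE => u1 u2 u3 u4.
exact: (selected_cumulant_ge lam0 m0 m1 m2 m4 D j1 j2 j1' j3 qN u1 u2 u3 u4).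
Qed.

End blocks.

Hypothesis q_gt0 : forall i, (0 < q i)%N.

Local Notation F := (integral_sum_rv Ig).

(** Take the atoms of all sets of the kernels [e i] as blocks. Both projections, of each kernel and
    of F, are then at least as close as the given step kernels and their integrals. *)
Lemma step_approximation (e : forall i, step_kernel mu (q i)) :
  exists (g : forall i, (q i).-tuple Z -> R) (s : R), [/\
    forall i, measurable_fun setT (@g i),
    forall i x, 0 <= @g i x,
    forall i, (\int[power_measure mu (q i)]_x ((f i x - @g i x) ^+ 2)%:E <=
               \int[power_measure mu (q i)]_x ((f i x - sk_fun (e i) x) ^+ 2)%:E)%E,
    0 <= s /\
    mean (fun w => F w ^+ 2) - s <=
      mean (fun w => (F w - \sum_(i < k) sk_integral eta (e i) w) ^+ 2) &
    forall i N (s1 s2 s3 s4 : 'I_(q i) -> 'I_N), cumulant_selection s1 s2 s3 s4 ->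
      (\int[power_measure mu N]_x (select_prod s1 s2 s3 s4 (@g i) x)%:E + (3 * s ^+ 2)%:E <=
       \int[P]_w (F w ^+ 4)%:E)%E].
Proof.
pose N := {i : 'I_k & 'I_(sk_size (e i))}.
pose S (p : N) := sk_set (tagged p).
pose phi i (a : 'I_(sk_size (e i))) : N := Tagged (fun i => 'I_(sk_size (e i))) a.
have Sphi i a : S (phi i a) = sk_set a by [].
have mS p : measurable (S p) by exact: sk_measurable.
have Soo p : (mu (S p) < +oo)%E by exact: sk_finite.
pose B := atom S.
have mB b : measurable (B b) by exact: measurable_atom.
have Boo b : (mu (B b) < +oo)%E by exact: atom_finite.
have tB : disjoint_family B by exact: disjoint_atom.
pose g i := step_fun B (block_average mu B (f i)).
pose G := step_sum mu eta B (average mu f B).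
pose c (p : block_index q {set N}) := refined_coef (phi (tag p)) (tagged p).
have c_inj p : c p != 0 -> injective (tagged p) by exact: refined_coef_inj.
have gL i : g i \in Lfun (power_measure mu (q i)) 2%:E by exact: step_fun_Lfun2.
have xi_atoms : {ae P, forall w, forall p : N,
    xi (S p) w = \sum_(b : {set N} | p \in b) xi (atom S b) w}.
  apply: ae_forall_fin => p; have := xi_bigsetU PE (fun b : {set N} => p \in b) mB Boo tB.
  by apply: filterS => w; rewrite -atom_cover.
have cE : {ae P, forall w, step_sum mu eta B c w = \sum_(i < k) sk_integral eta (e i) w}.
  apply: filterS xi_atoms => w xiS; rewrite /step_sum.
  rewrite -(sig_big_dep (fun=> true) (fun _ _ => true) (fun i (b : {ffun 'I_(q i) -> {set N}}) =>
    refined_coef (phi i) b * word_var mu eta B (codom b) w))/=.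
  apply: eq_bigr => i _; rewrite /sk_integral.
  rewrite (refined_coefE (Sphi i) (v := fun _ A => xi A w)).
  - apply: eq_bigr => b _; congr (_ * _).
    by rewrite /word_var codomE big_map big_enum.
  - by move=> _; exact: xi_set0.
  - by move=> _ p; exact: xiS.
have [split1 split2] := second_moment_split ZE muE PE fL fI mB Boo tB c_inj.
have aG : all_moments P G by exact: step_sum_moments.
(* The functions g are the block averages and s is the second moment of G. *)
exists g, (mean (fun w => G w ^+ 2)); split.
- by move=> i; exact: Lfun2_measurable (gL i).
- move=> i x; apply: sumr_ge0 => b _; rewrite mulr_ge0//.
  by apply: block_average_ge0 => //; exact: f_ge0.
- move=> i; pose c' := refined_coef (phi i).
  have c'L : step_fun B c' \in Lfun (power_measure mu (q i)) 2%:E by exact: step_fun_Lfun2.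
  rewrite (_ : sk_fun (e i) = step_fun B c'); last first.
    by apply/funext => x; exact: (refined_step_fun (Sphi i)).
  pose nu := power_measure mu (q i).
  have isq (u : (q i).-tuple Z -> R) : u \in Lfun nu 2%:E -> nu.-integrable setT (EFin \o (fun w => u w ^+ 2)).
    exact: Lfun2_integrable_sqr.
  have i2 (u v : (q i).-tuple Z -> R) : u \in Lfun nu 2%:E -> v \in Lfun nu 2%:E ->
    nu.-integrable setT (EFin \o (fun w => u w * v w)) by exact: Lfun2_integrable_mul.
  have fgL := Lfun2B (fL i) (gL i); have gcL := Lfun2B (gL i) c'L.
  have fcL := Lfun2B (fL i) c'L.
  rewrite -[leLHS]fineK; last by apply: integrable_fin_num => //; exact: (isq _ fgL).
  rewrite -[leRHS]fineK; last by apply: integrable_fin_num => //; exact: (isq _ fcL).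
  rewrite lee_fin -!/(Rintegral _ _ _).
  have iA : nu.-integrable setT (EFin \o (fun x => (f i x - g i x) ^+ 2 + (g i x - step_fun B c' x) ^+ 2)).
    exact: (integrableD measurableT (isq _ fgL) (isq _ gcL)).
  have iB : nu.-integrable setT (EFin \o
      (fun x => (f i x - g i x) * g i x - (f i x - g i x) * step_fun B c' x)).
    exact: (integrableB measurableT (i2 _ _ fgL (gL i)) (i2 _ _ fgL c'L)).
  apply: (@le_trans _ _ (\int[nu]_x (((f i x - g i x) ^+ 2 + (g i x - step_fun B c' x) ^+ 2) +
      2 * ((f i x - g i x) * g i x - (f i x - g i x) * step_fun B c' x)))); last first.
    by rewrite le_eqVlt; apply/orP; left; apply/eqP; apply: eq_Rintegral => x _; ring.
  rewrite RintegralD//; last by exact: (integrableZl measurableT 2 iB).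
  rewrite RintegralZl// RintegralB//; [|exact: (i2 _ _ fgL (gL i))|exact: (i2 _ _ fgL c'L)].
  rewrite (step_fun_orthogonal mB Boo tB (fL i)); last first.
    by move=> b; rewrite /block_average; case: ifP => [/injectiveP//|_]; rewrite eqxx.
  rewrite (step_fun_orthogonal mB Boo tB (fL i)); last by move=> b; exact: refined_coef_inj.
  rewrite subrr mulr0 addr0 RintegralD//; [|exact: isq|exact: isq].
  by rewrite lerDl Rintegral_ge0// => x _; exact: sqr_ge0.
- split; first by apply: Rintegral_ge0 => w _; exact: sqr_ge0.
  apply: (le_trans split1); rewrite le_eqVlt; apply/orP; left; apply/eqP.
  have FL := integral_sum_Lfun2 PE fI.
  have mc : measurable_fun setT (step_sum mu eta B c).
    by have [] := step_sum_moments PE mB Boo c.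
  have me : measurable_fun setT (fun w => \sum_(i < k) sk_integral eta (e i) w).
    have ae i (_ : true) := sk_integral_moments PE (e i).
    by have [] := all_moments_sum (index_enum 'I_k) ae.
  apply: mean_ae.
  + by apply: measurable_funX; apply: measurable_funB => //; exact: Lfun2_measurable FL.
  + by apply: measurable_funX; apply: measurable_funB => //; exact: Lfun2_measurable FL.
  + by apply: filterS cE => w /= ->.
- move=> i n s1 s2 s3 s4 sel; apply: le_trans (fourth_moment_le ZE muE PE fL f_ge0 fI mB Boo tB).
  apply: (@le_trans _ _ ((mean (fun w => G w ^+ 4) - 3 * mean (fun w => G w ^+ 2) ^+ 2)%:E +
    (3 * mean (fun w => G w ^+ 2) ^+ 2)%:E)%E).
    by rewrite leeD2r// selection_le.
  by rewrite -EFinD subrK.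
Qed.

End step_approximation.

(** * Powers of the control measure *)

Section box_uniqueness.
Context {d : measure_display} {Z : measurableType d} {R : realType}.
Variable mu : {sigma_finite_measure set Z -> \bar R}.

Lemma sigma_finite_exhaustion : exists F : nat -> set Z, [/\ \bigcup_n F n = setT,
  nondecreasing_seq F, forall n, measurable (F n) & forall n, (mu (F n) < +oo)%E].
Proof.
have /sigma_finiteP[F [FT ndF Foo]] := sigma_finiteT mu.
by exists F; split=> // n; case: (Foo n).
Qed.

Lemma box_cover (F : nat -> set Z) q : \bigcup_n F n = setT -> nondecreasing_seq F ->
  \bigcup_n box (fun _ : 'I_q => F n) = setT.
Proof.
move=> FT ndF; apply/seteqP; split=> // x _.
have /choice[N FN] : forall i : 'I_q, exists n, F n (tnth x i).
  move=> i; have [n _ Fn] : (\bigcup_n F n) (tnth x i) by rewrite FT.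
  by exists n.
exists (\max_i N i)%N => // i; move: (FN i); apply/subsetPset; apply: ndF.
exact: leq_bigmax.
Qed.

Lemma measurable_tuple_boxes q : @measurable _ (q.-tuple Z) =
  <<s [set A | exists2 D : 'I_q -> set Z, (forall i, measurable (D i)) & A = box D] >>.
Proof.
apply/seteqP; split; last first.
  apply: smallest_sub; first exact: sigma_algebra_measurable.
  by move=> _ [D mD ->]; exact: measurable_box.
apply: smallest_sub; first exact: smallest_sigma_algebra.
rewrite -bigcup_seq => A [i _ [B mB <-]]; apply: sub_sigma_algebra.
exists (fun j => if j == i then B else setT) => [j|]; first by case: ifP.
apply/seteqP; split=> x /=.
  by move=> [_ Bx] j; case: eqP => // ->.
by move=> /(_ i); rewrite eqxx.
Qed.

Lemma measure_unique_boxes q (m1 m2 : {measure set (q.-tuple Z) -> \bar R})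
    (F : nat -> set Z) : \bigcup_n F n = setT -> nondecreasing_seq F ->
  (forall n, measurable (F n)) -> (forall n, (m1 (box (fun _ : 'I_q => F n)) < +oo)%E) ->
  (forall D : 'I_q -> set Z, (forall i, measurable (D i)) -> m1 (box D) = m2 (box D)) ->
  forall A, measurable A -> m1 A = m2 A.
Proof.
move=> FT ndF mF Foo m12.
apply: (measure_unique _ (fun n => box (fun _ : 'I_q => F n)) (measurable_tuple_boxes q)) => //.
- move=> _ _ [D mD ->] [D' mD' ->]; exists (fun i => D i `&` D' i) => [i|].
    exact: measurableI.
  apply/seteqP; split=> x /=; first by move=> [Dx D'x] i; split.
  by move=> DD'x; split=> i; case: (DD'x i).
- by move=> n; exists (fun=> F n).
- exact: box_cover.
- by move=> _ [D mD ->]; exact: m12.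
Qed.

(** Reading coordinates through an injective map pushes the N-th power forward to a multiple of the
    q-th power, as boxes show. The factor comes from the unread coordinates and may be infinite, so
    the space is first cut into boxes of finite measure. *)
Lemma select_null q N (s : 'I_q -> 'I_N) (A : set (q.-tuple Z)) : injective s ->
  measurable A -> power_measure mu q A = 0%E -> power_measure mu N (select s @^-1` A) = 0%E.
Proof.
move=> s_inj mA A0; have [F [FT ndF mF Foo]] := sigma_finite_exhaustion.
have mpre (A' : set (q.-tuple Z)) : measurable A' -> measurable (select s @^-1` A').
  by move=> mA'; rewrite -[X in measurable X]setTI; exact: measurable_select.
have mbF n k : measurable (box (fun _ : 'I_k => F n)) by exact: measurable_box.
suff null n : power_measure mu N (select s @^-1` A `&` box (fun=> F n)) = 0%E.
  rewrite -[X in power_measure mu N X]setIT -(box_cover N FT ndF) setI_bigcupr.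
  have mI n : measurable (select s @^-1` A `&` box (fun _ : 'I_N => F n)).
    by apply: measurableI; [exact: mpre|exact: mbF].
  apply: measure_negligible; first by apply: bigcupT_measurable => n; exact: mI.
  by apply: negligible_bigcup => n; apply/negligibleP; [exact: mI|exact: null].
have [m1 m1E] : exists m1 : {measure set (q.-tuple Z) -> \bar R},
    forall A', m1 A' = power_measure mu N (select s @^-1` A' `&` box (fun=> F n)).
  pose m0 := measure_function_mrestr__canonical__measure_function_Measure (power_measure mu N) (mbF n N).
  by exists (measure_function_pushforward__canonical__measure_function_Measure m0 (measurable_select s)).
(* The mass carried by the coordinates that [s] does not read. *)
pose c := \prod_(j | j \notin codom s) fine (mu (F n)).
have c0 : 0 <= c by apply: prodr_ge0 => j _; exact: fine_ge0.
pose m2 := mscale (NngNum c0) (mrestr (power_measure mu q) (mbF n q)).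
have boxoo n' : (m1 (box (fun _ : 'I_q => F n')) < +oo)%E.
  rewrite m1E; apply: le_lt_trans (le_measure _ _ _ (@subIsetr _ _ _)) _; rewrite ?inE.
  - by apply: measurableI; [apply: mpre; exact: mbF|exact: mbF].
  - exact: mbF.
  - rewrite [X in (X < _)%E](_ : _ = (\prod_(j < N) fine (mu (F n)))%:E) ?ltry//.
    exact: box_measureE.
suff m12 (D : 'I_q -> set Z) : (forall i, measurable (D i)) -> m1 (box D) = m2 (box D).
  have := measure_unique_boxes FT ndF mF boxoo m12 mA; rewrite m1E => ->.
  have AF0 : power_measure mu q (A `&` box (fun=> F n)) = 0%E.
    apply/eqP; rewrite -measure_le0 -A0; apply: le_measure; rewrite ?inE//.
    by apply: measurableI => //; exact: mbF.
  by change ((c%:E * power_measure mu q (A `&` box (fun=> F n)))%E = 0%E); rewrite AF0 mule0.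
move=> mD; rewrite m1E.
change (power_measure mu N (select s @^-1` box D `&` box (fun=> F n)) =
  c%:E * power_measure mu q (box D `&` box (fun=> F n)))%E.
(* The sides of the pulled-back box: D i cut by F n at the coordinate s i, and F n at unread
   coordinates. *)
pose D' j := [set z | F n z /\ forall i, s i = j -> D i z].
have D's i : D' (s i) = D i `&` F n.
  apply/seteqP; split=> z /= [].
    by move=> Fz /(_ i erefl).
  by move=> Dz Fz; split=> // i' /s_inj ->.
have D'n j : j \notin codom s -> D' j = F n.
  move=> jn; apply/seteqP; split=> z /=; first by case.
  by move=> Fz; split=> // i si; move: jn; rewrite -si codom_f.
have D'F j : D' j `<=` F n by move=> z [].
have mD' j : measurable (D' j).
  have [/codomP[i ->]|/D'n ->//] := boolP (j \in codom s).
  by rewrite D's; exact: measurableI.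
have D'oo j : (mu (D' j) < +oo)%E.
  by apply: le_lt_trans (Foo n); apply: le_measure; rewrite ?inE//; exact: D'F.
rewrite (_ : _ `&` _ = box D'); last first.
  apply/seteqP; split=> x /=.
    move=> [Dx Fx] j; split; first exact: Fx.
    by move=> i <-; have := Dx i; rewrite tnth_mktuple.
  move=> D'x; split=> [i|j]; last by have [] := D'x j.
  by rewrite tnth_mktuple; have [_] := D'x (s i); exact.
rewrite (_ : _ `&` _ = box (fun i => D' (s i))); last first.
  apply/seteqP; split=> x /=; first by move=> [Dx Fx] i; rewrite D's; split; [exact: Dx|exact: Fx].
  by move=> D'x; split=> i; have := D'x i; rewrite D's => -[].
transitivity (\prod_j fine (mu (D' j)))%:E; first exact: box_measureE.
transitivity (c%:E * (\prod_i fine (mu (D' (s i))))%:E)%E; last first.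
  by congr (_ * _)%E; apply/esym; exact: box_measureE.
rewrite -EFinM; congr EFin.
rewrite (bigID (mem (codom s))) /= mulrC; congr (_ * _).
  by apply: eq_bigr => j /D'n ->.
have <- : \prod_(j <- codom s) fine (mu (D' j)) = \prod_i fine (mu (D' (s i))) by rewrite big_image.
by rewrite big_uniq//= map_inj_uniq ?enum_uniq.
Qed.

End box_uniqueness.

(** * Passage to the limit *)

Section L2_eventually.
Context {d : measure_display} {T : measurableType d} {R : realType}.
Variable m : {measure set T -> \bar R}.

Lemma L2_eventually (v : T -> R) (u : nat -> T -> R) (e : R) : 0 < e ->
  ('N[m]_2%:E[EFin \o (v \- u n)%R] @[n --> \oo] --> 0)%E ->
  \forall n \near \oo, (\int[m]_x ((v x - u n x) ^+ 2)%:E <= e%:E)%E.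
Proof.
move=> e0 H; have H1 := cvg_is_fine H.
have fH : fine 'N[m]_2%:E[EFin \o (v \- u n)%R]%E @[n --> \oo] --> (0 : R) by exact: fine_cvg.
have se0 : 0 < Num.sqrt e by rewrite sqrtr_gt0.
have H2 := cvgr_dist_lt _ _ fH _ se0.
near=> n; have fn : 'N[m]_2%:E[EFin \o (v \- u n)%R]%E \is a fin_num by near: n.
have nle : `|0 - fine 'N[m]_2%:E[EFin \o (v \- u n)%R]%E| < Num.sqrt e by near: n; exact: H2.
rewrite sub0r normrN in nle.
rewrite (eq_integral (fun x => `|(EFin \o (v \- u n)%R) x| ^+ 2)%E) => [|x _]; last first.
  by rewrite abse_EFin -EFin_expe real_normK ?num_real.
rewrite -Lnorm2_sqr -(fineK fn) -EFin_expe lee_fin -[leRHS]sqr_sqrtr ?(ltW e0)//.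
by rewrite -real_normK ?num_real// lerXn2r ?nnegrE// ltW.
Unshelve. all: by end_near. Qed.

End L2_eventually.

Lemma sqr_sum_le (R : realFieldType) k (u : 'I_k -> R) :
  (\sum_i u i) ^+ 2 <= k%:R * \sum_i u i ^+ 2.
Proof.
have uu : \sum_i \sum_j (u i ^+ 2 + u j ^+ 2) = 2 * (k%:R * \sum_i u i ^+ 2).
  under eq_bigr do rewrite big_split /= sumr_const card_ord -mulr_natl.
  by rewrite big_split /= sumr_const card_ord -mulr_sumr -mulr_natl; ring.
suff : 2 * (\sum_i u i) ^+ 2 <= \sum_i \sum_j (u i ^+ 2 + u j ^+ 2) by rewrite uu; lra.
rewrite expr2 mulr_suml mulr_sumr; apply: ler_sum => i _.
rewrite !mulr_sumr; apply: ler_sum => j _.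
by have := sqr_ge0 (u i - u j); lra.
Qed.

Section fourth_moment_approximation.
Context {d dO : measure_display} {Z : measurableType d} {Omega : measurableType dO}.
Context {R : realType}.
Variables (mu : {sigma_finite_measure set Z -> \bar R}) (P : probability Omega R).
Variable eta : R.-ker Omega ~> Z.
Hypotheses (ZE : borel_space Z R) (muE : no_atoms mu) (PE : poisson_measure P mu eta).

Local Notation mean Y := (\int[P]_w Y w).

Variables (k : nat) (q : 'I_k -> nat) (f : forall i : 'I_k, (q i).-tuple Z -> R)
  (Ig : 'I_k -> {RV P >-> R}).
Arguments f : clear implicits.
Hypotheses (fL : forall i, f i \in Lfun (power_measure mu (q i)) 2%:E)
  (f_ge0 : forall i, {ae power_measure mu (q i), forall x, 0 <= f i x})
  (fI : forall i, is_multiple_integral mu eta (f i) (Ig i)).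
Hypothesis q_gt0 : forall i, (0 < q i)%N.
Local Notation F := (integral_sum_rv Ig).
Local Notation v := (mean (fun w => F w ^+ 2)).

Lemma mean_sqr_error (e : forall i, step_kernel mu (q i)) (c : R) :
  (forall i, (\int[P]_w ((Ig i w - sk_integral eta (e i) w) ^+ 2)%:E <= c%:E)%E) ->
  mean (fun w => (F w - \sum_(i < k) sk_integral eta (e i) w) ^+ 2) <= k%:R * (k%:R * c).
Proof.
move=> ec.
have uL i : (fun w => Ig i w - sk_integral eta (e i) w) \in Lfun P 2%:E.
  apply: Lfun2B; first exact: (multiple_integral_Lfun2 PE (fI i)).
  by apply: all_moments_Lfun2; exact: (sk_integral_moments PE).
have ui i : P.-integrable setT (EFin \o (fun w => (Ig i w - sk_integral eta (e i) w) ^+ 2)).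
  exact: Lfun2_integrable_sqr.
have sL : (fun w => F w - \sum_(i < k) sk_integral eta (e i) w) \in Lfun P 2%:E.
  rewrite (_ : (fun _ => _) = fun w => \sum_(i < k) (Ig i w - sk_integral eta (e i) w)).
    by apply: Lfun2_sum.
  by apply/funext => w; rewrite sumrB.
have iS : P.-integrable setT (EFin \o (fun w => \sum_(i < k) (Ig i w - sk_integral eta (e i) w) ^+ 2)).
  rewrite (_ : EFin \o _ = fun w => \sum_(i < k) ((Ig i w - sk_integral eta (e i) w) ^+ 2)%:E)%E.
    by apply: integrable_sum => // i _; exact: ui.
  by apply/funext => w; rewrite /= sumEFin.
apply: (@le_trans _ _ (mean (fun w => k%:R * \sum_(i < k) (Ig i w - sk_integral eta (e i) w) ^+ 2))).
  apply: le_Rintegral => //; [exact: (Lfun2_integrable_sqr sL)|exact: (integrableZl measurableT k%:R iS)|].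
  by move=> w _; rewrite -sumrB sqr_sum_le.
rewrite RintegralZl//.
rewrite ler_wpM2l// /Rintegral (eq_integral (fun w => \sum_(i < k) ((Ig i w - sk_integral eta (e i) w) ^+ 2)%:E))%E; last first.
  by move=> w _; rewrite sumEFin.
rewrite integral_sum//.
rewrite -sum_fine => [|i _]; last by apply: integrable_fin_num => //; exact: ui.
rewrite mulr_natl -[X in c *+ X]card_ord -sumr_const; apply: ler_sum => i _.
by rewrite -lee_fin fineK//; apply: integrable_fin_num => //; exact: ui.
Qed.

Lemma fourth_moment_approximation (delta : R) : 0 < delta ->
  exists g : forall i, (q i).-tuple Z -> R, [/\
    forall i, measurable_fun setT (@g i),
    forall i x, 0 <= @g i x,
    forall i, (\int[power_measure mu (q i)]_x ((f i x - @g i x) ^+ 2)%:E <= delta%:E)%E &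
    forall i N (s1 s2 s3 s4 : 'I_(q i) -> 'I_N), cumulant_selection s1 s2 s3 s4 ->
      (\int[power_measure mu N]_x (select_prod s1 s2 s3 s4 (@g i) x)%:E + (3 * v ^+ 2)%:E <=
       \int[P]_w (F w ^+ 4)%:E + delta%:E)%E].
Proof.
move=> delta0; have v0 : 0 <= v by apply: Rintegral_ge0 => w _; exact: sqr_ge0.
(* The error in F is at most k^2 e2 <= e1 in mean square, so v - s <= e1. When s < v, 3 (v^2 - s^2)
   = 3 (v - s)(v + s) <= 6 v e1 <= delta; when v <= s nothing is lost. *)
pose e1 := delta / (6 * v + 1); pose e2 := Num.min delta (e1 / (k%:R * k%:R + 1)).
have e10 : 0 < e1 by rewrite divr_gt0// ltr_wpDl// mulr_ge0.
have kk0 : 0 < k%:R * k%:R + 1 :> R by rewrite ltr_wpDl// mulr_ge0.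
have e20 : 0 < e2 by rewrite lt_min delta0 divr_gt0.
have near_e i : exists e : step_kernel mu (q i),
    (\int[power_measure mu (q i)]_x ((f i x - sk_fun e x) ^+ 2)%:E <= e2%:E)%E /\
    (\int[P]_w ((Ig i w - sk_integral eta e w) ^+ 2)%:E <= e2%:E)%E.
  have [e [/(L2_eventually e20) H1 /(L2_eventually e20) H2]] := fI i.
  by have [n [n1 n2]] := filter_ex (filterI H1 H2); exists (e n).
pose e i := projT1 (cid (near_e i)).
have [e1e e2e] : (forall i, (\int[power_measure mu (q i)]_x ((f i x - sk_fun (e i) x) ^+ 2)%:E <= e2%:E)%E) /\
    (forall i, (\int[P]_w ((Ig i w - sk_integral eta (e i) w) ^+ 2)%:E <= e2%:E)%E).
  by split=> i; have [] := projT2 (cid (near_e i)).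
have [g [s [mg g0 fg [s0 sv] gs]]] := step_approximation ZE muE PE fL f_ge0 fI q_gt0 e.
exists g; split=> // [i|i N s1 s2 s3 s4 sel].
  by apply: le_trans (fg i) _; apply: le_trans (e1e i) _; rewrite lee_fin ge_min lexx.
apply: le_trans (leeD2r delta%:E (gs i N s1 s2 s3 s4 sel)).
rewrite -[leRHS]addeA; apply: leeD2l; rewrite -EFinD lee_fin.
have : v - s <= e1.
  apply: le_trans sv _; apply: le_trans (mean_sqr_error e2e) _.
  rewrite mulrA; apply: (@le_trans _ _ ((k%:R * k%:R) * (e1 / (k%:R * k%:R + 1)))).
    by rewrite ler_wpM2l ?mulr_ge0// ge_min lexx orbT.
  by rewrite mulrA ler_pdivrMr// mulrC ler_wpM2l ?(ltW e10)// lerDl.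
have [vs|sv' h] := leP v s.
  by move=> _; rewrite ler_wpDr ?(ltW delta0)// ler_pM2l// lerXn2r.
have : e1 * (6 * v + 1) = delta by rewrite mulfVK ?gt_eqF// ltr_wpDl// mulr_ge0.
by nra.
Qed.

End fourth_moment_approximation.

(** * Tonelli for concatenated tuples *)

Section fubini.
Context {d : measure_display} {Z : measurableType d} {R : realType}.
Variable mu : {sigma_finite_measure set Z -> \bar R}.
Context {a b : nat}.

Definition cat_pair (p : a.-tuple Z * b.-tuple Z) : (a + b).-tuple Z := [tuple of p.1 ++ p.2].

Lemma measurable_cat_pair : measurable_fun setT cat_pair.
Proof.
apply/measurable_fun_tnthP => i; case: (split_ordP i) => j ->.
  rewrite (_ : _ \o _ = (fun x => tnth x j) \o fst).
    by apply: measurableT_comp => //; exact: measurable_tnth.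
  by apply/funext => p /=; rewrite tnth_lshift.
rewrite (_ : _ \o _ = (fun x => tnth x j) \o snd).
  by apply: measurableT_comp => //; exact: measurable_tnth.
by apply/funext => p /=; rewrite tnth_rshift.
Qed.

Lemma power_measure_cat (A : set ((a + b).-tuple Z)) : measurable A ->
  power_measure mu (a + b) A = (power_measure mu a \x power_measure mu b)%E (cat_pair @^-1` A).
Proof.
move=> mA; have [F [FT ndF mF Foo]] := sigma_finite_exhaustion mu.
pose m2 := measure_function_pushforward__canonical__measure_function_Measure
  (power_measure mu a \x power_measure mu b)%E measurable_cat_pair.
apply: (measure_unique_boxes (m1 := power_measure mu (a + b)) (m2 := m2) FT ndF mF) => // [n|D mD].
  rewrite [X in (X < _)%E](_ : _ = (\prod_(j < a + b) fine (mu (F n)))%:E) ?ltry//.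
  exact: box_measureE.
rewrite [LHS](_ : _ = \prod_i mu (D i))%E; last exact: power_measure_box.
change ((\prod_i mu (D i))%E = (power_measure mu a \x power_measure mu b)%E (cat_pair @^-1` box D)).
rewrite (_ : _ @^-1` _ = box (D \o lshift b) `*` box (D \o @rshift a b)); last first.
  apply/seteqP; split=> -[x y] /=.
    move=> Dxy; split=> i /=; first by have := Dxy (lshift b i); rewrite tnth_lshift.
    by have := Dxy (rshift a i); rewrite tnth_rshift.
  move=> [Dx Dy] i; case: (split_ordP i) => j ->; rewrite ?tnth_lshift ?tnth_rshift.
    exact: Dx.
  exact: Dy.
rewrite product_measure1E; [|by apply: measurable_box => i; exact: mD..].
rewrite big_split_ord; congr (_ * _)%E.
  by apply/esym; apply: power_measure_box => i; exact: mD.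
by apply/esym; apply: power_measure_box => i; exact: mD.
Qed.

Lemma integral_cat (h : (a + b).-tuple Z -> \bar R) :
  measurable_fun setT h -> (forall x, (0 <= h x)%E) ->
  (\int[power_measure mu (a + b)]_x h x =
   \int[power_measure mu a]_x \int[power_measure mu b]_y h (cat_pair (x, y)))%E.
Proof.
move=> mh h0; pose nu := (power_measure mu a \x power_measure mu b)%E.
transitivity (\int[pushforward nu cat_pair]_x h x)%E.
  apply: eq_measure_integral; first exact: measurable_cat_pair.
  by move=> mc A mA _; exact: power_measure_cat.
rewrite ge0_integral_pushforward//; last exact: measurable_cat_pair.
rewrite preimage_setT fubini_tonelli1//.
- by apply: measurableT_comp => //; exact: measurable_cat_pair.
- by move=> p; exact: h0.
Qed.

End fubini.

Section selection_limit.
Context {d : measure_display} {Z : measurableType d} {R : realType}.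
Variable mu : {sigma_finite_measure set Z -> \bar R}.

Lemma select_ae q N (s : 'I_q -> 'I_N) (Q : q.-tuple Z -> Prop) : injective s ->
  {ae power_measure mu q, forall x, Q x} -> {ae power_measure mu N, forall x, Q (select s x)}.
Proof.
move=> s_inj [A [mA A0 QA]]; exists (select s @^-1` A); split.
- by rewrite -[X in measurable X]setTI; exact: measurable_select.
- exact: select_null.
- by move=> x Qx; exact: QA.
Qed.

Lemma measurable_select_prod q N (s1 s2 s3 s4 : 'I_q -> 'I_N) (g : q.-tuple Z -> R) :
  measurable_fun setT g -> measurable_fun setT (select_prod s1 s2 s3 s4 g).
Proof.
move=> mg; have mgs (s : 'I_q -> 'I_N) : measurable_fun setT (fun x => g (select s x)).
  by apply: measurableT_comp => //; exact: measurable_select.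
by do !apply: measurable_funM.
Qed.

Lemma select_prod_ge0 q N (s1 s2 s3 s4 : 'I_q -> 'I_N) (g : q.-tuple Z -> R) x :
  (forall y, 0 <= g y) -> 0 <= select_prod s1 s2 s3 s4 g x.
Proof. by move=> g0; rewrite !mulr_ge0. Qed.

End selection_limit.

Section almost_everywhere_limit.
Context {d : measure_display} {T : measurableType d} {R : realType}.
Variable m : {measure set T -> \bar R}.

(** The squared errors have a summable total integral, so their sum is finite almost everywhere and
    its terms tend to 0. No subsequence is extracted, as the rate is prescribed. *)
Lemma L2_summable_cvg_ae (f : T -> R) (g : nat -> T -> R) :
  measurable_fun setT f -> (forall n, measurable_fun setT (g n)) ->
  (forall n, (\int[m]_x ((f x - g n x) ^+ 2)%:E <= (1 / (2 ^ n.+1)%:R)%:E)%E) ->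
  {ae m, forall x, g n x @[n --> \oo] --> f x}.
Proof.
move=> mf mg fg; pose h n x := ((f x - g n x) ^+ 2)%:E.
have h0 n x : (0 <= h n x)%E by rewrite lee_fin sqr_ge0.
have mh n : measurable_fun setT (h n).
  by apply/measurable_EFinP; apply: measurable_funX; exact: measurable_funB.
have mH : measurable_fun setT (fun x => \sum_(0 <= n <oo) h n x)%E.
  by apply: ge0_emeasurable_sum => // n x _ _; exact: h0.
have : {ae m, forall x, setT x -> (\sum_(0 <= n <oo) h n x)%E \is a fin_num}.
  apply: integrable_ae => //; apply/integrableP; split=> //.
  rewrite (eq_integral (fun x => \sum_(0 <= n <oo) h n x))%E => [|x _]; last first.
    by rewrite gee0_abs// nneseries_ge0.
  rewrite integral_nneseries//.
  apply: (@le_lt_trans _ _ 1%:E); last exact: ltry.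
  apply: le_trans (epsilon_trick0 xpredT ler01); apply: lee_nneseries => n _.
    by move=> _; apply: integral_ge0 => x _; exact: h0.
  exact: fg.
apply: filterS => x /(_ Logic.I) fx; pose t n := (\sum_(n <= i <oo) h i x)%E.
have t0 : t n @[n --> \oo] --> 0%E.
  by apply: nneseries_tail_cvg => // ; rewrite -ge0_fin_numE// nneseries_ge0.
have hx : h n x @[n --> \oo] --> 0%E.
  apply: (squeeze_cvge _ (cvg_cst 0%E) t0); apply: nearW => n; rewrite h0 /= /t.
  have := @nneseries_lim_ge _ (h ^~ x) xpredT n n.+1 (fun i _ _ => h0 i x).
  by rewrite big_nat1.
have fx0 : (f x - g n x) ^+ 2 @[n --> \oo] --> (0 : R) by exact: fine_cvg hx.
apply/cvgrPdist_lt => e e0; have e2 : 0 < e ^+ 2 by rewrite exprn_gt0.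
have H := cvgr_dist_lt _ _ fx0 _ e2; near=> n.
have : `|0 - (f x - g n x) ^+ 2| < e ^+ 2 by near: n; exact: H.
rewrite sub0r normrN ger0_norm ?sqr_ge0// -[X in X < _]real_normK ?num_real//.
by rewrite ltr_pXn2r// nnegrE ltW.
Unshelve. all: by end_near. Qed.

End almost_everywhere_limit.

Lemma limn_einf_le (R : realType) (u : nat -> \bar R) (c : \bar R) :
  (\forall n \near \oo, (u n <= c)%E) -> (limn_einf u <= c)%E.
Proof.
move=> uc; rewrite limn_einf_lim; apply: lime_le; first exact: is_cvg_einfs.
apply: filterS uc => n; apply: le_trans; apply: ereal_inf_lbound.
by exists n => /=.
Qed.

Section selection_bound.
Context {d dO : measure_display} {Z : measurableType d} {Omega : measurableType dO}.
Context {R : realType}.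
Variables (mu : {sigma_finite_measure set Z -> \bar R}) (P : probability Omega R).
Variable eta : R.-ker Omega ~> Z.
Hypotheses (ZE : borel_space Z R) (muE : no_atoms mu) (PE : poisson_measure P mu eta).

Local Notation mean Y := (\int[P]_w Y w).

Variables (k : nat) (q : 'I_k -> nat) (f : forall i : 'I_k, (q i).-tuple Z -> R)
  (Ig : 'I_k -> {RV P >-> R}).
Arguments f : clear implicits.
Hypotheses (fL : forall i, f i \in Lfun (power_measure mu (q i)) 2%:E)
  (f_ge0 : forall i, {ae power_measure mu (q i), forall x, 0 <= f i x})
  (fI : forall i, is_multiple_integral mu eta (f i) (Ig i)).
Hypothesis q_gt0 : forall i, (0 < q i)%N.
Local Notation F := (integral_sum_rv Ig).
Local Notation v := (mean (fun w => F w ^+ 2)).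

(** Fatou along the approximations g n of accuracy 2^-(n+1). Injective index maps pull null sets
    back to null sets, so the convergence of g n transfers to each of the four factors. *)
Lemma selection_integral_le i N (s1 s2 s3 s4 : 'I_(q i) -> 'I_N) :
  injective s1 -> injective s2 -> injective s3 -> injective s4 ->
  cumulant_selection s1 s2 s3 s4 ->
  (\int[power_measure mu N]_x (select_prod s1 s2 s3 s4 (fun y => `|f i y|) x)%:E +
   (3 * v ^+ 2)%:E <= \int[P]_w (F w ^+ 4)%:E)%E.
Proof.
move=> i1 i2 i3 i4 sel; pose nu := power_measure mu N.
have d0 n : 0 < 1 / (2 ^ n.+1)%:R :> R by rewrite divr_gt0// ltr0n expn_gt0.
have approx n := fourth_moment_approximation ZE muE PE fL f_ge0 fI q_gt0 (d0 n).
pose g n := projT1 (cid (approx n)) i.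
have mg n : measurable_fun setT (g n) by have [+ _ _ _] := projT2 (cid (approx n)); exact.
have g0 n x : 0 <= g n x by have [_ + _ _] := projT2 (cid (approx n)); exact.
have fg n : (\int[power_measure mu (q i)]_x ((f i x - g n x) ^+ 2)%:E <= (1 / (2 ^ n.+1)%:R)%:E)%E.
  by have [_ _ + _] := projT2 (cid (approx n)); exact.
have gF n : (\int[nu]_x (select_prod s1 s2 s3 s4 (g n) x)%:E + (3 * v ^+ 2)%:E <=
    \int[P]_w (F w ^+ 4)%:E + (1 / (2 ^ n.+1)%:R)%:E)%E.
  by have [_ _ _ +] := projT2 (cid (approx n)); exact.
have g_cvg := L2_summable_cvg_ae (Lfun2_measurable (fL i)) mg fg.
pose G n x := (select_prod s1 s2 s3 s4 (g n) x)%:E.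
have mG n : measurable_fun setT (G n) by apply/measurable_EFinP; exact: measurable_select_prod.
have G0 n x : (0 <= G n x)%E by rewrite lee_fin select_prod_ge0.
have mf : measurable_fun setT (fun y => `|f i y|).
  by apply: measurableT_comp => //; exact: Lfun2_measurable (fL i).
have -> : (\int[nu]_x (select_prod s1 s2 s3 s4 (fun y => `|f i y|) x)%:E =
    \int[nu]_x limn_einf (G ^~ x))%E.
  apply: ae_eq_integral => //.
  - by apply/measurable_EFinP; exact: measurable_select_prod.
  - apply: (emeasurable_fun_cvg (fun n x => einfs (G ^~ x) n)).
      by move=> n; exact: measurable_fun_einfs.
    by move=> x _; rewrite limn_einf_lim; exact: is_cvg_einfs.
  pose cvg_at (s : 'I_(q i) -> 'I_N) x := g n (select s x) @[n --> \oo] --> f i (select s x).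
  have c12 : {ae nu, forall x, cvg_at s1 x /\ cvg_at s2 x}.
    by apply: filterS2 (select_ae i1 g_cvg) (select_ae i2 g_cvg) => x.
  apply: filterS3 c12 (select_ae i3 g_cvg) (select_ae i4 g_cvg) => x [c1 c2] c3 c4 _; apply/esym.
  suff : G n x @[n --> \oo] --> (select_prod s1 s2 s3 s4 (fun y => `|f i y|) x)%:E.
    by move=> /cvg_limn_einf_sup[].
  apply: cvg_EFin; first exact: nearW.
  (* The approximations are nonnegative, so their limit is its own absolute value at these
     points. *)
  have cN (s : 'I_(q i) -> 'I_N) : g n (select s x) @[n --> \oo] --> f i (select s x) ->
      g n (select s x) @[n --> \oo] --> `|f i (select s x)|.
    by move=> c; rewrite [X in X @ _](_ : _ = (fun n => `|g n (select s x)|));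
      [exact: cvg_norm|apply/funext => n; rewrite ger0_norm].
  by apply: cvgM; [apply: cvgM; [apply: cvgM|]|]; exact: cN.
have := fatou nu measurableT mG (fun n x _ => G0 n x); move=> /(leeD2r (3 * v ^+ 2)%:E) /le_trans; apply.
rewrite addeC -limn_einf_shift//; apply/lee_addgt0Pr => e e0.
apply: limn_einf_le; near=> n; rewrite addeC; apply: le_trans (gF n) _.
apply: leeD2l; rewrite lee_fin.
have : 1 / 2 ^+ n < e by near: n; exact: (near_infty_natSinv_expn_lt (PosNum e0)).
move=> /ltW; apply: le_trans; rewrite !div1r lef_pV2 ?posrE ?exprn_gt0 ?ltr0n ?expn_gt0//.
by rewrite natrX ler_weXn2l// ler1n.
Unshelve. all: by end_near. Qed.

End selection_bound.

(** * Contractions *)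

Lemma card_preim_inj (I J : finType) (s : I -> J) j : injective s ->
  #|[pred i | s i == j]| = (j \in codom s).
Proof.
move=> s_inj; case: (boolP (j \in codom s)) => [/codomP[i ->]|jn].
  transitivity #|pred1 i|; last exact: card1.
  by apply: eq_card => i'; rewrite !inE (inj_eq s_inj).
by apply: eq_card0 => i; rewrite !inE; apply: contraNF jn => /eqP <-; exact: codom_f.
Qed.

Lemma second_copy_lt a b (j : 'I_(a + b)) : ((if j < a then nat_of_ord j else j + b) < a + (b + b))%N.
Proof. by have := ltn_ord j; case: ifP; lia. Qed.

(** In a point (y, z, z') with y of length a and z, z' of length b, this map reads (y, z'), and
    [first_copy] reads (y, z). *)
Definition second_copy a b (j : 'I_(a + b)) : 'I_(a + (b + b)) := Ordinal (second_copy_lt j).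

Lemma first_copy_lt a b (j : 'I_(a + b)) : (j < a + (b + b))%N.
Proof. by have := ltn_ord j; lia. Qed.

Definition first_copy a b (j : 'I_(a + b)) : 'I_(a + (b + b)) := Ordinal (first_copy_lt j).

Lemma first_copy_inj a b : injective (@first_copy a b).
Proof. by move=> i j /(congr1 val)/= ?; apply/val_inj. Qed.

Lemma second_copy_inj a b : injective (@second_copy a b).
Proof.
move=> i j /(congr1 val)/=; have := ltn_ord i; have := ltn_ord j.
by do 2 case: ifP; move=> *; apply/val_inj => /=; lia.
Qed.

Section contraction_selection.
Variables q r l : nat.
Hypotheses (r_gt0 : (0 < r)%N) (rq : (r <= q)%N) (l_gt0 : (0 < l)%N) (lr : (l <= r)%N)
  (lq : (l < q)%N).
Local Notation m := (2 * q - r - l)%N.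

(* A point of Z^(m + l) is (y, z) with y = (gamma, t, s) and z the integrated
   variables.  Duplicating z after y, the square of a contraction becomes an integral
   over Z^(m + 2l) without exchanging the order of integration. *)
Lemma left_index_lt (i : 'I_q) : ((if i < l then m + i else i - l) < m + l)%N.
Proof. by have := ltn_ord i; case: ifP; lia. Qed.

Definition left_index (i : 'I_q) : 'I_(m + l) := Ordinal (left_index_lt i).

Lemma right_index_lt (i : 'I_q) :
  ((if i < l then m + i else if i < r then i - l else q - r + i - l) < m + l)%N.
Proof. by have := ltn_ord i; case: ifP; [|case: ifP]; lia. Qed.

Definition right_index (i : 'I_q) : 'I_(m + l) := Ordinal (right_index_lt i).

Lemma left_index_inj : injective left_index.
Proof.
move=> i j /(congr1 val)/=; have := ltn_ord i; have := ltn_ord j.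
by do 2 case: ifP; move=> *; apply/val_inj => /=; lia.
Qed.

Lemma right_index_inj : injective right_index.
Proof.
move=> i j /(congr1 val)/=; have := ltn_ord i; have := ltn_ord j.
by do 4 try (case: ifP => ?); move=> *; apply/val_inj => /=; lia.
Qed.

Lemma codom_first_left (j : 'I_(m + (l + l))) :
  (j \in codom (@first_copy m l \o left_index)) = (j < q - l)%N || (m <= j < m + l)%N.
Proof.
apply/codomP/idP => [[i ->]/=|jP]; first by have := ltn_ord i; case: ifP; lia.
have ilt n : (n < q)%N -> j = (if n < l then m + n else n - l)%N :> nat ->
    exists i, j = (@first_copy m l \o left_index) i.
  by move=> nq jn; exists (Ordinal nq); exact/val_inj.
have [jl|jl] := ltnP j (q - l).
  by apply: (ilt (j + l)%N); [|case: ifP]; lia.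
by apply: (ilt (j - m)%N); [|case: ifP]; lia.
Qed.

Lemma codom_second_left (j : 'I_(m + (l + l))) :
  (j \in codom (@second_copy m l \o left_index)) = (j < q - l)%N || (m + l <= j < m + (l + l))%N.
Proof.
apply/codomP/idP => [[i ->]/=|jP].
  by have := ltn_ord i; have [nl|nl] := ltnP i l; case: ifP; lia.
have ilt n : (n < q)%N -> j = (if n < l then m + n + l else n - l)%N :> nat ->
    exists i, j = (@second_copy m l \o left_index) i.
  move=> nq jn; exists (Ordinal nq); apply/val_inj; rewrite /= jn.
  by have [nl|nl] := ltnP n l; case: ifP; lia.
have [jl|jl] := ltnP j (q - l).
  by apply: (ilt (j + l)%N); [|case: ifP]; lia.
by apply: (ilt (j - (m + l))%N); [|case: ifP]; lia.
Qed.

Lemma codom_first_right (j : 'I_(m + (l + l))) :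
  (j \in codom (@first_copy m l \o right_index)) =
  [|| (j < r - l)%N, (q - l <= j < m)%N | (m <= j < m + l)%N].
Proof.
apply/codomP/idP => [[i ->]/=|jP].
  by have := ltn_ord i; do 2 try (case: ifP => ?); lia.
have ilt n : (n < q)%N -> j = (if n < l then m + n else if n < r then n - l else q - r + n - l)%N :> nat ->
    exists i, j = (@first_copy m l \o right_index) i.
  by move=> nq jn; exists (Ordinal nq); exact/val_inj.
have [jl|jl] := ltnP j (r - l).
  by apply: (ilt (j + l)%N); [|do 2 try (case: ifP => ?)]; lia.
have [jm|jm] := ltnP j m.
  by apply: (ilt (j + r + l - q)%N); [|do 2 try (case: ifP => ?)]; lia.
by apply: (ilt (j - m)%N); [|do 2 try (case: ifP => ?)]; lia.
Qed.

Lemma codom_second_right (j : 'I_(m + (l + l))) :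
  (j \in codom (@second_copy m l \o right_index)) =
  [|| (j < r - l)%N, (q - l <= j < m)%N | (m + l <= j < m + (l + l))%N].
Proof.
apply/codomP/idP => [[i ->]/=|jP].
  have := ltn_ord i.
  by have [nl|nl] := ltnP i l; [|have [nr|nr] := ltnP i r]; case: ifP; lia.
have ilt n : (n < q)%N ->
    j = (if n < l then m + n + l else if n < r then n - l else q - r + n - l)%N :> nat ->
    exists i, j = (@second_copy m l \o right_index) i.
  move=> nq jn; exists (Ordinal nq); apply/val_inj; rewrite /= jn.
  by have [nl|nl] := ltnP n l; [|have [nr|nr] := ltnP n r]; case: ifP; lia.
have [jl|jl] := ltnP j (r - l).
  by apply: (ilt (j + l)%N); [|do 2 try (case: ifP => ?)]; lia.
have [jm|jm] := ltnP j m.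
  by apply: (ilt (j + r + l - q)%N); [|do 2 try (case: ifP => ?)]; lia.
by apply: (ilt (j - (m + l))%N); [|do 2 try (case: ifP => ?)]; lia.
Qed.

(** The variables gamma are read by all four maps; t by the two left ones, s by the two right ones,
    z and z' by the two maps of one copy. Left and right share z as l > 0, and the two left maps
    share gamma or t as l < q, which also gives q > 1. *)
Lemma contraction_selection : cumulant_selection
  (@first_copy m l \o left_index) (@first_copy m l \o right_index)
  (@second_copy m l \o left_index) (@second_copy m l \o right_index).
Proof.
have fi := @first_copy_inj m l; have si := @second_copy_inj m l.
have li := left_index_inj; have ri := right_index_inj.
split; last by lia.
- move=> j; rewrite !card_preim_inj; [|exact: inj_comp..].
  rewrite codom_first_left codom_second_left codom_first_right codom_second_right.
  have jN := ltn_ord j; rewrite !inE.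
  by case: (ltnP j (r - l)) => ?; case: (ltnP j (q - l)) => ?; case: (ltnP j m) => ?;
    case: (ltnP j (m + l)) => ?; lia.
- have mN : (m < m + (l + l))%N by lia.
  by exists (Ordinal mN); rewrite codom_first_left codom_first_right /=; lia.
- have mN : (0 < m + (l + l))%N by lia.
  by exists (Ordinal mN); rewrite codom_first_left codom_second_left /=; lia.
- by apply/orP; left; lia.
Qed.


Section contraction_norm.
Context {d : measure_display} {Z : measurableType d} {R : realType}.
Variables (mu : {sigma_finite_measure set Z -> \bar R}) (f : q.-tuple Z -> R).
Hypothesis mf : measurable_fun setT f.

Lemma select_comp n p s (t1 : 'I_n -> 'I_p) (t2 : 'I_p -> 'I_s) (x : s.-tuple Z) :
  select (t2 \o t1) x = select t1 (select t2 x).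
Proof. by apply: eq_from_tnth => i; rewrite !tnth_mktuple. Qed.

Lemma select_first_copy a b (y : a.-tuple Z) (z z' : b.-tuple Z) :
  select (@first_copy a b) (cat_pair (y, cat_pair (z, z'))) = cat_pair (y, z).
Proof.
apply: eq_from_tnth => i; rewrite tnth_mktuple !(tnth_nth point) /= !nth_cat !size_tuple.
by have := ltn_ord i; case: ifP => // ? ?; case: ifP => //; lia.
Qed.

Lemma select_second_copy a b (y : a.-tuple Z) (z z' : b.-tuple Z) :
  select (@second_copy a b) (cat_pair (y, cat_pair (z, z'))) = cat_pair (y, z').
Proof.
apply: eq_from_tnth => i; rewrite tnth_mktuple !(tnth_nth point) /= !nth_cat !size_tuple.
have [ia|ia] := ltnP i a; first by rewrite ia.
rewrite !ifF; [|lia..]; congr nth; lia.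
Qed.

Lemma star_contractionE (g : q.-tuple Z -> R) (y : m.-tuple Z) :
  star_contraction mu g g r l y = (\int[power_measure mu l]_z
    (g (select left_index (cat_pair (y, z))) * g (select right_index (cat_pair (y, z))))%:E)%E.
Proof.
apply: eq_integral => z _; congr (_ * _)%:E; congr g; apply: eq_from_tnth => i;
  rewrite !tnth_mktuple (tnth_nth point) /= -?takeD !nth_cat !size_tuple; have iq := ltn_ord i.
  have [il|il] := ltnP i l.
    by rewrite ifF; [congr nth|]; lia.
  by rewrite ifT ?nth_take //; lia.
have [il|il] := ltnP i l.
  by rewrite ifF; [congr nth|]; lia.
have [ir|ir] := ltnP i r.
  rewrite !ifT; [|lia..]; rewrite nth_take//; lia.
rewrite nth_drop ifF ?ifT; [congr nth| |]; do ? case: ifP; lia.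
Qed.

Let h (x : (m + l).-tuple Z) : R := f (select left_index x) * f (select right_index x).

Let mh : measurable_fun setT h.
Proof.
by apply: measurable_funM; apply: measurableT_comp => //; exact: measurable_select.
Qed.

(** The corresponding contraction of |f|, which dominates the contraction of f and is always defined
    as a nonnegative integral. *)
Let K (y : m.-tuple Z) : \bar R := (\int[power_measure mu l]_z `|h (cat_pair (y, z))|%:E)%E.

Let mhp : measurable_fun setT (fun p : m.-tuple Z * l.-tuple Z => h (cat_pair p)).
Proof. by apply: measurableT_comp => //; exact: measurable_cat_pair. Qed.

Let mhy y : measurable_fun setT (fun z => h (cat_pair (y, z))).
Proof. exact: (measurableT_comp mhp (pair1_measurable y)). Qed.

Let mK : measurable_fun setT K.
Proof.
apply: (@measurable_fun_fubini_tonelli_F _ _ _ _ _ (power_measure mu l) (fun p => `|h (cat_pair p)|%:E)) => //.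
by apply/measurable_EFinP; exact: measurableT_comp.
Qed.

Let K0 y : (0 <= K y)%E. Proof. by apply: integral_ge0. Qed.

Let measurable_star : measurable_fun setT (fun y : m.-tuple Z => star_contraction mu f f r l y).
Proof.
pose H (p : m.-tuple Z * l.-tuple Z) := (h (cat_pair p))%:E.
have mH : measurable_fun setT H by apply/measurable_EFinP.
rewrite (_ : (fun _ => _) = fun y => (\int[power_measure mu l]_z H^\+ (y, z) -
  \int[power_measure mu l]_z H^\- (y, z))%E).
  apply: emeasurable_funB.
  - apply: (@measurable_fun_fubini_tonelli_F _ _ _ _ _ (power_measure mu l) (H^\+)%E) => //.
    exact: measurable_funepos.
  - apply: (@measurable_fun_fubini_tonelli_F _ _ _ _ _ (power_measure mu l) (H^\-)%E) => //.
    exact: measurable_funeneg.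
by apply/funext => y; rewrite star_contractionE integralE; congr (_ - _)%E; apply: eq_integral => z _; rewrite ?funeposE ?funenegE.
Qed.

(** The contraction is dominated by [K], and K(y)^2 is the double integral over z and z' of a
    product of four factors |f|. Concatenating y, z and z' gives the integral on the right. *)
Lemma contraction_norm_le :
  ('N[power_measure mu m]_2%:E[star_contraction mu f f r l] ^+ 2 <=
   \int[power_measure mu (m + (l + l))]_x (select_prod
     (@first_copy m l \o left_index) (@first_copy m l \o right_index)
     (@second_copy m l \o left_index) (@second_copy m l \o right_index)
     (fun y => `|f y|) x)%:E)%E.
Proof.
rewrite Lnorm2_sqr; under eq_integral do rewrite expe2.
apply: (@le_trans _ _ (\int[power_measure mu m]_y (K y * K y)))%E.
  have mS : measurable_fun setT (fun y : m.-tuple Z => `|star_contraction mu f f r l y|)%E.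
    by apply: measurableT_comp => //; exact: abse_measurable.
  apply: ge0_le_integral => //.
  - exact: emeasurable_funM.
  - exact: emeasurable_funM.
  move=> y _; have SK : (`|star_contraction mu f f r l y| <= K y)%E.
    rewrite star_contractionE; apply: le_abse_integral => //.
    by apply/measurable_EFinP; exact: mhy.
  exact: lee_pmul.
rewrite integral_cat; last 2 first.
- apply/measurable_EFinP; apply: measurable_select_prod; exact: measurableT_comp.
- by move=> x; rewrite lee_fin select_prod_ge0.
have mabs y : measurable_fun setT (fun z => `|h (cat_pair (y, z))|%:E).
  by apply/measurable_EFinP; exact: measurableT_comp (mhy y).
rewrite le_eqVlt; apply/orP; left; apply/eqP; apply: eq_integral => y _.
rewrite integral_cat; last 2 first.
- apply/measurable_EFinP; apply: (measurableT_comp (f := select_prod _ _ _ _ _)).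
    by apply: measurable_select_prod; exact: measurableT_comp.
  exact: (measurableT_comp measurable_cat_pair (pair1_measurable y)).
- by move=> x; rewrite lee_fin select_prod_ge0.
transitivity (\int[power_measure mu l]_z (K y * `|h (cat_pair (y, z))|%:E))%E.
  by rewrite ge0_integralZl.
apply: eq_integral => z _; rewrite muleC -ge0_integralZl_EFin//; apply: eq_integral => z' _.
rewrite -EFinM /select_prod !select_comp select_first_copy select_second_copy.
by rewrite /h !normrM mulrA.
Qed.

End contraction_norm.

End contraction_selection.

Section norms.
Context {R : realType}.
Local Open Scope ereal_scope.

Lemma le_sqrte (x y : \bar R) : 0 <= x -> x ^+ 2 <= y -> x <= sqrte y.
Proof.
move=> x0 xy; have <- : sqrte (x ^+ 2) = x.
  case: x x0 {xy} => [r r0| _|//]; first by rewrite -EFin_expe /= sqrtr_sqr ger0_norm.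
  by rewrite expe2 mulyy.
by rewrite lee_sqrt// (le_trans _ xy)// expe_ge0.
Qed.

Lemma Lnorm4_exp {d : measure_display} {T : measurableType d} (m : {measure set T -> \bar R})
    (f : T -> R) : ('N[m]_4%:E[EFin \o f] ^+ 2) ^+ 2 = \int[m]_x (f x ^+ 4)%:E.
Proof.
transitivity ('N[m]_4%:E[EFin \o f] `^ 4).
  case: ('N[m]_4%:E[EFin \o f]) (Lnorm_ge0 m 4%:E (EFin \o f)) => [r r0| _|//].
    by rewrite poweR_EFin powR_mulrn// -!EFin_expe -expr2 -exprM.
  by rewrite poweRyr// !expe2 !mulyy.
rewrite poweR_Lnorm//; apply: eq_integral => x _.
rewrite poweR_EFin powR_mulrn// -[4%N]/(2 * 2)%N !exprM.
by rewrite real_normK ?num_real.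
Qed.

End norms.

Lemma select_id d (Z : measurableType d) n (x : n.-tuple Z) : select id x = x.
Proof. by apply: eq_from_tnth => i; rewrite tnth_mktuple. Qed.

(** All four maps read every coordinate, so the selected integral is that of f^4. For q = 1 there is
    a single coordinate, which is the alternative allowed in place of q > 1. *)
Lemma id_selection q : (0 < q)%N -> cumulant_selection (@id 'I_q) id id id.
Proof.
move=> q0; split=> //.
- by move=> j; rewrite !card_preim_inj// codomE map_id mem_enum.
- by exists (Ordinal q0); rewrite codomE map_id mem_enum.
- by exists (Ordinal q0); rewrite codomE map_id mem_enum.
- by lia.
Qed.

Theorem proposition3p9 (R : realType) (k : nat) (q : 'I_k -> nat)
    (k_ge1 : (1 <= k)%N) (q_ge1 : forall i, (1 <= q i)%N)
    (q_incr : forall i j : 'I_k, (i < j)%N -> (q i < q j)%N) :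
  exists C2 : R,
  forall (d : measure_display) (Z : measurableType d)
    (mu : {sigma_finite_measure set Z -> \bar R})
    (dO : measure_display) (Omega : measurableType dO)
    (P : probability Omega R) (eta : R.-ker Omega ~> Z)
    (f : forall i : 'I_k, (q i).-tuple Z -> R)
    (I : 'I_k -> {RV P >-> R}) (sigma : R),
  let F : Omega -> R := fun w => \sum_(i < k) I i w in
  borel_space Z R ->
  no_atoms mu ->
  poisson_measure P mu eta ->
  (forall i, L2_symmetric mu (f i)) ->
  (forall i, ~ {ae power_measure mu (q i), forall x, f i x = 0}) ->
  (forall i, {ae power_measure mu (q i), forall x, 0 <= f i x}) ->
  assumption_i mu f ->
  assumption_ii mu f ->
  assumption_iii mu f ->
  (forall i, is_multiple_integral mu eta (f i) (I i)) ->
  (sigma ^+ 2)%:E = 'E_P[(F ^+ 2)%R]%E ->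
  0 < sigma ^+ 2 ->
  (\big[maxe/0]_(i < k | (1 < q i)%N)
     \big[maxe/0]_(1 <= r < (q i).+1)
       \big[maxe/0]_(1 <= l < (minn r (q i - 1)).+1)
         'N[power_measure mu (2 * q i - r - l)]_2%:E[
           star_contraction mu (f i) (f i) r l]
   + \big[maxe/0]_(i < k) 'N[power_measure mu (q i)]_4%:E[EFin \o f i] ^+ 2
   <= C2%:E * sqrte ('E_P[F ^+ 4] - (3 * sigma ^+ 4)%:E))%E.

Proof.
(* Each of the two maxima is at most the square root, whence 2 = 1 + 1. *)
exists 2 => d Z mu dO Omega P eta f Ig sigma F ZE muE PE fS _ f_ge0 _ _ _ fI sigmaE _.
have fL i : f i \in Lfun (power_measure mu (q i)) 2%:E by have [] := fS i.
have vE : \int[P]_w (integral_sum_rv Ig w ^+ 2) = sigma ^+ 2.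
  by apply: EFin_inj; rewrite sigmaE unlock /Rintegral; rewrite unlock in sigmaE; rewrite -sigmaE.
pose X := ('E_P[F ^+ 4] - (3 * sigma ^+ 4)%:E)%E.
have selX i N (s1 s2 s3 s4 : 'I_(q i) -> 'I_N) :
    injective s1 -> injective s2 -> injective s3 -> injective s4 ->
    cumulant_selection s1 s2 s3 s4 ->
    (\int[power_measure mu N]_x (select_prod s1 s2 s3 s4 (fun y => `|f i y|%R) x)%:E <= X)%E.
  (* The term 3 sigma^4 is finite, so it may be moved across even when E F^4 is infinite. *)
  move=> i1 i2 i3 i4 sel; rewrite /X leeBrDr//.
  have := selection_integral_le ZE muE PE fL f_ge0 fI q_ge1 i1 i2 i3 i4 sel.
  by rewrite vE -exprM unlock.
have s0 : (0 <= sqrte X)%E by exact: sqrte_ge0.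
have -> : (2%:E * sqrte X = sqrte X + sqrte X)%E.
  by rewrite -[2]/(1 + 1) EFinD ge0_muleDl// !mul1e.
apply: leeD.
  apply: bigmax_le => // i qi; rewrite big_nat_cond; apply: bigmax_le => // r /andP[/andP[r0 rq] _].
  rewrite big_nat_cond; apply: bigmax_le => // l /andP[/andP[l0 lr] _].
  apply: le_sqrte; first exact: Lnorm_ge0.
  have rq' : (r <= q i)%N by lia.
  have lr' : (l <= r)%N by lia.
  have lq : (l < q i)%N by lia.
  apply: le_trans (contraction_norm_le r0 rq' l0 lr' lq mu (Lfun2_measurable (fL i))) _.
  apply: selX; last exact: contraction_selection.
  - by apply: inj_comp; [exact: first_copy_inj|exact: left_index_inj].
  - by apply: inj_comp; [exact: first_copy_inj|exact: right_index_inj].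
  - by apply: inj_comp; [exact: second_copy_inj|exact: left_index_inj].
  - by apply: inj_comp; [exact: second_copy_inj|exact: right_index_inj].
apply: bigmax_le => // i _; apply: le_sqrte; first by rewrite expe_ge0// Lnorm_ge0.
rewrite Lnorm4_exp.
have := selX i (q i) id id id id; move/(_ _ _ _ _ (id_selection (q_ge1 i))) => H.
apply: le_trans (H _ _ _ _) => //; rewrite le_eqVlt; apply/orP; left; apply/eqP.
apply: eq_integral => x _; rewrite /select_prod !select_id; congr EFin.
by rewrite -mulrA -!expr2 real_normK ?num_real// -exprM.
Qed.
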